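(* Let $d,n\in\mathbb{N}_{\geq1}$, $s\in\mathbb{N}_{\geq0}$, $0<\lambda\leq1$, $\gamma:=s+\lambda$, and let $1\leq t<\infty$. For any $0<\epsilon<1$ and any $\boldsymbol{f}:[0,1]^{d\times n}\to\mathbb{R}^{d\times n}$ whose components $f_{pq}$ all belong to $C^{s,\lambda}([0,1]^{d\times n})$, there exists a Transformer $\boldsymbol{T}:\mathbb{R}^{d\times n}\to\mathbb{R}^{d\times n}$ of length $n$ with size \begin{align*} &L_0=4,\quad W_0=\mathcal{O}(\epsilon^{-1/\gamma});\\ &H_1=(3d+1)\binom{s+dn-1}{dn-1},\quad S_1=\max\{dn,3\};\\ &L_l=3,\quad W_l=d\binom{s+dn-1}{dn-1}(4n+11),\quad l=1,\dots,n-1;\\ &H_l=3d\binom{s+dn-1}{dn-1},\quad S_l=3,\quad l=2,\dots,n;\\ &L_n=\mathcal{O}(\log\tfrac{1}{\epsilon}),\quad W_n=\mathcal{O}(\epsilon^{-dn/\gamma}) \end{align*} and dimension vector $\big(d,\ d+n+1,\ (2dn+5d)\binom{s+dn-1}{dn-1}\boldsymbol{1}_{1\times n},\ d\big)$ (i.e. $d_{in}=d$, $d_0=d+n+1$, $d_1=\dots=d_n=(2dn+5d)\binom{s+dn-1}{dn-1}$, $d_{out}=d$) such that for all $p\in[d],q\in[n]$, $$\|T_{pq}-f_{pq}\|_{L^t([0,1]^{d\times n})}\leq\epsilon.$$ Furthermore, the weight bounds of $\boldsymbol{T}$ are $B_{EB}=\mathcal{O}(1)$, $B_{FF}=\mathcal{O}(\epsilon^{-(7dn+\gamma+2)t/\gamma})$,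 $B_{SA}=\mathcal{O}(\log\frac{1}{\epsilon})$ and its numbers of parameters are $M_{EB}=\mathcal{O}(1)$, $M_{FF}=\mathcal{O}(\epsilon^{-dn/\gamma})$, $M_{SA}=\mathcal{O}(1)$. Here all $\mathcal{O}(\cdot)$ constants are independent of $\epsilon$.
   Context: Hölder space: for $\Omega\subset\mathbb{R}^D$, multi-indices $\boldsymbol{\mu}\in\mathbb{N}_{\geq0}^D$, $|\boldsymbol{\mu}|=\sum\mu_i$, $D^{\boldsymbol\mu}f$ the partial derivative; $\|f\|_{C^{s,\lambda}(\Omega)}:=\max\{\max_{|\boldsymbol\mu|\le s}\sup_{\Omega}|D^{\boldsymbol\mu}f|,\ \max_{|\boldsymbol\mu|=s}\sup_{x\neq y\in\Omega}|D^{\boldsymbol\mu}f(x)-D^{\boldsymbol\mu}f(y)|/\|x-y\|_2^\lambda\}$, and $C^{s,\lambda}(\Omega)$ is the set of functions with finite norm (here $[0,1]^{d\times n}$ is identified with $[0,1]^{dn}$). $L^t$ is w.r.t. Lebesgue measure. $[m]=\{1,\dots,m\}$. Transformers: $\sigma_R(x)=\max\{x,0\}$ entrywise; $\sigma_S$ is the column-wise softmax, $[\sigma_S(\boldsymbol x)]_i=e^{x_i}/\sum_{j=1}^n e^{x_j}$ applied to each column. A ReLU FNN $f:\mathbb{R}^a\to\mathbb{R}^b$ of depth $L$ and width $W$: $f_0=x$, $f_l=\sigma_R(W_lf_{l-1}+b_l)$ for $1\le l\le L-1$, $f=W_Lf_{L-1}+b_L$, with $W_1\in\mathbb{R}^{W\times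 a}$, $W_l\in\mathbb{R}^{W\times W}$ ($2\le l\le L-1$), $W_L\in\mathbb{R}^{b\times W}$, $b_l\in\mathbb{R}^W$, $b_L\in\mathbb{R}^b$. The feedforward block $\mathcal F_{FF}:\mathbb{R}^{a\times n}\to\mathbb{R}^{b\times n}$ generated by $f$ applies $f$ to each column (biases $b_l\boldsymbol 1_{1\times n}$). A self-attention layer $\mathcal F_{SA}:\mathbb{R}^{D\times n}\to\mathbb{R}^{D\times n}$ with head number $H$ and head size $S$: $\mathcal F_{SA}(X)=X+\sum_{h=1}^H W_O^{(h)}W_V^{(h)}X\sigma_S(X^\top W_K^{(h)\top}W_Q^{(h)}X)$, $W_O^{(h)}\in\mathbb{R}^{D\times S}$, $W_V^{(h)},W_K^{(h)},W_Q^{(h)}\in\mathbb{R}^{S\times D}$. An embedding layer is $\mathcal F_{EB}(X)=W_{EB}X+B_{EB}$. A Transformer of length $K$ is $\mathcal F_{FF}^{(K)}\circ\mathcal F_{SA}^{(K)}\circ\mathcal F_{FF}^{(K-1)}\circ\cdots\circ\mathcal F_{FF}^{(1)}\circ\mathcal F_{SA}^{(1)}\circ\mathcal F_{FF}^{(0)}\circ\mathcal F_{EB}$ with $\mathcal F_{EB}:\mathbb{R}^{d_{in}\times n}\to\mathbb{R}^{d_0\times n}$, $\mathcal F_{FF}^{(k)}:\mathbb{R}^{d_k\times n}\to\mathbb{R}^{d_{k+1}\times n}$ ($d_{K+1}:=d_{out}$), $\mathcal F_{SA}^{(k)}$ acting on $\mathbb{R}^{d_k\times n}$. Its size is $\{(L_0,W_0),(H_1,S_1),(L_1,W_1),\dots,(H_K,S_K),(L_K,W_K)\}$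 with $(L_k,W_k)$ depth/width of $\mathcal F_{FF}^{(k)}$ and $(H_k,S_k)$ head number/size of $\mathcal F_{SA}^{(k)}$; its dimension vector is $(d_{in},d_0,\dots,d_K,d_{out})$. $B_{EB},B_{FF},B_{SA}$ are upper bounds on absolute values of the parameters of the embedding layer, all feedforward blocks, and all self-attention layers respectively; $M_{EB},M_{FF},M_{SA}$ are the corresponding numbers of parameters. *)

(* Defs.v *)
From HB Require Import structures.
From Stdlib Require List.
From mathcomp Require Import all_boot all_order all_algebra.
From mathcomp Require Import all_classical all_reals all_analysis.

Set Implicit Arguments.
Unset Strict Implicit.
Unset Printing Implicit Defensive.

Import Order.TTheory GRing.Theory Num.Theory.
Import numFieldNormedType.Exports.

Local Open Scope classical_set_scope.
Local Open Scope ring_scope.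

Section Defs.
Variable R : realType.

Definition in_cube (d n : nat) (x : 'M[R]_(d, n)) : Prop :=
  forall i j, 0 <= x i j <= 1.

Definition in_open_cube (d n : nat) (x : 'M[R]_(d, n)) : Prop :=
  forall i j, 0 < x i j < 1.

Definition norm2 (d n : nat) (x : 'M[R]_(d, n)) : R :=
  Num.sqrt (\sum_(i < d) \sum_(j < n) x i j ^+ 2).

Definition mindex_abs (d n : nat) (mu : 'I_d -> 'I_n -> nat) : nat :=
  (\sum_(i < d) \sum_(j < n) mu i j)%N.

Definition mindex_dirs (d n : nat) (mu : 'I_d -> 'I_n -> nat) : seq 'M[R]_(d, n) :=
  flatten [seq nseq (mu k.1 k.2) (delta_mx k.1 k.2) | k <- enum {: 'I_d * 'I_n}].

Fixpoint iderive (d n : nat) (vs : seq 'M[R]_(d, n)) (g : 'M[R]_(d, n) -> R)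
  : 'M[R]_(d, n) -> R :=
  match vs with
  | [::] => g
  | v :: vs' => fun x => 'D_v (iderive vs' g) x
  end.

Fixpoint iderivable (d n : nat) (vs : seq 'M[R]_(d, n)) (g : 'M[R]_(d, n) -> R)
  : Prop :=
  match vs with
  | [::] => True
  | v :: vs' => iderivable vs' g /\
                forall x, in_open_cube x -> derivable (iderive vs' g) x v
  end.

Definition pderiv (d n : nat) (mu : 'I_d -> 'I_n -> nat) (g : 'M[R]_(d, n) -> R) :=
  iderive (mindex_dirs mu) g.

(* g belongs to the Hoelder space C^{s,lam}([0,1]^{d x n}), i.e. has finite
   Hoelder norm.  Derivatives are taken at interior points of the cube
   (sup over the cube = sup over its interior by continuity); g itself is
   continuous on the closed cube (implied by finiteness of the norm). *)
Definition holder (d n s : nat) (lam : R) (g : 'M[R]_(d, n) -> R) : Prop :=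
  [/\ forall mu, (mindex_abs mu <= s)%N -> iderivable (mindex_dirs mu) g,
      {within [set x | in_cube x], continuous g} &
      exists M : R,
        (forall mu, (mindex_abs mu <= s)%N ->
           forall x, in_open_cube x -> `|pderiv mu g x| <= M) /\
        (forall mu, mindex_abs mu = s ->
           forall x y, in_open_cube x -> in_open_cube y -> x != y ->
             `|pderiv mu g x - pderiv mu g y| <= M * (norm2 (x - y)) `^ lam)].

(* L^t norm on [0,1]^{d x n} w.r.t. Lebesgue measure, computed as an    *)
(* iterated integral of 1-dimensional Lebesgue integrals (Tonelli).     *)

Definition set_coord (d n : nat) (x : 'M[R]_(d, n)) (k : 'I_d * 'I_n) (y : R)
  : 'M[R]_(d, n) :=
  \matrix_(i, j) if (i, j) == k then y else x i j.

Fixpoint iter_integral (d n : nat) (ks : seq ('I_d * 'I_n))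
  (g : 'M[R]_(d, n) -> \bar R) : 'M[R]_(d, n) -> \bar R :=
  match ks with
  | [::] => g
  | k :: ks' => fun x =>
      (\int[lebesgue_measure]_(y in [set y : R | (0 <= y <= 1)%R])
         iter_integral ks' g (set_coord x k y))%E
  end.

Definition cube_integral (d n : nat) (g : 'M[R]_(d, n) -> \bar R) : \bar R :=
  iter_integral (enum {: 'I_d * 'I_n}) g 0.

Definition Ltnorm (d n : nat) (t : R) (h : 'M[R]_(d, n) -> R) : \bar R :=
  (cube_integral (fun x => (`|h x| `^ t)%:E) `^ t^-1)%E.

Definition nnz (m k : nat) (A : 'M[R]_(m, k)) : nat :=
  #|[set ij : 'I_m * 'I_k | A ij.1 ij.2 != 0]|.

Definition mx_bdd (m k : nat) (B : R) (A : 'M[R]_(m, k)) : Prop :=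
  forall i j, `|A i j| <= B.

Definition relu_mx (m k : nat) (A : 'M[R]_(m, k)) : 'M[R]_(m, k) :=
  map_mx (fun x => Num.max x 0) A.

(* A ReLU FNN R^a -> R^b of width fnn_width and depth (size fnn_hid).+2:
   first layer W_1 (W x a), hidden layers W_2..W_{L-1} (W x W), last W_L (b x W). *)
Record FNN (a b : nat) := mkFNN {
  fnn_width : nat;
  fnn_W1 : 'M[R]_(fnn_width, a);
  fnn_b1 : 'cV[R]_fnn_width;
  fnn_hid : seq ('M[R]_fnn_width * 'cV[R]_fnn_width);
  fnn_WL : 'M[R]_(b, fnn_width);
  fnn_bL : 'cV[R]_b }.

Definition fnn_depth (a b : nat) (f : FNN a b) : nat := (size (fnn_hid f)).+2.

Definition fnn_eval (a b : nat) (f : FNN a b) (x : 'cV[R]_a) : 'cV[R]_b :=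
  fnn_WL f *m
    foldl (fun h p => relu_mx (p.1 *m h + p.2))
          (relu_mx (fnn_W1 f *m x + fnn_b1 f)) (fnn_hid f)
  + fnn_bL f.

Definition fnn_nnz (a b : nat) (f : FNN a b) : nat :=
  (nnz (fnn_W1 f) + nnz (fnn_b1 f)
   + \sum_(p <- fnn_hid f) (nnz p.1 + nnz p.2)
   + nnz (fnn_WL f) + nnz (fnn_bL f))%N.

Definition fnn_bdd (a b : nat) (B : R) (f : FNN a b) : Prop :=
  [/\ mx_bdd B (fnn_W1 f), mx_bdd B (fnn_b1 f),
      (forall p, p \in fnn_hid f -> mx_bdd B p.1 /\ mx_bdd B p.2),
      mx_bdd B (fnn_WL f) & mx_bdd B (fnn_bL f)].

Definition ff_block (a b n : nat) (f : FNN a b) (X : 'M[R]_(a, n)) : 'M[R]_(b, n) :=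
  \matrix_(i, j) fnn_eval f (col j X) i 0.

Definition softmax_col (m k : nat) (Z : 'M[R]_(m, k)) : 'M[R]_(m, k) :=
  \matrix_(i, j) (expR (Z i j) / \sum_(l < m) expR (Z l j)).

Record SAhead (D S : nat) := mkSAhead {
  sa_WO : 'M[R]_(D, S);
  sa_WV : 'M[R]_(S, D);
  sa_WK : 'M[R]_(S, D);
  sa_WQ : 'M[R]_(S, D) }.

Record SA (D : nat) := mkSA {
  sa_size : nat;
  sa_heads : seq (SAhead D sa_size) }.

Definition sa_headnum (D : nat) (A : SA D) : nat := size (sa_heads A).

Definition sa_eval (D n : nat) (A : SA D) (X : 'M[R]_(D, n)) : 'M[R]_(D, n) :=
  X + \sum_(h <- sa_heads A)
        (sa_WO h *m sa_WV h *m X *m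
           softmax_col (X^T *m (sa_WK h)^T *m sa_WQ h *m X)).

Definition sa_nnz (D : nat) (A : SA D) : nat :=
  (\sum_(h <- sa_heads A)
     (nnz (sa_WO h) + nnz (sa_WV h) + nnz (sa_WK h) + nnz (sa_WQ h)))%N.

Definition sa_bdd (D : nat) (B : R) (A : SA D) : Prop :=
  forall h, Stdlib.Lists.List.In h (sa_heads A) ->
    [/\ mx_bdd B (sa_WO h), mx_bdd B (sa_WV h), mx_bdd B (sa_WK h)
      & mx_bdd B (sa_WQ h)].

(* Transformers with dimension vector (din, d0, D 1_{1xK}, dout)        *)
(*   T = F_FF^(K) o F_SA^(K) o F_FF^(K-1) o ... o F_FF^(1) o F_SA^(1)   *)
(*       o F_FF^(0) o F_EB                                              *)
(* tf_mids lists the pairs (F_SA^(l), F_FF^(l)) for l = 1..K-1;         *)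
(* the length is K = (size tf_mids).+1.                                 *)

Record TF (n din d0 D dout : nat) := mkTF {
  tf_WEB : 'M[R]_(d0, din);
  tf_BEB : 'M[R]_(d0, n);
  tf_ff0 : FNN d0 D;
  tf_mids : seq (SA D * FNN D D);
  tf_saK : SA D;
  tf_ffK : FNN D dout }.

Definition tf_length n din d0 D dout (T : TF n din d0 D dout) : nat :=
  (size (tf_mids T)).+1.

Definition tf_sas n din d0 D dout (T : TF n din d0 D dout) : seq (SA D) :=
  rcons [seq p.1 | p <- tf_mids T] (tf_saK T).

Definition tf_ffmids n din d0 D dout (T : TF n din d0 D dout) : seq (FNN D D) :=
  [seq p.2 | p <- tf_mids T].

Definition tf_eval n din d0 D dout (T : TF n din d0 D dout)
  (X : 'M[R]_(din, n)) : 'M[R]_(dout, n) :=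
  ff_block (tf_ffK T)
    (sa_eval (tf_saK T)
       (foldl (fun Y p => ff_block p.2 (sa_eval p.1 Y))
              (ff_block (tf_ff0 T) (tf_WEB T *m X + tf_BEB T))
              (tf_mids T))).

Definition tf_nnz_EB n din d0 D dout (T : TF n din d0 D dout) : nat :=
  (nnz (tf_WEB T) + nnz (tf_BEB T))%N.

Definition tf_nnz_FF n din d0 D dout (T : TF n din d0 D dout) : nat :=
  (fnn_nnz (tf_ff0 T) + \sum_(f <- tf_ffmids T) fnn_nnz f + fnn_nnz (tf_ffK T))%N.

Definition tf_nnz_SA n din d0 D dout (T : TF n din d0 D dout) : nat :=
  (\sum_(A <- tf_sas T) sa_nnz A)%N.

Definition tf_bdd_EB n din d0 D dout (B : R) (T : TF n din d0 D dout) : Prop :=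
  mx_bdd B (tf_WEB T) /\ mx_bdd B (tf_BEB T).

Definition tf_bdd_FF n din d0 D dout (B : R) (T : TF n din d0 D dout) : Prop :=
  [/\ fnn_bdd B (tf_ff0 T), (forall f, Stdlib.Lists.List.In f (tf_ffmids T) -> fnn_bdd B f)
    & fnn_bdd B (tf_ffK T)].

Definition tf_bdd_SA n din d0 D dout (B : R) (T : TF n din d0 D dout) : Prop :=
  forall A, Stdlib.Lists.List.In A (tf_sas T) -> sa_bdd B A.

End Defs.

(* Main.v *)
(** Because each column carries its position as a one-hot vector, an attention
    score can be made to depend on positions only.  The softmax weights of the
    [l]-th self-attention layer are then constants, the layer writes a fixed
    invertible mixture of the columns of [X] into every column, and the last
    feedforward block undoes the mixture by a linear map; so this block sees the
    whole of [X] exactly, together with the position [q].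

    It then approximates [f_{pq}] on a grid with [N = O(eps^{-1/gam})] cells per
    coordinate.  Steep ramps produce the index of the cell of [X] (and [q]) as a
    single integer, a piecewise linear function of that integer with
    [n N^{dn} = O(eps^{-dn/gam})] breakpoints returns the coefficients of a local
    Taylor polynomial, and the monomials are evaluated by [O(log (1/eps))] layers
    of bounded width that implement Yarotsky's squaring.  The ramps are wrong only
    on slabs of total measure [O(eps^t)], where the output is bounded. *)
Require Import Defs.
From HB Require Import structures.
From Stdlib Require List.
From mathcomp Require Import all_boot all_order all_algebra.
From mathcomp Require Import all_classical all_reals all_analysis.
From mathcomp Require Import measurable_realfun.
From mathcomp Require Import zify ring lra.

Set Implicit Arguments.
Unset Strict Implicit.
Unset Printing Implicit Defensive.

Import Order.TTheory GRing.Theory Num.Theory.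
Import numFieldNormedType.Exports.

Local Open Scope classical_set_scope.
Local Open Scope ring_scope.


(** * Iterated integrals *)

(** The last block may have both width and number of weights of order eps^(-dn/gam), so its weight
    count must be linear in its width. Each wide layer (ramps, breakpoints of the table) is
    therefore joined only to a number of registers that does not depend on eps, and the
    multiplications act on such a bounded set of registers alone.

    On the slabs the computed index is meaningless, yet the output must stay bounded there. The
    registers that enter the multiplications are therefore clipped to [0,1], which is also the
    interval on which squaring is accurate. This is why the table stores coefficients after an
    affine rescaling to [0,1], and why a separate copy of each monomial is computed to undo the
    shift.

    The weights grow only through the slope 1/dl of the ramps and the size n N^(dn) of the table. A
    total slab measure of order eps^t forces dl to be of order eps^t / N, so the slope is of order
    eps^(-t - 1/gam). *)

Lemma ge0_le_integral_nomeas (d : measure_display) (T : measurableType d) (R : realType)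
    (mu : {measure set T -> \bar R}) (D : set T) (f g : T -> \bar R) :
  (forall x, D x -> (0 <= f x)%E) -> (forall x, D x -> (f x <= g x)%E) ->
  (\int[mu]_(x in D) f x <= \int[mu]_(x in D) g x)%E.
Proof.
move=> f0 fg.
have g0 x : D x -> (0 <= g x)%E by move=> Dx; exact: le_trans (f0 _ Dx) (fg _ Dx).
(* The integral of a nonnegative function is a supremum over the simple functions below it, hence
   monotone for arbitrary functions; measurability of the error is never established. *)
rewrite !ge0_integralE//; apply: ereal_sup_le => _ [h hf <-].
exists h => // x; apply: le_trans (hf x) _.
by rewrite /patch; case: ifPn => // xD; apply: fg; rewrite inE in xD.
Qed.

Lemma lebesgue_measure_unit_itv (R : realType) :
  lebesgue_measure [set y : R | 0 <= y <= 1] = 1%E.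
Proof.
have -> : [set y : R | 0 <= y <= 1] = [set` `[0, 1]%R].
  by apply/seteqP; split => x /=; rewrite in_itv.
by rewrite lebesgue_measure_itv /= lte01 sube0.
Qed.

Lemma measurable_unit_itv (R : realType) : measurable [set y : R | 0 <= y <= 1].
Proof.
have -> : [set y : R | 0 <= y <= 1] = [set` `[0, 1]%R].
  by apply/seteqP; split => x /=; rewrite in_itv.
exact: measurable_itv.
Qed.

Lemma integral_unit_itv_le (R : realType) (N : nat) (l u : nat -> R) (A b : R) :
  (forall i, l i <= u i) -> 0 <= A -> 0 <= b ->
  (\int[lebesgue_measure]_(y in [set y : R | (0 <= y <= 1)%R])
     (A + b * \sum_(i < N) \1_[set` `[l i, u i]] y)%:E
   <= (A + b * \sum_(i < N) (u i - l i))%:E)%E.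
Proof.
move=> lu A0 b0; have mD := @measurable_unit_itv R.
have mI i : measurable_fun [set y : R | (0 <= y <= 1)%R]
    (EFin \o (\1_[set` `[l i, u i]] : R -> R)).
  by apply/measurable_EFinP; apply: measurable_indic; exact: measurable_itv.
have mS : measurable_fun [set y : R | (0 <= y <= 1)%R]
    (fun y => \sum_(i < N) (EFin \o (\1_[set` `[l i, u i]] : R -> R)) y)%E.
  by apply: emeasurable_sum => i; exact: mI.
have -> : (fun y => (A + b * \sum_(i < N) \1_[set` `[l i, u i]] y)%:E) =
   (fun y => cst A%:E y + b%:E * \sum_(i < N) (\1_[set` `[l i, u i]] y)%:E)%E.
  by apply/funext => y; rewrite EFinD EFinM sumEFin.
rewrite ge0_integralD//; first last.
- by apply: emeasurable_funM => //; exact: measurable_cst.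
- by move=> y _; rewrite mule_ge0// sume_ge0// => i _; rewrite lee_fin.
rewrite integral_cst// [X in (_ * X + _)%E]lebesgue_measure_unit_itv mule1 EFinD leeD2l//.
rewrite ge0_integralZl//; first last.
- by move=> y _; rewrite sume_ge0// => i _; rewrite lee_fin.
rewrite EFinM lee_wpmul2l//.
rewrite ge0_integral_sum//; last by move=> i; exact: mI.
rewrite -sumEFin; apply: lee_sum => i _.
rewrite integral_indic//; apply: le_trans (_ : (lebesgue_measure [set` `[l i, u i]%R] <= _)%E).
  by apply: le_measure; rewrite ?inE//; exact: measurableI.
rewrite lebesgue_measure_itv /= lte_fin; case: ltP => // _.
by rewrite lee_fin subr_ge0.
Qed.

Lemma set_coordE (R : realType) (d n : nat) (x : 'M[R]_(d, n)) k y i j :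
  set_coord x k y i j = if (i, j) == k then y else x i j.
Proof. by rewrite mxE. Qed.

Lemma in_cube_set_coord (R : realType) (d n : nat) (x : 'M[R]_(d, n)) k (y : R) :
  in_cube x -> 0 <= y <= 1 -> in_cube (set_coord x k y).
Proof. by move=> xc y01 i j; rewrite set_coordE; case: ifP. Qed.

(** A majorant made of a constant plus indicators of intervals in single coordinates keeps its form
    under integration: integrating coordinate [k] replaces its indicators by the total length of the
    intervals. Only this explicit majorant is ever computed with, so [g] may be arbitrary. *)
Lemma iter_integral_le_sum (R : realType) (d n : nat) (N : nat) (l u : nat -> R) (A b : R)
    (g : 'M[R]_(d, n) -> \bar R) (ks : seq ('I_d * 'I_n)) :
  (forall i, l i <= u i) -> 0 <= A -> 0 <= b -> uniq ks ->
  (forall x, in_cube x -> (0 <= g x)%E) ->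
  (forall x, in_cube x ->
     (g x <= (A + b * \sum_(k : 'I_d * 'I_n) \sum_(i < N) \1_[set` `[l i, u i]] (x k.1 k.2))%:E)%E) ->
  forall x, in_cube x ->
  (0 <= iter_integral ks g x)%E /\
  (iter_integral ks g x <=
    (A + b * ((size ks)%:R * \sum_(i < N) (u i - l i)
     + \sum_(k | k \notin ks) \sum_(i < N) \1_[set` `[l i, u i]] (x k.1 k.2)))%:E)%E.
Proof.
move=> lu A0 b0 + g0 gle.
have I0 (r : R) : 0 <= \sum_(i < N) \1_[set` `[l i, u i]] r by apply: sumr_ge0 => i _.
have W0 : 0 <= \sum_(i < N) (u i - l i) by apply: sumr_ge0 => i _; rewrite subr_ge0.
elim: ks => [_|k ks IH /= /andP[kks uks]] x xc.
  split; first exact: g0.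
  by rewrite /= mul0r add0r; apply: gle.
have {}IH := IH uks; split; rewrite [iter_integral _ _]/=.
  apply: integral_ge0 => y y01; exact: (IH _ (in_cube_set_coord k xc y01)).1.
apply: (@le_trans _ _ (\int[lebesgue_measure]_(y in [set y : R | (0 <= y <= 1)%R])
     ((A + b * ((size ks)%:R * \sum_(i < N) (u i - l i)
     + \sum_(k' | k' \notin k :: ks) \sum_(i < N) \1_[set` `[l i, u i]] (x k'.1 k'.2)))
     + b * \sum_(i < N) \1_[set` `[l i, u i]] y)%:E)%E).
  apply: ge0_le_integral_nomeas => y y01.
    exact: (IH _ (in_cube_set_coord k xc y01)).1.
  apply: le_trans (IH _ (in_cube_set_coord k xc y01)).2 _.
  rewrite lee_fin (bigD1 k)//= set_coordE -surjective_pairing eqxx.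
  rewrite -addrA -mulrDr lerD2l ler_wpM2l// -addrA lerD2l addrC lerD2r.
  rewrite le_eqVlt; apply/orP; left; apply/eqP; apply: eq_big => k'.
    by rewrite inE negb_or andbC.
  by move=> /andP[_ kk']; rewrite set_coordE -surjective_pairing (negPf kk').
have B0 : 0 <= A + b * ((size ks)%:R * \sum_(i < N) (u i - l i)
     + \sum_(k' | k' \notin k :: ks) \sum_(i < N) \1_[set` `[l i, u i]] (x k'.1 k'.2)).
  rewrite addr_ge0// mulr_ge0// addr_ge0// ?mulr_ge0//.
  by apply: sumr_ge0.
apply: le_trans (integral_unit_itv_le N lu B0 b0) _.
rewrite lee_fin /= -[(size ks).+1%:R]natr1; lra.
Qed.

Lemma cube_integral_le (R : realType) (d n : nat) (N : nat) (l u : nat -> R) (A b : R)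
    (g : 'M[R]_(d, n) -> \bar R) :
  (forall i, l i <= u i) -> 0 <= A -> 0 <= b ->
  (forall x, in_cube x -> (0 <= g x)%E) ->
  (forall x, in_cube x ->
     (g x <= (A + b * \sum_(k : 'I_d * 'I_n) \sum_(i < N) \1_[set` `[l i, u i]] (x k.1 k.2))%:E)%E) ->
  (0 <= cube_integral g)%E /\
  (cube_integral g <= (A + b * ((d * n)%:R * \sum_(i < N) (u i - l i)))%:E)%E.
Proof.
move=> lu A0 b0 g0 gle.
have c0 : in_cube (0 : 'M[R]_(d, n)) by move=> i j; rewrite mxE lexx ler01.
have [h1 h2] := iter_integral_le_sum lu A0 b0 (enum_uniq {: 'I_d * 'I_n}) g0 gle c0.
split; first exact: h1.
apply: le_trans h2 _; rewrite -cardE card_prod !card_ord.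
rewrite [X in _ + _ * (_ + X)]big1 ?addr0// => k.
by rewrite mem_enum.
Qed.

(** Pointwise, the [t]-th power of [h] is at most (eps/2)^t plus M^t times the number of slabs that
    contain the point. The first term takes at most half of eps^t because (1/2)^t <= 1/2 for t >=
    1. *)
Lemma Ltnorm_le (R : realType) (d n : nat) (t eps M : R) (N : nat) (l u : nat -> R)
    (h : 'M[R]_(d, n) -> R) :
  1 <= t -> 0 < eps -> 0 <= M -> (forall i, l i <= u i) ->
  (forall x, in_cube x -> `|h x| <= M) ->
  (forall x, in_cube x -> (forall (k : 'I_d * 'I_n) (i : 'I_N), ~ (l i <= x k.1 k.2 <= u i)) ->
      `|h x| <= eps / 2) ->
  M `^ t * ((d * n)%:R * \sum_(i < N) (u i - l i)) <= eps `^ t / 2 ->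
  (Ltnorm t h <= eps%:E)%E.
Proof.
move=> t1 e0 M0 lu hM he small.
have t0 : 0 < t by exact: lt_le_trans t1.
have [c0 c1] : (0 <= cube_integral (fun X => (`|h X| `^ t)%:E))%E /\
   (cube_integral (fun X => (`|h X| `^ t)%:E) <= ((eps / 2) `^ t +
      M `^ t * ((d * n)%:R * \sum_(i < N) (u i - l i)))%:E)%E.
  apply: cube_integral_le => //; [exact: powR_ge0|exact: powR_ge0|].
  move=> x xc; rewrite lee_fin.
  have S0 : 0 <= \sum_(k : 'I_d * 'I_n) \sum_(i < N) \1_[set` `[l i, u i]] (x k.1 k.2) :> R.
    by apply: sumr_ge0 => k _; apply: sumr_ge0.
  case: (pselect (exists (k : 'I_d * 'I_n) (i : 'I_N), l i <= x k.1 k.2 <= u i)).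
    move=> [k [i ki]].
    apply: ler_wpDl; first exact: powR_ge0.
    rewrite -[X in X <= _]mulr1; apply: ler_pM; rewrite ?powR_ge0//.
      by apply: ge0_ler_powR; rewrite ?nnegrE//; [exact: ltW|exact: hM].
    rewrite (bigD1 k)//= (bigD1 i)//= indicE mem_set /=; last by rewrite in_itv.
    rewrite -addrA lerDl addr_ge0//; first by apply: sumr_ge0.
    by apply: sumr_ge0 => ? _; apply: sumr_ge0.
  move=> nex; apply: ler_wpDr; first by rewrite mulr_ge0// powR_ge0.
  apply: ge0_ler_powR; rewrite ?nnegrE//; first exact: ltW.
    by rewrite divr_ge0// ltW.
  by apply: he => // k i ki; apply: nex; exists k, i.
rewrite /Ltnorm.
have c2 : (cube_integral (fun X => (`|h X| `^ t)%:E) <= (eps `^ t)%:E)%E.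
  apply: le_trans c1 _; rewrite lee_fin.
  have -> : eps `^ t = eps `^ t / 2 + eps `^ t / 2 by field.
  apply: lerD => //.
  rewrite powRM ?(ltW e0)//; apply: ler_wpM2l; first exact: powR_ge0.
  rewrite -[X in X `^ _]powR_inv1// -powRrM mulN1r powRN lef_pV2 ?posrE ?powR_gt0//.
  rewrite -[X in X <= _]powRr1//; apply: ler_powR => //; lra.
have -> : eps%:E = ((eps `^ t)%:E `^ t^-1)%E.
  by rewrite poweR_EFin -powRrM divff ?gt_eqF// powRr1// ltW.
apply: gt0_ler_poweR => //; first by rewrite invr_ge0 ltW.
- by rewrite in_itv /= c0 leey.
- by rewrite in_itv /= leey lee_fin powR_ge0.
Qed.

(** * Local Taylor polynomials *)

Lemma is_derive_taylor_term (R : realType) (c a y : R) (i : nat) :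
  is_derive y 1 (fun z : R => c * (z - a) ^+ i.+1) (c * (i.+1%:R * (y - a) ^+ i)).
Proof.
have H : is_derive y (1:R) (fun z : R => z - a) 1.
  by apply: is_derive_eq; rewrite subr0.
have H2 := @is_deriveX R R (fun z : R => z - a) i.+1 y 1 1 H.
have H3 := @is_deriveZ R R R ((fun z : R => z - a) ^+ i.+1) c y 1 _ H2.
have -> : (fun z : R => c * (z - a) ^+ i.+1) = c *: (fun z : R => z - a) ^+ i.+1.
  by apply/funext => z; rewrite /= fctE.
apply: is_derive_eq; rewrite /GRing.scale /= -mulr_natl; ring.
Qed.

Lemma is_derive_taylor_poly (R : realType) (r : nat) (g : nat -> R) (a y : R) :
  is_derive y 1 (fun z : R => \sum_(i < r.+2) g i / i`!%:R * (z - a) ^+ i)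
    (\sum_(i < r.+1) g i.+1 / i`!%:R * (y - a) ^+ i).
Proof.
have -> : (fun z : R => \sum_(i < r.+2) g i / i`!%:R * (z - a) ^+ i) =
    cst (g 0%N) + \sum_(i < r.+1) (fun z : R => g i.+1 / (i.+1)`!%:R * (z - a) ^+ i.+1).
  apply/funext => z; rewrite big_ord_recl /= fact0 expr0 divr1 mulr1.
  by rewrite fctE; congr (_ + _); rewrite fct_sumE.
apply: is_derive_eq.
  apply: is_deriveD.
  apply: is_derive_sum => i; exact: is_derive_taylor_term.
rewrite add0r; apply: eq_bigr => i _.
rewrite factS natrM invfM; field.
by rewrite nat1r !pnatr_eq0 -lt0n fact_gt0.
Qed.

(** Induction on [r]: the derivative of the order [r.+1] remainder is the order [r] remainder of
    [g 1], so the mean value theorem contributes one factor [h]. At [r = 0] the remainder is the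
    oscillation of the last derivative. *)
Lemma taylor_holder_1d (R : realType) (r : nat) (g : nat -> R -> R) (lo hi a E h : R) :
  lo < a < hi -> hi - lo <= h -> 0 <= E ->
  (forall i y, (i < r)%N -> lo < y < hi -> is_derive y 1 (g i) (g i.+1 y)) ->
  (forall y, lo < y < hi -> `|g r y - g r a| <= E) ->
  forall y, lo < y < hi ->
    `|g 0%N y - \sum_(i < r.+1) g i a / i`!%:R * (y - a) ^+ i| <= E * h ^+ r.
Proof.
move=> ab hh E0; have h0 : 0 <= h by lra.
elim: r g => [|r IH] g dg gE y yb.
  by rewrite big_ord1 fact0 divr1 !expr0 !mulr1; apply: gE.
have {IH}dbnd : forall z, lo < z < hi ->
    `|g 1%N z - \sum_(i < r.+1) g i.+1 a / i`!%:R * (z - a) ^+ i| <= E * h ^+ r.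
  by apply: (IH (fun i => g i.+1)) => // i z ir zb; apply: dg.
pose rho z := g 0%N z - \sum_(i < r.+2) g i a / i`!%:R * (z - a) ^+ i.
pose drho z := g 1%N z - \sum_(i < r.+1) g i.+1 a / i`!%:R * (z - a) ^+ i.
have drhoP z : lo < z < hi -> is_derive z 1 rho (drho z).
  move=> zb; have d0 := dg 0%N z (ltn0Sn _) zb.
  have d1 := is_derive_taylor_poly r (g^~ a) a z.
  exact: is_deriveB.
have rho_a : rho a = 0.
  rewrite /rho big_ord_recl /= expr0 fact0 divr1 mulr1 subrr big1 ?addr0 ?subrr// => i _.
  by rewrite expr0n /= mulr0.
have rho_c z : lo < z < hi -> {for z, continuous rho}.
  move=> zb; apply: differentiable_continuous; apply/derivable1_diffP.
  exact: (@ex_derive _ _ _ _ _ _ _ (drhoP z zb)).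
(* The ordered form serves both sides of [a], where [rho] vanishes. *)
have key u v : lo < u < hi -> lo < v < hi -> u <= v -> `|rho v - rho u| <= E * h ^+ r.+1.
  move=> ub vb uv.
  have [||c /[!in_itv]/= /andP[uc cv] ->] := @MVT_segment _ rho drho u v uv.
  - by move=> z /[!in_itv]/= /andP[uz zv]; apply: drhoP; lra.
  - apply: continuous_in_subspaceT => z /[!inE]/= /[!in_itv]/= /andP[uz zv].
    by apply: rho_c; lra.
  rewrite normrM exprSr mulrA; apply: ler_pM => //.
    by apply: dbnd; lra.
  rewrite ger0_norm; lra.
rewrite -/(rho y).
case: (leP a y) => [ay|ya].
  by have := key a y ab yb ay; rewrite rho_a subr0.
by have := key y a yb ab (ltW ya); rewrite rho_a sub0r normrN.
Qed.

(** Moving along the unit direction of [k] is resetting coordinate [k], so the two difference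
    quotients are the same function of the increment. *)
Lemma is_derive_set_coord (R : realType) (d n : nat) (F : 'M[R]_(d, n) -> R) x k (y : R) :
  derivable F (set_coord x k y) (delta_mx k.1 k.2) ->
  is_derive y 1 (fun z => F (set_coord x k z)) ('D_(delta_mx k.1 k.2) F (set_coord x k y)).
Proof.
have E : (fun h : R => h^-1 *: ((F \o shift (set_coord x k y)) (h *: delta_mx k.1 k.2) - F (set_coord x k y)))
   = (fun h : R => h^-1 *: (((fun z => F (set_coord x k z)) \o shift y) (h *: (1:R)) - F (set_coord x k y))).
  apply/funext => h /=; congr (_ *: (F _ - _)).
  apply/matrixP => i j; rewrite !mxE [h *: 1]mulr1.
  case: ((i, j) =P k) => [<-|ne] /=; first by rewrite !eqxx mulr1.
  case: (i =P k.1) => [i1|]; case: (j =P k.2) => [j2|] /=; rewrite ?mulr0 ?add0r//.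
  by exfalso; apply: ne; rewrite i1 j2 -surjective_pairing.
move=> dF; split.
  by rewrite /derivable -E; exact: dF.
by rewrite /derive -E.
Qed.

Definition dirs (R : realType) (d n : nat) (ks : seq ('I_d * 'I_n))
    (mu : 'I_d * 'I_n -> nat) : seq 'M[R]_(d, n) :=
  flatten [seq nseq (mu k) (delta_mx k.1 k.2) | k <- ks].

(** [done] is meant to be a final segment of the enumeration of the coordinates: putting copies of
    the preceding coordinate in front then keeps the order prescribed by [mindex_dirs]. *)
Definition sorted_dirs (R : realType) (d n : nat) (done : seq ('I_d * 'I_n))
    (vs : seq 'M[R]_(d, n)) : Prop :=
  exists2 mu : 'I_d * 'I_n -> nat, forall k, k \notin done -> mu k = 0%N & vs = dirs R done mu.

Lemma dirs_zero_prefix (R : realType) (d n : nat) (ks done : seq ('I_d * 'I_n)) mu :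
  (forall k, k \in ks -> mu k = 0%N) -> dirs R (ks ++ done) mu = dirs R done mu.
Proof.
rewrite /dirs map_cat flatten_cat => mu0.
rewrite (_ : flatten _ = [::])//; elim: ks mu0 => //= k ks IH mu0.
by rewrite mu0 ?mem_head//= IH// => k' k'ks; rewrite mu0// inE k'ks orbT.
Qed.

Lemma eq_dirs (R : realType) (d n : nat) (ks : seq ('I_d * 'I_n)) mu mu' :
  {in ks, mu =1 mu'} -> dirs R ks mu = dirs R ks mu'.
Proof.
by move=> E; rewrite /dirs; congr flatten; apply/eq_in_map => k kks; rewrite E.
Qed.

Lemma sorted_dirs_cons (R : realType) (d n : nat) (done : seq ('I_d * 'I_n)) k i
    (vs : seq 'M[R]_(d, n)) :
  k \notin done -> sorted_dirs done vs ->
  sorted_dirs (k :: done) (nseq i (delta_mx k.1 k.2) ++ vs).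
Proof.
move=> kd [mu mu0 ->]; exists (fun k' => if k' == k then i else mu k').
  by move=> k'; rewrite inE negb_or => /andP[/negPf -> /mu0].
rewrite /dirs /= eqxx; congr (_ ++ flatten _); apply/eq_in_map => k' k'd.
by case: eqP k'd => // ->; rewrite (negPf kd).
Qed.

Lemma sorted_dirsP (R : realType) (d n : nat) (ks done : seq ('I_d * 'I_n))
    (vs : seq 'M[R]_(d, n)) :
  ks ++ done = enum {: 'I_d * 'I_n} -> sorted_dirs done vs ->
  exists2 mu : 'I_d -> 'I_n -> nat, vs = mindex_dirs R mu & mindex_abs mu = size vs.
Proof.
move=> E [mu mu0 ->]; exists (fun i j => mu (i, j)).
  rewrite /mindex_dirs -E -/(dirs R _ (fun k => mu (k.1, k.2))).
  rewrite (@eq_dirs _ _ _ _ _ mu); last by move=> [].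
  rewrite dirs_zero_prefix// => k kks; apply: mu0; apply/negP => kd.
  by have := enum_uniq {: 'I_d * 'I_n}; rewrite -E cat_uniq => /and3P[_ /hasPn /(_ _ kd) /negP].
rewrite /mindex_abs pair_big /= size_flatten /shape -map_comp sumnE big_map.
rewrite (eq_bigr (fun k => mu k)); last by move=> [].
rewrite -big_enum -E big_cat /= [X in (X + _)%N]big1_seq ?add0n.
  by apply: eq_bigr => k _; rewrite size_nseq.
move=> k /= kks; apply: mu0; apply/negP => kd.
by have := enum_uniq {: 'I_d * 'I_n}; rewrite -E cat_uniq => /and3P[_ /hasPn /(_ _ kd) /negP].
Qed.

Lemma iderivable_nseq (R : realType) (d n : nat) (r i : nat) (v : 'M[R]_(d, n)) vs g :
  iderivable (nseq r v ++ vs) g -> (i < r)%N ->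
  forall x, in_open_cube x -> derivable (iderive (nseq i v ++ vs) g) x v.
Proof.
elim: r => //= r IH [H1 H2]; rewrite ltnS leq_eqVlt => /orP[/eqP ->|] //; exact: IH.
Qed.

(* Only derivatives in the coordinate order of [mindex_dirs] (smallest coordinate
   outermost) are available, and mixed partials are not known to commute; [ks] must
   therefore list the coordinates from the largest to the smallest. *)
Fixpoint taylor_at (R : realType) (d n : nat) (g : 'M[R]_(d, n) -> R)
    (a : 'I_d * 'I_n -> R) (ks : seq ('I_d * 'I_n)) (r : nat) (vs : seq 'M[R]_(d, n))
    (x : 'M[R]_(d, n)) : R :=
  match ks with
  | [::] => iderive vs g x
  | k :: ks' => \sum_(i < r.+1) (x k.1 k.2 - a k) ^+ i / i`!%:R *
      taylor_at g a ks' (r - i) (nseq i (delta_mx k.1 k.2) ++ vs) (set_coord x k (a k))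
  end.

Lemma norm2_set_coord (R : realType) (d n : nat) (x : 'M[R]_(d, n)) k (y z : R) :
  norm2 (set_coord x k y - set_coord x k z) = `|y - z|.
Proof.
rewrite /norm2 pair_big /= (bigD1 k)//= big1 ?addr0.
  by rewrite !mxE -surjective_pairing eqxx sqrtr_sqr.
move=> k' kk'; rewrite !mxE -surjective_pairing (negPf kk') subrr expr0n//.
Qed.

Definition in_box (R : realType) (d n : nat) (lo hi : 'I_d * 'I_n -> R) (x : 'M[R]_(d, n)) :=
  forall k : 'I_d * 'I_n, lo k < x k.1 k.2 < hi k.

Lemma in_box_set_coord (R : realType) (d n : nat) (lo hi : 'I_d * 'I_n -> R)
    (x : 'M[R]_(d, n)) k y :
  in_box lo hi x -> lo k < y < hi k -> in_box lo hi (set_coord x k y).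
Proof.
move=> xb yb k'; rewrite set_coordE -surjective_pairing.
by case: eqP => [->|_].
Qed.

Lemma holder_sorted (R : realType) (d n s : nat) (lam : R) (g : 'M[R]_(d, n) -> R) :
  holder s lam g -> exists2 M : R, 0 <= M &
  forall ks done vs, ks ++ done = enum {: 'I_d * 'I_n} -> sorted_dirs done vs ->
   [/\ ((size vs <= s)%N -> iderivable vs g),
       ((size vs <= s)%N -> forall x, in_open_cube x -> `|iderive vs g x| <= M) &
       (size vs = s -> forall x y, in_open_cube x -> in_open_cube y -> x != y ->
             `|iderive vs g x - iderive vs g y| <= M * (norm2 (x - y)) `^ lam)].
Proof.
move=> [H1 _ [M [H2 H3]]].
have MM : M <= `|M| by exact: ler_norm.
exists `|M| => // ks done vs E /(sorted_dirsP E)[mu -> <-]; split=> [mus|mus x xc|mus x y xc yc xy].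
- exact: H1.
- exact: le_trans (H2 _ mus _ xc) MM.
- by apply: le_trans (H3 _ mus _ _ xc yc xy) _; rewrite ler_wpM2r// powR_ge0.
Qed.

(** A one-dimensional expansion in the first coordinate of [ks] leaves as coefficients derivatives
    at [a k], which are functions of the other coordinates with [r - i] orders of smoothness left;
    the induction applies to them. Each coordinate multiplies the bound by at most 1 + (r + 1) <= s
    + 2, which gives the power of [s.+2]. *)
Lemma taylor_at_approx (R : realType) (d n s : nat) (lam M h : R) (g : 'M[R]_(d, n) -> R)
    (lo hi a : 'I_d * 'I_n -> R) :
  0 <= lam -> 0 <= M -> 0 <= h ->
  (forall k, [/\ 0 <= lo k, hi k <= 1, lo k < a k < hi k & hi k - lo k <= h]) ->
  (forall ks done vs, ks ++ done = enum {: 'I_d * 'I_n} -> sorted_dirs done vs ->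
   [/\ ((size vs <= s)%N -> iderivable vs g),
       ((size vs <= s)%N -> forall x, in_open_cube x -> `|iderive vs g x| <= M) &
       (size vs = s -> forall x y, in_open_cube x -> in_open_cube y -> x != y ->
             `|iderive vs g x - iderive vs g y| <= M * (norm2 (x - y)) `^ lam)]) ->
  forall ks done vs r x, rev ks ++ done = enum {: 'I_d * 'I_n} -> sorted_dirs done vs ->
    (size vs + r)%N = s -> in_box lo hi x ->
    `|iderive vs g x - taylor_at g a ks r vs x| <=
      M * (s.+2%:R ^+ size ks) * (h ^+ r * h `^ lam).
Proof.
move=> lam0 M0 h0 box Hg.
have bc x : in_box lo hi x -> in_open_cube x.
  move=> xb i j; have := xb (i, j); have [/= b1 b2 b3 b4] := box (i, j); lra.
have hl0 : 0 <= h `^ lam by exact: powR_ge0.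
elim=> [|k ks IH] done vs r x E vsd rs xb.
  by rewrite /= subrr normr0 !mulr_ge0// exprn_ge0.
have E' : rev ks ++ (k :: done) = enum {: 'I_d * 'I_n} by rewrite -E rev_cons cat_rcons.
have kd : k \notin done.
  have := enum_uniq {: 'I_d * 'I_n}; rewrite -E cat_uniq => /and3P[_ /hasPn kn _].
  by apply/negP => /kn; rewrite mem_rev mem_head.
have [b1 b2 b3 b4] := box k.
have vsi i := sorted_dirs_cons i kd vsd.
have szi i : (i <= r)%N -> (size (nseq i (delta_mx k.1 k.2 : 'M[R]_(d, n)) ++ vs) + (r - i))%N = s.
  by move=> ir; rewrite size_cat size_nseq addnAC subnKC// addnC.
have xk : set_coord x k (x k.1 k.2) = x.
  apply/matrixP => i j; rewrite set_coordE; case: eqP => // ij.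
  by rewrite -ij.
have xa : in_box lo hi (set_coord x k (a k)) by apply: in_box_set_coord.
pose G i z := iderive (nseq i (delta_mx k.1 k.2) ++ vs) g (set_coord x k z).
have T1 : `|G 0%N (x k.1 k.2) - \sum_(i < r.+1) G i (a k) / i`!%:R * (x k.1 k.2 - a k) ^+ i|
     <= (M * h `^ lam) * h ^+ r.
  apply: (@taylor_holder_1d R r G (lo k) (hi k)) => //.
  - by rewrite mulr_ge0.
  - move=> i y ir yb; rewrite /G /=; apply: is_derive_set_coord.
    apply: (iderivable_nseq (r := r)) => //.
      by have [+ _ _] := Hg _ _ _ E' (vsi r); apply; rewrite -(szi r (leqnn _)) leq_addr.
    by apply: bc; apply: in_box_set_coord.
  - move=> y yb; rewrite /G.
    have [_ _ H3] := Hg _ _ _ E' (vsi r).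
    have yc : in_open_cube (set_coord x k y) by apply: bc; apply: in_box_set_coord.
    case: (eqVneq (set_coord x k y) (set_coord x k (a k))) => [->|ne].
      by rewrite subrr normr0 mulr_ge0.
    apply: le_trans (H3 _ _ _ _ _ ne) _ => //.
    + by rewrite -[RHS](szi r (leqnn _)) subnn addn0.
    + exact: bc.
    + rewrite ler_wpM2l// norm2_set_coord ge0_ler_powR ?nnegrE//.
      rewrite ler_norml; lra.
rewrite {1}/G /= xk in T1.
rewrite [taylor_at _ _ _ _ _ _]/=.
set S1 := \sum_(i < _) _ in T1; set S2 := \sum_(i < _) _.
have T2 : `|S1 - S2| <= (r.+1)%:R * (M * (s.+2%:R ^+ size ks) * (h ^+ r * h `^ lam)).
  rewrite /S1 /S2 -sumrB; apply: le_trans (ler_norm_sum _ _ _) _.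
  rewrite -[X in X%:R * _](card_ord r.+1) mulr_natl -sumr_const; apply: ler_sum => i _.
  have ir : (i <= r)%N by rewrite -ltnS.
  rewrite (_ : G i (a k) / i`!%:R * (x k.1 k.2 - a k) ^+ i =
    (x k.1 k.2 - a k) ^+ i / i`!%:R * G i (a k)); last by rewrite mulrC mulrA mulrAC.
  rewrite -mulrBr.
  have := IH _ _ (r - i)%N _ E' (vsi i) (szi i ir) xa; rewrite -/(G i (a k)) => IHi.
  rewrite normrM.
  have e1 : `|(x k.1 k.2 - a k) ^+ i / i`!%:R| <= h ^+ i.
    rewrite normrM normrX [`|_%:R^-1|]ger0_norm ?invr_ge0//.
    have e2 : `|x k.1 k.2 - a k| ^+ i <= h ^+ i.
      by apply: lerXn2r; rewrite ?nnegrE// ler_norml; have := xb k; lra.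
    rewrite ler_pdivrMr ?ltr0n ?fact_gt0//; apply: le_trans e2 _.
    by rewrite ler_peMr ?exprn_ge0// ler1n fact_gt0.
  apply: le_trans (ler_pM _ _ e1 IHi) _ => //.
  (* The [i] orders spent on the coefficient come back through the factor (x_k - a_k)^i. *)
  have -> : h ^+ r = h ^+ i * h ^+ (r - i) by rewrite -exprD subnKC.
  lra.
have -> : iderive vs g x - S2 = (iderive vs g x - S1) + (S1 - S2) by ring.
apply: le_trans (ler_normD _ _) _; apply: le_trans (lerD T1 T2) _.
have s1 : 1 <= s.+2%:R ^+ size ks :> R by rewrite exprn_ege1// ler1n.
have hr : 0 <= h ^+ r * h `^ lam by rewrite mulr_ge0// exprn_ge0.
have rs' : r.+1%:R <= s.+1%:R :> R by rewrite ler_nat ltnS -rs leq_addl.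
rewrite /= exprS.
apply: (@le_trans _ _ ((1 + r.+1%:R) * (M * (s.+2%:R ^+ size ks) * (h ^+ r * h `^ lam)))).
  rewrite mulrDl mul1r lerD2r mulrAC -mulrA ler_wpM2r// ?[h `^ _ * _]mulrC//.
  by rewrite -[X in X <= _]mulr1 ler_wpM2l.
have rs2 : 1 + r.+1%:R <= s.+2%:R :> R by rewrite -[s.+2%:R]natr1; lra.
apply: le_trans (ler_wpM2r (mulr_ge0 (mulr_ge0 M0 (le_trans ler01 s1)) hr) rs2) _.
by rewrite !mulrA [s.+2%:R * M]mulrC.
Qed.

(** * Taylor polynomials as combinations of monomials with bounded coefficients *)

Fixpoint nestsum (R : realType) (d n s : nat) (ks : seq ('I_d * 'I_n)) (c : seq nat -> R)
    (y : 'M[R]_(d, n)) : R :=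
  match ks with
  | [::] => c [::]
  | k :: ks' => \sum_(i < s.+1) y k.1 k.2 ^+ i * nestsum s ks' (fun w => c (nat_of_ord i :: w)) y
  end.

(** The degree is bounded in each coordinate separately, so that the set of words is a product and
    matches the nesting of [nestsum]; its size (s+1)^m does not depend on eps. *)
Fixpoint words (s m : nat) : seq (seq nat) :=
  match m with
  | 0 => [:: [::]]
  | m'.+1 => [seq i :: w | i <- iota 0 s.+1, w <- words s m']
  end.

Definition monomial (R : realType) (d n : nat) (ks : seq ('I_d * 'I_n)) (w : seq nat)
    (y : 'M[R]_(d, n)) : R :=
  \prod_(p <- zip ks w) y p.1.1 p.1.2 ^+ p.2.

Lemma nestsum_words (R : realType) (d n s : nat) (ks : seq ('I_d * 'I_n)) (c : seq nat -> R) y :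
  nestsum s ks c y = \sum_(w <- words s (size ks)) c w * monomial ks w y.
Proof.
elim: ks c => [|k ks IH] c.
  by rewrite /= big_seq1 /monomial big_nil mulr1.
rewrite [LHS]/= (_ : words _ _ = [seq i :: w | i <- iota 0 s.+1, w <- words s (size ks)])//.
rewrite big_allpairs_dep.
rewrite -[iota 0 s.+1]/(index_iota 0 s.+1) big_mkord; apply: eq_bigr => i _.
rewrite IH mulr_sumr; apply: eq_bigr => w _.
by rewrite /monomial /= big_cons /= mulrCA.
Qed.

Lemma nestsum_linear (R : realType) (d n s N : nat) (ks : seq ('I_d * 'I_n))
    (al : nat -> R) (c : nat -> seq nat -> R) y :
  nestsum s ks (fun w => \sum_(i < N) al i * c i w) y =
  \sum_(i < N) al i * nestsum s ks (c i) y.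
Proof.
elim: ks c => [|k ks IH] c //=.
under eq_bigr do rewrite (IH (fun i w => c i (_ :: w))) mulr_sumr.
rewrite exchange_big /=; apply: eq_bigr => i _.
by rewrite mulr_sumr; apply: eq_bigr => j _; rewrite mulrCA.
Qed.

Lemma nestsum_set_coord (R : realType) (d n s : nat) (ks : seq ('I_d * 'I_n))
    (c : seq nat -> R) y k z :
  k \notin ks -> nestsum s ks c (set_coord y k z) = nestsum s ks c y.
Proof.
elim: ks c => [|k' ks IH] c //=; rewrite inE negb_or => /andP[kk' kks].
apply: eq_bigr => i _; rewrite IH// set_coordE -surjective_pairing.
by rewrite eq_sym (negPf kk').
Qed.

(** Bounds, for all [j] at once, the sums over [i] of binomials that arise when the powers of
    [y - a] are expanded. *)
Definition binsum (R : realType) (s : nat) : R :=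
  \sum_(i < s.+1) \sum_(j < s.+1) 'C(i, j)%:R.

(** Expanding the powers of [y - a] binomially gives monomials in the coordinates themselves, which
    are the same for all cells. Only the coefficients depend on the cell, and they are bounded
    uniformly because [a] lies in the unit cube and the derivatives are bounded by [M]. The point
    [x] fixes the coordinates outside [ks]; none remain when [ks] lists them all. *)
Lemma taylor_at_nestsum (R : realType) (d n s : nat) (M : R) (g : 'M[R]_(d, n) -> R)
    (lo hi a : 'I_d * 'I_n -> R) :
  0 <= M ->
  (forall k, [/\ 0 <= lo k, hi k <= 1 & lo k < a k < hi k]) ->
  (forall ks done vs, ks ++ done = enum {: 'I_d * 'I_n} -> sorted_dirs done vs ->
     (size vs <= s)%N -> forall x, in_open_cube x -> `|iderive vs g x| <= M) ->
  forall ks done vs r x, rev ks ++ done = enum {: 'I_d * 'I_n} -> sorted_dirs done vs ->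
    (size vs + r)%N = s -> in_box lo hi x ->
    exists2 c : seq nat -> R, forall w, `|c w| <= M * binsum R s ^+ size ks &
      forall y : 'M[R]_(d, n), (forall k, k \notin ks -> y k.1 k.2 = x k.1 k.2) ->
        taylor_at g a ks r vs y = nestsum s ks c y.
Proof.
move=> M0 box Hg.
have bs0 : 0 <= binsum R s by apply: sumr_ge0 => i _; apply: sumr_ge0.
have bc x : in_box lo hi x -> in_open_cube x.
  move=> xb i j; have := xb (i, j); have [/= b1 b2 b3] := box (i, j); lra.
elim=> [|k ks IH] done vs r x E vsd rs xb.
  exists (fun _ => iderive vs g x).
    by move=> w; rewrite /= mulr1; apply: Hg E vsd _ _ (bc _ xb); rewrite -rs leq_addr.
  move=> y yx /=; congr iderive; apply/matrixP => i j; exact: (yx (i, j)).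
have E' : rev ks ++ (k :: done) = enum {: 'I_d * 'I_n} by rewrite -E rev_cons cat_rcons.
have un : uniq (k :: ks).
  by have := enum_uniq {: 'I_d * 'I_n}; rewrite -E cat_uniq rev_uniq => /and3P[].
have kks : k \notin ks by case/andP: un.
have kd : k \notin done.
  have := enum_uniq {: 'I_d * 'I_n}; rewrite -E cat_uniq => /and3P[_ /hasPn kn _].
  by apply/negP => /kn; rewrite mem_rev mem_head.
have rs1 : (r.+1 <= s.+1)%N by rewrite ltnS -rs leq_addl.
have [b1 b2 b3] := box k.
have xa : in_box lo hi (set_coord x k (a k)) by apply: in_box_set_coord.
have /choice[f fP] : forall i : nat, exists c : seq nat -> R, (i <= r)%N ->
    (forall w, `|c w| <= M * binsum R s ^+ size ks) /\
      forall y : 'M[R]_(d, n), (forall k', k' \notin ks -> y k'.1 k'.2 = set_coord x k (a k) k'.1 k'.2) ->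
        taylor_at g a ks (r - i) (nseq i (delta_mx k.1 k.2) ++ vs) y = nestsum s ks c y.
  move=> i; case: (leqP i r) => ir; last by exists (fun _ => 0).
  have [|c c1 c2] := IH _ _ (r - i)%N _ E' (sorted_dirs_cons i kd vsd) _ xa.
    by rewrite size_cat size_nseq -rs -addnA addnCA subnKC.
  by exists c.
have ak1 : `|a k| <= 1 by rewrite ler_norml; lra.
(* The coefficient of z^j in (z - a_k)^i / i!. *)
pose al j i : R := 'C(i, j)%:R * (- a k) ^+ (i - j) / i`!%:R.
pose c w := if w is j :: w' then \sum_(i < r.+1) al j i * f i w' else 0.
exists c.
  case=> [|j w]; first by rewrite normr0 mulr_ge0// exprn_ge0.
  rewrite /c; apply: le_trans (ler_norm_sum _ _ _) _.
  have al_le i : `|al j i| <= 'C(i, j)%:R.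
    rewrite /al -mulrA normrM ger0_norm// ler_piMr// normrM normrX normrN.
    rewrite [`|_^-1|]ger0_norm ?invr_ge0//.
    rewrite ler_pdivrMr ?ltr0n ?fact_gt0// mul1r.
    apply: (@le_trans _ _ 1); first by apply: exprn_ile1.
    by rewrite ler1n fact_gt0.
  apply: (@le_trans _ _ (\sum_(i < r.+1) 'C(i, j)%:R * (M * binsum R s ^+ size ks))).
    apply: ler_sum => i _; rewrite normrM; apply: ler_pM => //.
    by have [|+ _] := fP i; [rewrite -ltnS|exact].
  rewrite -mulr_suml [size (_ :: _)]/= exprS [M * (_ * _)]mulrCA; apply: ler_wpM2r.
    by rewrite mulr_ge0// exprn_ge0.
  case: (ltnP s j) => sj.
    rewrite big1// => i _; rewrite bin_small//.
    by apply: leq_ltn_trans sj; rewrite -ltnS; exact: leq_trans (ltn_ord i) rs1.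
  rewrite /binsum (@big_ord_widen _ _ _ r.+1 s.+1 (fun i => 'C(i, j)%:R))//.
  rewrite big_mkcond /=; apply: ler_sum => i _.
  have jP : (j < s.+1)%N by [].
  rewrite (bigD1 (Ordinal jP))//=.
  have Q : 0 <= \sum_(l < s.+1 | l != Ordinal jP) 'C(i, l)%:R :> R by apply: sumr_ge0.
  by case: ifP => _; rewrite ?lerDl// addr_ge0.
move=> y yx; rewrite /= .
transitivity (\sum_(i < r.+1) \sum_(j < s.+1) (y k.1 k.2 ^+ j * (al j i * nestsum s ks (f i) y))).
  apply: eq_bigr => i _.
  have ir : (i <= r)%N by rewrite -ltnS.
  have [_ ->//] := fP i ir; last first.
    move=> k' k'ks; rewrite !set_coordE -surjective_pairing; case: eqP => // kk'.
    by apply: yx; rewrite inE negb_or k'ks andbT; apply/eqP.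
  rewrite nestsum_set_coord// [_ - _]addrC exprDn !mulr_suml.
  rewrite (@big_ord_widen _ _ _ i.+1 s.+1 (fun l => (- a k) ^+ (i - l) * y k.1 k.2 ^+ l *+ 'C(i, l) / i`!%:R * nestsum s ks (f i) y)); last exact: leq_trans rs1.
  rewrite big_mkcond /=; apply: eq_bigr => j _.
  rewrite /al; case: ltnP => ij; last by rewrite bin_small// !mul0r mulr0.
  by rewrite -mulr_natl; ring.
rewrite exchange_big /=; apply: eq_bigr => j _.
by rewrite -mulr_sumr nestsum_linear.
Qed.

Lemma holder_local_poly (R : realType) (d n s : nat) (lam : R) (g : 'M[R]_(d, n) -> R) :
  0 <= lam -> holder s lam g -> exists2 C : R, 0 <= C &
  forall (h : R) (lo hi : 'I_d * 'I_n -> R), 0 <= h ->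
    (forall k, [/\ 0 <= lo k, lo k < hi k, hi k <= 1 & hi k - lo k <= h]) ->
    exists2 c : seq nat -> R, forall w, `|c w| <= C &
      forall x, in_box lo hi x ->
        `|g x - \sum_(w <- words s (d * n)) c w * monomial (rev (enum {: 'I_d * 'I_n})) w x|
        <= C * (h ^+ s * h `^ lam).
Proof.
move=> lam0 /holder_sorted[M M0 H].
have szE : size (rev (enum {: 'I_d * 'I_n})) = (d * n)%N.
  by rewrite size_rev -cardE card_prod !card_ord.
pose C1 := M * s.+2%:R ^+ (d * n); pose C2 := M * binsum R s ^+ (d * n).
have C10 : 0 <= C1 by rewrite mulr_ge0// exprn_ge0.
have C20 : 0 <= C2.
  by rewrite mulr_ge0// exprn_ge0//; apply: sumr_ge0 => i _; apply: sumr_ge0.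
exists (C1 + C2); first exact: addr_ge0.
move=> h lo hi h0 box.
(* The centre is interior to the cube even if the cell touches its boundary, where no derivatives
   are given. *)
pose a k := (lo k + hi k) / 2.
pose x0 : 'M[R]_(d, n) := \matrix_(i, j) a (i, j).
have ab k : lo k < a k < hi k by have [? ? ? ?] := box k; rewrite /a; lra.
have x0b : in_box lo hi x0 by move=> k; rewrite mxE -surjective_pairing.
have E : rev (rev (enum {: 'I_d * 'I_n})) ++ [::] = enum {: 'I_d * 'I_n} by rewrite revK cats0.
have vsd : sorted_dirs [::] ([::] : seq 'M[R]_(d, n)) by exists (fun _ => 0%N).
have [||c c1 c2] := @taylor_at_nestsum R d n s M g lo hi a M0 _ _ (rev (enum {: 'I_d * 'I_n})) [::] [::] s x0 E vsd (add0n s) x0b.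
- by move=> k; have [? ? ? ?] := box k; split.
- by move=> ks done vs E1 vs1; have [_ + _] := H _ _ _ E1 vs1.
exists c.
  by move=> w; apply: le_trans (c1 w) _; rewrite szE -/C2 lerDr.
move=> x xb.
rewrite -szE -nestsum_words -c2; last by move=> k; rewrite mem_rev mem_enum.
apply: le_trans (_ : _ <= C1 * (h ^+ s * h `^ lam)) _.
  rewrite /C1 -szE -[g x]/(iderive [::] g x).
  apply: (@taylor_at_approx R d n s lam M h g lo hi a) E vsd (add0n s) xb => //.
  by move=> k; have [? ? ? ?] := box k; split.
by rewrite ler_wpM2r ?lerDl// mulr_ge0 ?exprn_ge0 ?powR_ge0.
Qed.

(** The bound in [holder] is available only in the open cube; continuity on the closed cube carries
    it to the boundary at the price of 1. *)
Lemma holder_bounded (R : realType) (d n s : nat) (lam : R) (g : 'M[R]_(d, n) -> R) :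
  holder s lam g -> exists2 M : R, 0 <= M & forall x, in_cube x -> `|g x| <= M.
Proof.
move=> hg; have [M M0 H] := holder_sorted hg.
have vsd : sorted_dirs [::] ([::] : seq 'M[R]_(d, n)) by exists (fun _ => 0%N).
have [_ + _] := H _ _ _ (cats0 _) vsd; move=> /(_ (leq0n _)) /= gM.
exists (M + 1); first by rewrite addr_ge0.
move=> x xc; have [_ cg _] := hg.
have /cvgrPdist_lt /(_ 1 ltr01) := (subspace_continuousP _ _).1 cg x xc.
rewrite /within /= => /nbhs_ballP[e /= e0 He].
pose tau := Num.min (e / 2) (1 / 2).
have t0 : 0 < tau by rewrite /tau lt_min; apply/andP; split; lra.
have t1 : tau <= 1 / 2 by rewrite /tau ge_min lexx orbT.
have te : tau < e by apply: le_lt_trans (_ : e / 2 < e); [rewrite /tau ge_min lexx|lra].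
(* [x] moved towards the centre of the cube, hence into the interior, by less than [e]. *)
pose y : 'M[R]_(d, n) := \matrix_(i, j) ((1 - tau) * x i j + tau / 2).
have yo : in_open_cube y.
  move=> i j; rewrite mxE; have := xc i j => xij; apply/andP; split; nra.
have yb : ball x e y.
  split=> // i j; rewrite /ball /= mxE ltr_norml; have := xc i j => xij; apply/andP; split; nra.
have yc : in_cube y by move=> i j; have /andP[/ltW -> /ltW ->] := yo i j.
have Hy := He y yb yc.
have -> : g x = g y + (g x - g y) by ring.
apply: le_trans (ler_normD _ _) _; apply: lerD; [exact: gM|exact: ltW].
Qed.

(** * ReLU layers on registers indexed by finite types *)

(** A partial inverse of the enumeration of [I]: rows beyond [#|I|] are padding. *)
Definition slot (I : finType) (W : nat) (r : 'I_W) : option I :=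
  omap enum_val (insub (r : nat) : option 'I_#|I|).

Definition enc (R : realType) (W : nat) (I : finType) (v : I -> R) : 'cV[R]_W :=
  \col_r oapp v 0 (slot I r).

Definition pad_mx (R : realType) (W1 W2 : nat) (J I : finType) (A : J -> I -> R) : 'M[R]_(W1, W2) :=
  \matrix_(r, c) oapp (fun j => oapp (A j) 0 (slot I c)) 0 (slot J r).

Definition relu (R : realType) (x : R) : R := Num.max x 0.

Definition lay (R : realType) (I J : finType) (A : J -> I -> R) (b : J -> R) (v : I -> R) (j : J) : R :=
  relu (\sum_i A j i * v i + b j).

Lemma slot_inj (I : finType) (W : nat) (r r' : 'I_W) :
  isSome (slot I r) -> slot I r = slot I r' -> r = r'.
Proof.
rewrite /slot; case: insubP => //= i _ ir _; case: insubP => //= i' _ i'r [] /enum_val_inj ii'.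
by apply: val_inj => /=; rewrite -ir -i'r ii'.
Qed.

Lemma sum_slot (R : realType) (I : finType) (W : nat) (F : I -> R) :
  (#|I| <= W)%N -> \sum_(c < W) oapp F 0 (slot I c) = \sum_i F i.
Proof.
move=> IW; rewrite (bigID (fun c : 'I_W => isSome (slot I c))) /= [X in _ + X]big1 ?addr0; last first.
  by move=> c; case: slot.
pose h (i : I) : 'I_W := Ordinal (leq_trans (ltn_ord (enum_rank i)) IW).
have hK i : slot I (h i) = Some i.
  rewrite /slot /=; case: insubP => [j _ ji|]; last by rewrite ltn_ord.
  by rewrite /= (_ : j = enum_rank i) ?enum_rankK//; apply: val_inj.
rewrite (reindex_omap h (fun c => slot I c)); last first.
  move=> c; case E: (slot I c) => [i|] //= _; congr Some.
  by apply: (@slot_inj I); rewrite hK// E.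
by apply: eq_big => [i|i _]; rewrite hK //= eqxx.
Qed.

Lemma pad_mx_enc (R : realType) (W1 W2 : nat) (I J : finType) (A : J -> I -> R) (v : I -> R) :
  (#|I| <= W2)%N ->
  pad_mx W1 W2 A *m enc W2 v = enc W1 (fun j => \sum_i A j i * v i).
Proof.
move=> IW; apply/matrixP => r c; rewrite !mxE.
case E: (slot J r) => [j|] /=; last by rewrite big1// => i _; rewrite !mxE E /= mul0r.
rewrite -(sum_slot _ IW); apply: eq_bigr => i _; rewrite !mxE E /=.
by case: slot => //=; rewrite mul0r.
Qed.

Lemma relu_pad_mx_enc (R : realType) (W1 W2 : nat) (I J : finType) (A : J -> I -> R) b (v : I -> R) :
  (#|I| <= W2)%N ->
  relu_mx (pad_mx W1 W2 A *m enc W2 v + enc W1 b) = enc W1 (lay A b v).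
Proof.
move=> IW; rewrite pad_mx_enc//; apply/matrixP => r c; rewrite !mxE.
by case: slot => //=; rewrite addr0 maxxx.
Qed.

Lemma enc_ord (R : realType) (m : nat) (z : 'cV[R]_m) : enc m (fun i => z i 0) = z.
Proof.
apply/matrixP => r c; rewrite !mxE /slot (ord1 c).
case: insubP => [i _ ir|/negP[]]; last by rewrite [X in (_ < X)%N]card_ord.
by rewrite /= enum_val_ord; congr (z _ _); apply: val_inj.
Qed.

Lemma mx_bdd_enc (R : realType) (W : nat) (I : finType) (v : I -> R) B :
  0 <= B -> (forall i, `|v i| <= B) -> mx_bdd B (enc W v).
Proof. by move=> B0 vB i j; rewrite mxE; case: slot => /=; rewrite ?normr0. Qed.

Lemma mx_bdd_pad (R : realType) (W1 W2 : nat) (I J : finType) (A : J -> I -> R) B :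
  0 <= B -> (forall j i, `|A j i| <= B) -> mx_bdd B (pad_mx W1 W2 A).
Proof.
by move=> B0 vB i j; rewrite mxE; case: slot => /=; rewrite ?normr0//; case: slot => /=; rewrite ?normr0.
Qed.

(** Nonzero entries sit in rows that carry a register, and [slot] separates these rows. The bound
    therefore involves the registers and not [W], as is needed to count the weights of small layers
    inside a wide block. *)
Lemma nnz_enc (R : realType) (W : nat) (I : finType) (v : I -> R) : (nnz (enc W v) <= #|I|.+1)%N.
Proof.
rewrite -card_option /nnz -(card_in_imset (f := fun ij : 'I_W * 'I_1 => slot I ij.1)) ?max_card//.
move=> [i k] [i' k'] /=; rewrite !inE /= !mxE => + _ E; rewrite (ord1 k) (ord1 k').
case E1: (slot I i) => [a|] /=; rewrite ?eqxx// => _.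
by rewrite (slot_inj _ E)// E1.
Qed.

Lemma nnz_pad (R : realType) (W1 W2 : nat) (I J : finType) (A : J -> I -> R) :
  (nnz (pad_mx W1 W2 A) <= #|J|.+1 * #|I|.+1)%N.
Proof.
rewrite -!card_option -card_prod /nnz.
rewrite -(card_in_imset (f := fun ij : 'I_W1 * 'I_W2 => (slot J ij.1, slot I ij.2))) ?max_card//.
move=> [i k] [i' k'] /=; rewrite !inE /= !mxE => + _ [E F].
case E1: (slot J i) => [a|] /=; rewrite ?eqxx//.
case E2: (slot I k) => [e|] /=; rewrite ?eqxx// => _.
by rewrite (slot_inj _ E) ?E1// (slot_inj _ F) ?E2.
Qed.

(** * Stacks of hidden layers as relations between register vectors *)

Definition run (R : realType) (W : nat) (hs : seq ('M[R]_W * 'cV[R]_W)) (h : 'cV[R]_W) :=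
  foldl (fun h p => relu_mx (p.1 *m h + p.2)) h hs.

(* [enc] stores registers indexed by a finite type in the first rows of a state
   vector and keeps the remaining rows 0, so that layers of different sizes share
   the width [W]. *)
Definition hnet (R : realType) (W : nat) (B : R) (Z len : nat) (I J : finType)
    (S : (I -> R) -> (J -> R) -> Prop) : Prop :=
  exists hs : seq ('M[R]_W * 'cV[R]_W),
    [/\ size hs = len, (\sum_(p <- hs) (nnz p.1 + nnz p.2) <= Z)%N,
        (forall p, p \in hs -> mx_bdd B p.1 /\ mx_bdd B p.2) &
        forall v, exists2 v', run hs (enc W v) = enc W v' & S v v'].

Lemma hnet_lay (R : realType) (W : nat) (B : R) (I J : finType) (A : J -> I -> R) (b : J -> R)
    (S : (I -> R) -> (J -> R) -> Prop) :
  (#|I| <= W)%N -> 0 <= B -> (forall j i, `|A j i| <= B) -> (forall j, `|b j| <= B) ->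
  (forall v, S v (lay A b v)) ->
  hnet W B (#|J|.+1 * #|I|.+2) 1 S.
Proof.
move=> IW B0 AB bB HS; exists [:: (pad_mx W W A, enc W b)]; split => //.
- by rewrite big_seq1 /= mulnS addnC leq_add ?nnz_enc ?nnz_pad.
- by move=> p; rewrite inE => /eqP ->; split; [exact: mx_bdd_pad|exact: mx_bdd_enc].
- by move=> v; exists (lay A b v) => //=; rewrite relu_pad_mx_enc.
Qed.

Lemma hnet_comp (R : realType) (W : nat) (B : R) (Z1 Z2 l1 l2 : nat) (I J K : finType)
    (S1 : (I -> R) -> (J -> R) -> Prop) (S2 : (J -> R) -> (K -> R) -> Prop) S :
  hnet W B Z1 l1 S1 -> hnet W B Z2 l2 S2 ->
  (forall u v w, S1 u v -> S2 v w -> S u w) ->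
  hnet W B (Z1 + Z2) (l1 + l2) S.
Proof.
move=> [h1 [<- z1 b1 s1]] [h2 [<- z2 b2 s2]] HS; exists (h1 ++ h2); split.
- by rewrite size_cat.
- by rewrite big_cat leq_add.
- by move=> p; rewrite mem_cat => /orP[/b1|/b2].
- move=> u; have [v r1 t1] := s1 u; have [w r2 t2] := s2 v.
  by exists w; [rewrite /run foldl_cat -/(run h1 _) r1|exact: HS t1 t2].
Qed.

Lemma hnet_weaken (R : realType) (W : nat) (B B' : R) (Z Z' l : nat) (I J : finType)
    (S S' : (I -> R) -> (J -> R) -> Prop) :
  B <= B' -> (Z <= Z')%N -> (forall u v, S u v -> S' u v) ->
  hnet W B Z l S -> hnet W B' Z' l S'.
Proof.
move=> BB ZZ SS [hs [hl hz hb hS]]; exists hs; split => //; first exact: leq_trans ZZ.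
  by move=> p /hb[b1 b2]; split=> i j; [apply: le_trans (b1 i j) BB|apply: le_trans (b2 i j) BB].
by move=> u; have [v rv sv] := hS u; exists v => //; exact: SS.
Qed.

Lemma hnet_nil (R : realType) (W : nat) (B : R) (I : finType) (S : (I -> R) -> (I -> R) -> Prop) :
  (forall v, S v v) -> hnet W B 0 0 S.
Proof. by move=> SS; exists [::]; split => //; [rewrite big_nil|move=> v; exists v]. Qed.

Lemma sum_pick (R : realType) (I : finType) (v : I -> R) (i0 : I) (c : R) :
  \sum_i (c * (i == i0)%:R) * v i = c * v i0.
Proof.
rewrite (bigD1 i0)//= eqxx mulr1 big1 ?addr0// => i /negPf ->.
by rewrite mulr0 mul0r.
Qed.

Lemma relu_ge0 (R : realType) (x : R) : 0 <= relu x.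
Proof. by rewrite /relu le_max lexx orbT. Qed.

Lemma relu_id (R : realType) (x : R) : 0 <= x -> relu x = x.
Proof. by move=> x0; rewrite /relu max_l. Qed.

Lemma relu_0 (R : realType) (x : R) : x <= 0 -> relu x = 0.
Proof. by move=> x0; rewrite /relu max_r. Qed.

(** * Approximate multiplication of registers in [0,1] *)

Definition in01 (R : realType) (I : Type) (v : I -> R) : Prop := forall i, 0 <= v i <= 1.

(** The projection of the line onto [0,1], in a form that costs two layers with weights of modulus
    at most 1. *)
Definition clip (R : realType) (x : R) : R := relu (1 - relu (1 - x)).

Lemma clip01 (R : realType) (x : R) : 0 <= clip x <= 1.
Proof. by rewrite relu_ge0 /clip /relu ge_max ler01 andbT gerBl relu_ge0. Qed.

Lemma clip_id (R : realType) (x : R) : 0 <= x <= 1 -> clip x = x.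
Proof. by move=> x01; rewrite /clip !relu_id ?subKr//; lra. Qed.

Lemma clip_close (R : realType) (x y : R) : 0 <= y <= 1 -> `|clip x - y| <= `|x - y|.
Proof.
move=> y01; case: (lerP x 0) => x0.
  have -> : clip x = 0 by rewrite /clip [relu (1 - x)]relu_id ?subKr ?relu_0//; lra.
  by rewrite !ler0_norm; lra.
case: (lerP x 1) => x1; first by rewrite clip_id//; lra.
have -> : clip x = 1 by rewrite /clip [relu (1 - x)]relu_0 ?subr0 ?relu_id//; lra.
by rewrite !ger0_norm; lra.
Qed.

Lemma hnet_clip (R : realType) (W : nat) (I : finType) :
  (#|I| <= W)%N ->
  hnet W (1 : R) (#|I|.+1 * #|I|.+2 + #|I|.+1 * #|I|.+2) 2
    (fun v v' : I -> R => forall i, v' i = clip (v i)).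
Proof.
move=> IW.
have H : hnet W (1 : R) (#|I|.+1 * #|I|.+2) 1 (fun v v' : I -> R => forall i, v' i = relu (1 - v i)).
  apply: (@hnet_lay R W 1 I I (fun j i => -1 * (i == j)%:R) (fun _ => 1)) => //.
  - by move=> j i; rewrite normrM normrN1 mul1r; case: eqP; rewrite ?normr1 ?normr0.
  - by move=> j; rewrite normr1.
  - by move=> v j; rewrite /lay sum_pick mulN1r addrC.
by apply: (hnet_comp H H) => u v w uv vw i; rewrite vw uv.
Qed.

(** The three arguments to be squared in the polarisation xy = 2 ((x+y)/2)^2 - x^2/2 - y^2/2; the
    sum is halved to stay in [0,1]. *)
Definition sq_in (R : realType) (I : finType) (a b : I -> I) (v : I -> R) (j : I) (t : 'I_3) : R :=
  if t == 0 then (v (a j) + v (b j)) / 2 else if t == 1 then v (a j) else v (b j).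

(* With tooth y = 2y - 4 max(y - 1/2, 0) and q y = y - y^2, one has
   q y = (tooth y + q (tooth y)) / 4 on [0,1]; so subtracting tooth^l x / 4^l
   for l = 1, 2, ... from x leaves x^2 + q (tooth^l x) / 4^l. *)
Definition sq_state (R : realType) (I : finType) (l : nat) (x : I -> 'I_3 -> R)
    (st : I * 'I_3 * 'I_3 -> R) : Prop :=
  forall j t, exists2 y : R, 0 <= y <= 1 &
    [/\ st (j, t, 0) = y, st (j, t, 1) = relu (y - 1 / 2) &
        st (j, t, 2%:R) = x j t ^+ 2 + (y - y ^+ 2) * (4 ^- l)].

Lemma sum_I3 (R : realType) (F : 'I_3 -> R) : \sum_(t < 3) F t = F 0 + F 1 + F 2%:R.
Proof.
by rewrite !big_ord_recl big_ord0 addr0 addrA; congr (F _ + F _ + F _); apply: val_inj.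
Qed.

Lemma hnet_sq_init (R : realType) (W : nat) (I : finType) (a b : I -> I) :
  (#|I| <= W)%N ->
  hnet W (4 : R) (#|{: I * 'I_3 * 'I_3}|.+1 * #|I|.+2) 1
    (fun (v : I -> R) st => in01 v -> sq_state 0 (sq_in a b v) st).
Proof.
move=> IW.
pose A (jtq : I * 'I_3 * 'I_3) (i : I) : R := let '(j, t, q) := jtq in
  if t == 0 then 1 / 2 * (i == a j)%:R + 1 / 2 * (i == b j)%:R
  else if t == 1 then 1 * (i == a j)%:R else 1 * (i == b j)%:R.
pose c (jtq : I * 'I_3 * 'I_3) : R := if jtq.2 == 1 then - (1 / 2) else 0.
apply: (@hnet_lay R W 4 _ _ A c) => //.
- move=> [[j t] q] i; rewrite /A.
  have b01 (x y : I) : 0 <= (x == y)%:R :> R /\ (x == y)%:R <= 1 :> R by case: eqP => _; rewrite ?ler01 ?lexx.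
  by have := b01 i (a j); have := b01 i (b j); do 2?[case: ifP => _]; rewrite ler_norml; lra.
- by move=> [[j t] q]; rewrite /c; case: ifP => _; rewrite ?normr0 // normrN ger0_norm; lra.
- move=> v v01 j t.
  have E : \sum_i A (j, t, 0) i * v i = sq_in a b v j t.
    rewrite /A /sq_in; case: ifP => _.
      by (under eq_bigr do rewrite mulrDl); rewrite big_split /= !sum_pick; lra.
    by case: ifP => _; rewrite sum_pick mul1r.
  have y01 : 0 <= sq_in a b v j t <= 1.
    rewrite /sq_in; have := v01 (a j); have := v01 (b j).
    by case: ifP => _; [lra|case: ifP => _; lra].
  exists (sq_in a b v j t) => //; rewrite /lay /c /= !E.
  have y0 : 0 <= sq_in a b v j t by case/andP: y01.
  rewrite !addr0 !(relu_id y0).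
  split=> //; rewrite expr0 invr1; ring.
Qed.

Lemma hnet_sq_step (R : realType) (W : nat) (I : finType) (l : nat) :
  (#|{: I * 'I_3 * 'I_3}| <= W)%N ->
  hnet W (4 : R) (#|{: I * 'I_3 * 'I_3}|.+1 * #|{: I * 'I_3 * 'I_3}|.+2) 1
    (fun st st' : I * 'I_3 * 'I_3 -> R =>
      forall x, sq_state l x st -> sq_state l.+1 x st').
Proof.
move=> IW.
(* Rows 0 and 1 both compute tooth y, and the bias -1/2 of row 1 prepares the next step; row 2
   subtracts tooth y / 4^(l+1) from the running approximation. *)
pose m (q q' : 'I_3) : R :=
  if q == 2%:R then
    if q' == 0 then - (2 / 4 ^+ l.+1) else if q' == 1 then 4 / 4 ^+ l.+1 else 1
  else if q' == 0 then 2 else if q' == 1 then - 4 else 0.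
pose A (u u' : I * 'I_3 * 'I_3) : R := (u.1 == u'.1)%:R * m u.2 u'.2.
pose c (jtq : I * 'I_3 * 'I_3) : R := if jtq.2 == 1 then - (1 / 2) else 0.
have p4 : 1 <= 4 ^+ l.+1 :> R by rewrite exprn_ege1// ler1n.
have i4 : 0 <= (4 ^+ l.+1 : R)^-1 <= 1.
  by rewrite invr_ge0 (le_trans _ p4)//= invf_le1// (lt_le_trans _ p4).
apply: (@hnet_lay R W 4 _ _ A c) => //.
- move=> u u'; rewrite /A normrM -[X in _ <= X]mul1r; apply: ler_pM => //.
    by case: eqP; rewrite ?normr1 ?normr0.
  rewrite /m; do ?case: ifP => _; rewrite ?normr0// ?normrN ger0_norm//; lra.
- by move=> [[j t] q]; rewrite /c; case: ifP => _; rewrite ?normr0 // normrN ger0_norm; lra.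
- move=> st x0 H j t; have [y y01 [s0 s1 s2]] := H j t.
  have E q : \sum_u A (j, t, q) u * st u = m q 0 * y + m q 1 * relu (y - 1 / 2) +
       m q 2%:R * (x0 j t ^+ 2 + (y - y ^+ 2) * (4 ^- l)).
    rewrite -s1 -s2 -{1}s0 -(sum_I3 (fun q' => m q q' * st (j, t, q'))).
    transitivity (\sum_(jt : I * 'I_3) \sum_(q' < 3) A (j, t, q) (jt, q') * st (jt, q')).
      by rewrite pair_bigA; apply: eq_bigr => [[? ?]].
    rewrite (bigD1 (j, t))//= [X in _ + X]big1 ?addr0.
      by apply: eq_bigr => q' _; rewrite /A /= eqxx mul1r.
    move=> jt ne; rewrite big1// => q' _.
    by rewrite /A /= eq_sym (negPf ne) !mul0r.
  pose z := 2 * y - 4 * relu (y - 1 / 2).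
  have [z01 zq] : 0 <= z <= 1 /\ y - y ^+ 2 = (z + (z - z ^+ 2)) / 4.
    rewrite /z; case: (lerP y (1 / 2)) => y2.
      by rewrite relu_0; [split; [lra|field]|lra].
    by rewrite relu_id; [split; [lra|field]|lra].
  exists z => //; rewrite /lay /c /= !E /m /=; split.
  + by rewrite addr0 mul0r addr0 mulNr -/z relu_id//; case/andP: z01.
  + by rewrite mul0r addr0 mulNr -/z.
  + rewrite addr0 [1 * (_ + _)]mul1r zq.
    have -> : - (2 / 4 ^+ l.+1) * y + 4 / 4 ^+ l.+1 * relu (y - 1 / 2) +
       (x0 j t ^+ 2 + (z + (z - z ^+ 2)) / 4 / 4 ^+ l) =
       x0 j t ^+ 2 + (z - z ^+ 2) / 4 ^+ l.+1.
      have n4 : 4 ^+ l != 0 :> R by rewrite expf_neq0// pnatr_eq0.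
      by rewrite /z exprS; move: (4 ^+ l) n4 => p p0; field.
    (* The approximation never falls below the square, so the ReLU leaves it unchanged. *)
    rewrite relu_id//; apply: addr_ge0; first exact: sqr_ge0.
    by apply: mulr_ge0; [nra|case/andP: i4].
Qed.

Lemma hnet_sq (R : realType) (W : nat) (I : finType) (a b : I -> I) (L : nat) :
  (#|I| <= W)%N -> (#|{: I * 'I_3 * 'I_3}| <= W)%N ->
  hnet W (4 : R) (#|{: I * 'I_3 * 'I_3}|.+1 * #|I|.+2
      + L * (#|{: I * 'I_3 * 'I_3}|.+1 * #|{: I * 'I_3 * 'I_3}|.+2)) (1 + L)
    (fun (v : I -> R) st => in01 v -> sq_state L (sq_in a b v) st).
Proof.
move=> IW IW3; elim: L => [|L IH]; first by rewrite !addn0; exact: hnet_sq_init.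
have H := hnet_comp IH (hnet_sq_step R L IW3)
  (fun u v w uv vw => fun u01 => vw _ (uv u01)).
have -> : (1 + L.+1 = 1 + L + 1)%N by lia.
by rewrite [(L.+1 * _)%N]mulSnr addnA; exact: H.
Qed.

(** Each of the [m] registers needs three squares with three registers each, hence the factor 9. *)
Definition round_cost (m : nat) : nat := ((9 * m).+2 * (9 * m).+2)%N.

(** The depth is one layer to set up the squares, [L] squaring steps, one layer for the polarisation
    and two for [clip]. Each square is too large by at most 4^-L / 4, so the combination 2 e0 - e1/2
    - e2/2 of the errors is at most 4^-L in modulus. *)
Lemma hnet_round (R : realType) (W : nat) (I : finType) (a b : I -> I) (L : nat) :
  (9 * #|I| <= W)%N ->
  hnet W (4 : R) (round_cost #|I| * (L + 4)) (L + 4)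
    (fun v v' : I -> R => in01 v -> in01 v' /\ forall i, `|v' i - v (a i) * v (b i)| <= 4 ^- L).
Proof.
move=> IW9.
have c9 : #|{: I * 'I_3 * 'I_3}| = (9 * #|I|)%N by rewrite !card_prod !card_ord; lia.
have IW : (#|I| <= W)%N by lia.
have IW3 : (#|{: I * 'I_3 * 'I_3}| <= W)%N by rewrite c9.
pose A (j : I) (u : I * 'I_3 * 'I_3) : R :=
  2 * (u == (j, 0, 2%:R))%:R + - (1 / 2) * (u == (j, 1, 2%:R))%:R
   + - (1 / 2) * (u == (j, 2%:R, 2%:R))%:R.
have HA : hnet W (4 : R) (#|I|.+1 * #|{: I * 'I_3 * 'I_3}|.+2) 1
   (fun (st : I * 'I_3 * 'I_3 -> R) v' => forall j, v' j =
      relu (2 * st (j, 0, 2%:R) - 1 / 2 * st (j, 1, 2%:R) - 1 / 2 * st (j, 2%:R, 2%:R))).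
  apply: (@hnet_lay R W 4 _ _ A (fun _ => 0)) => //.
  - move=> j u; rewrite /A.
    have b01 (x y : I * 'I_3 * 'I_3) : 0 <= (x == y)%:R :> R /\ (x == y)%:R <= 1 :> R.
      by case: eqP => _; rewrite ?ler01 ?lexx.
    have [? ?] := b01 u (j, 0, 2%:R); have [? ?] := b01 u (j, 1, 2%:R).
    have [? ?] := b01 u (j, 2%:R, 2%:R).
    by rewrite ler_norml; lra.
  - by move=> j; rewrite normr0.
  - move=> st j; rewrite /lay addr0; congr relu.
    under eq_bigr do rewrite !mulrDl.
    by rewrite !big_split /= !sum_pick; lra.
have Hc := hnet_weaken (_ : 1 <= 4 :> R) (leqnn _) (fun u v H => H) (@hnet_clip R W I IW).
have {}Hc := Hc (ler_nat R 1 4).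
have H1 := hnet_comp (hnet_comp (hnet_sq R a b L IW IW3) HA (fun u v w H1 H2 => ex_intro2 _ _ v H1 H2))
   Hc (fun u v w H1 H2 => ex_intro2 _ _ v H1 H2).
have -> : (L + 4 = 1 + L + 1 + 2)%N by lia.
apply: hnet_weaken H1 => //.
  rewrite c9 /round_cost; set q := #|I|; nia.
move=> v v' [v1 [st Hst Hv1] Hv'] v01; split.
  by move=> i; rewrite Hv'; exact: clip01.
move=> i; rewrite Hv'.
have va := v01 (a i); have vb := v01 (b i).
apply: le_trans (clip_close _ _) _; first by apply/andP; split; nra.
have [y0 y001 [_ _ s0]] := Hst v01 i 0.
have [y1 y101 [_ _ s1]] := Hst v01 i 1.
have [y2 y201 [_ _ s2]] := Hst v01 i 2%:R.
have d0 : 0 <= (4 ^+ L : R)^-1 by rewrite invr_ge0 exprn_ge0.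
move: s0 s1 s2; rewrite /sq_in /=; move: (4 ^- L) d0 => dl d0 s0 s1 s2.
rewrite Hv1 s0 s1 s2.
set e0 := y0 - y0 ^+ 2; set e1 := y1 - y1 ^+ 2; set e2 := y2 - y2 ^+ 2.
have q0 : 0 <= e0 <= 1 / 4.
  rewrite /e0; have := sqr_ge0 (y0 - 1 / 2); rewrite !expr2 => ?; apply/andP; split; nra.
have q1 : 0 <= e1 <= 1 / 4.
  rewrite /e1; have := sqr_ge0 (y1 - 1 / 2); rewrite !expr2 => ?; apply/andP; split; nra.
have q2 : 0 <= e2 <= 1 / 4.
  rewrite /e2; have := sqr_ge0 (y2 - 1 / 2); rewrite !expr2 => ?; apply/andP; split; nra.
have p0 : 0 <= e0 * dl <= 1 / 4 * dl by apply/andP; split; nra.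
have p1 : 0 <= e1 * dl <= 1 / 4 * dl by apply/andP; split; nra.
have p2 : 0 <= e2 * dl <= 1 / 4 * dl by apply/andP; split; nra.
set x := v (a i) in va *; set y := v (b i) in vb *.
have E : 2 * (((x + y) / 2) ^+ 2 + e0 * dl) - 1 / 2 * (x ^+ 2 + e1 * dl) - 1 / 2 * (y ^+ 2 + e2 * dl)
   = x * y + (2 * (e0 * dl) - 1 / 2 * (e1 * dl) - 1 / 2 * (e2 * dl)) by field.
rewrite E; set er := 2 * (e0 * dl) - _ - _.
have er1 : `|er| <= dl by rewrite /er ler_norml; apply/andP; split; lra.
have xy0 : 0 <= x * y by nra.
(* Since x y >= 0, replacing a negative value by 0 moves the result towards x y. *)
apply: le_trans er1; rewrite /relu; case: (lerP 0 (x * y + er)) => h.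
  by rewrite addrAC subrr add0r.
by rewrite sub0r normrN ger0_norm// ler_normr; apply/orP; right; lra.
Qed.

(** * Sequences of multiplications *)

Definition mul_round (R : realType) (I : Type) (v : I -> R) (p : (I -> I) * (I -> I)) (i : I) : R :=
  v (p.1 i) * v (p.2 i).

Definition mul_rounds (R : realType) (I : Type) (rs : seq ((I -> I) * (I -> I))) (v : I -> R) : I -> R :=
  foldl (@mul_round R I) v rs.

Lemma mul_round01 (R : realType) (I : Type) (v : I -> R) p : in01 v -> in01 (mul_round v p).
Proof.
move=> v01 i; have := v01 (p.1 i); have := v01 (p.2 i); rewrite /mul_round => h1 h2.
by apply/andP; split; nra.
Qed.

(** With all factors in [0,1], the error of a product is at most the sum of the errors of its
    factors, so each round at most doubles it. *)
Lemma mul_rounds_lip (R : realType) (I : Type) (rs : seq ((I -> I) * (I -> I))) (u v : I -> R) (E : R) :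
  in01 u -> in01 v -> (forall i, `|u i - v i| <= E) ->
  forall i, `|mul_rounds rs u i - mul_rounds rs v i| <= 2 ^+ size rs * E.
Proof.
elim: rs u v E => [|p rs IH] u v E u01 v01 uv i; first by rewrite mul1r.
rewrite [size _]/= exprSr -mulrA; apply: IH; try exact: mul_round01.
move=> j; rewrite /mul_round.
have -> : u (p.1 j) * u (p.2 j) - v (p.1 j) * v (p.2 j) =
   (u (p.1 j) - v (p.1 j)) * u (p.2 j) + v (p.1 j) * (u (p.2 j) - v (p.2 j)) by ring.
apply: le_trans (ler_normD _ _) _; rewrite !normrM.
have := u01 (p.2 j); have := v01 (p.1 j) => /andP[a0 a1] /andP[b0 b1].
rewrite [`|u (p.2 j)|]ger0_norm// [`|v (p.1 j)|]ger0_norm//.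
have := uv (p.1 j); have := uv (p.2 j) => h1 h2.
have n1 := normr_ge0 (u (p.1 j) - v (p.1 j)).
have n2 := normr_ge0 (u (p.2 j) - v (p.2 j)).
nra.
Qed.

(** The error of the first round grows to at most 2^k 4^-L in the [k] exact rounds that follow. The
    induction hypothesis bounds the errors made in those rounds by the same amount, and the two add
    up to 2^(k+1) 4^-L. *)
Lemma hnet_rounds (R : realType) (W : nat) (I : finType) (rs : seq ((I -> I) * (I -> I))) (L : nat) :
  (9 * #|I| <= W)%N ->
  hnet W (4 : R) (size rs * (round_cost #|I| * (L + 4))) (size rs * (L + 4))
    (fun v v' : I -> R => in01 v ->
       in01 v' /\ forall i, `|v' i - mul_rounds rs v i| <= 2 ^+ size rs * 4 ^- L).
Proof.
move=> IW; elim: rs => [|p rs IH].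
  rewrite !mul0n; apply: hnet_nil => v v01; split=> // i.
  by rewrite subrr normr0 mul1r invr_ge0 exprn_ge0.
rewrite !mulSn; apply: (hnet_comp (hnet_round R p.1 p.2 L IW) IH) => u v w H1 H2 u01.
have [v01 uv] := H1 u01; have [w01 vw] := H2 v01; split=> // i.
have -> : w i - mul_rounds (p :: rs) u i = (w i - mul_rounds rs v i) +
   (mul_rounds rs v i - mul_rounds rs (mul_round u p) i) by rewrite /mul_rounds /=; ring.
apply: le_trans (ler_normD _ _) _; rewrite exprS mulr2n -mulrA mulrDl mul1r; apply: lerD => //.
by apply: mul_rounds_lip => //; exact: mul_round01.
Qed.

(** * Cell index and coefficient table *)

(** A base-[N] numeral with the coordinates of the cell as digits and the position [q] as leading
    part, so that one table with [N ^ #|K| * n] entries serves all columns. *)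
Definition code (K : finType) (N : nat) (j : K -> nat) (q : nat) : nat :=
  (\sum_k N ^ enum_rank k * j k + N ^ #|K| * q)%N.

Lemma digits_inj (N m : nat) (j j' : nat -> nat) (q q' : nat) :
  (forall p, (p < m)%N -> (j p < N)%N /\ (j' p < N)%N) ->
  (\sum_(p < m) N ^ p * j p + N ^ m * q = \sum_(p < m) N ^ p * j' p + N ^ m * q')%N ->
  (forall p, (p < m)%N -> j p = j' p) /\ q = q'.
Proof.
elim: m j j' => [|m IH] j j' jN.
  by rewrite !big_ord0 !add0n !mul1n => ->.
have [j0 j'0] := jN 0%N isT; have N0 : (0 < N)%N by lia.
have E (f : nat -> nat) r : (\sum_(p < m.+1) N ^ p * f p + N ^ m.+1 * r =
    (\sum_(p < m) N ^ p * f p.+1 + N ^ m * r) * N + f 0%N)%N.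
  rewrite big_ord_recl /= expn0 mul1n expnS [RHS]addnC -addnA; congr (_ + _)%N.
  rewrite mulnDl; congr (_ + _)%N; last by rewrite -mulnA mulnC.
  by rewrite big_distrl; apply: eq_bigr => p _; rewrite /= /bump /= add1n expnS -mulnA mulnC.
rewrite !E => H.
have H0 : j 0%N = j' 0%N by have := congr1 (modn^~ N) H; rewrite /= !modnMDl !modn_small.
have H1 := congr1 (divn^~ N) H; rewrite /= !divnMDl// !divn_small// !addn0 in H1.
have [|h1 ->] := IH (fun p => j p.+1) (fun p => j' p.+1) _ H1.
  by move=> p pm; apply: jN.
by split=> // [[|p]] // pm; apply: h1.
Qed.

Lemma digits_lt (N m n : nat) (j : nat -> nat) (q : nat) :
  (forall p, (p < m)%N -> (j p < N)%N) -> (q < n)%N ->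
  (\sum_(p < m) N ^ p * j p + N ^ m * q < N ^ m * n)%N.
Proof.
move=> jN qn.
have H : (\sum_(p < m) N ^ p * j p < N ^ m)%N.
  elim: m jN => [|m IH] jN; first by rewrite big_ord0.
  rewrite big_ord_recr /= expnSr.
  have h1 := IH (fun p pm => jN p (ltnW pm)); have h2 := jN m (ltnSn m).
  have : (N ^ m * (j m).+1 <= N ^ m * N)%N by rewrite leq_mul2l h2 orbT.
  by apply: leq_trans; rewrite mulnS -addSn leq_add2r.
have : (N ^ m * q.+1 <= N ^ m * n)%N by rewrite leq_mul2l qn orbT.
by apply: leq_trans; rewrite mulnS -addSn leq_add2r.
Qed.

Lemma code_digits (K : finType) (N : nat) (j : K -> nat) (q : nat) (k0 : K) :
  code N j q = (\sum_(p < #|K|) N ^ p * j (nth k0 (enum K) p) + N ^ #|K| * q)%N.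
Proof.
rewrite /code; congr (_ + _)%N.
rewrite (reindex (@enum_val K K))/=; last exact/onW_bij/enum_val_bij.
by apply: eq_bigr => p _; rewrite enum_valK (enum_val_nth k0).
Qed.

Lemma code_inj (K : finType) (N n : nat) :
  injective (fun p : {ffun K -> 'I_N} * 'I_n => code N (fun k => p.1 k) p.2).
Proof.
move=> [j q] [j' q'] /=.
case: (pickP (@predT K)) => [k0 _|K0]; last first.
  have cK : #|K| = 0%N by apply: eq_card0.
  rewrite /code !big1; try by move=> k; have := K0 k.
  rewrite cK !add0n !mul1n => /val_inj ->; congr (_, _).
  by apply/ffunP => k; have := K0 k.
rewrite !(code_digits _ _ _ k0) => H.
have [|h1 /val_inj ->] := @digits_inj N #|K| (fun p => j (nth k0 (enum K) p)) (fun p => j' (nth k0 (enum K) p)) q q' _ H.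
  by move=> p _; split.
congr (_, _); apply/ffunP => k; apply: val_inj.
have := h1 (enum_rank k) (ltn_ord _).
by rewrite nth_enum_rank.
Qed.

Lemma code_lt (K : finType) (N n : nat) (j : {ffun K -> 'I_N}) (q : 'I_n) :
  (code N (fun k => j k) q < N ^ #|K| * n)%N.
Proof.
case: (pickP (@predT K)) => [k0 _|K0].
  by rewrite (code_digits _ _ _ k0); apply: (@digits_lt N #|K| n (fun p => j (nth k0 (enum K) p))).
have cK : #|K| = 0%N by apply: eq_card0.
rewrite /code big1; last by move=> k; have := K0 k.
by rewrite cK add0n !mul1n.
Qed.

(** [code] is injective, so a table indexed by integers can be filled by searching for the preimage.
    [P] is asked of all values of [tau], those outside the image of [code] included, because
    differences of consecutive values become weights. *)
Lemma code_table (K : finType) (T : Type) (N n : nat) (P : T -> Prop)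
    (val : {ffun K -> 'I_N} * 'I_n -> T) (t0 : T) :
  P t0 -> (forall p, P (val p)) ->
  exists2 tau : nat -> T, forall U, P (tau U) &
    forall (j : {ffun K -> 'I_N}) (q : 'I_n), tau (code N (fun k => j k) q) = val (j, q).
Proof.
move=> P0 Pv.
exists (fun U => oapp val t0 [pick p : {ffun K -> 'I_N} * 'I_n | code N (fun k => p.1 k) p.2 == U]).
  by move=> U; case: pickP => [p _|_] /=; [exact: Pv|exact: P0].
move=> j q; case: pickP => [p /eqP E|/(_ (j, q))] /=; last by rewrite eqxx.
by rewrite (@code_inj K N n p (j, q) E).
Qed.

(** The difference of the two ReLUs is a ramp that climbs from 0 to 1 on the interval of length [dl]
    ending at (i+1)/N. Outside that slab it is an exact step. *)
Lemma step_indicator (R : realType) (N : nat) (dl x : R) (i j : nat) :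
  0 < dl -> (0 < N)%N -> j%:R / N%:R <= x <= j.+1%:R / N%:R - dl ->
  relu ((x - i.+1%:R / N%:R) / dl + 1) - relu ((x - i.+1%:R / N%:R) / dl) = (i < j)%N%:R.
Proof.
move=> d0 N0 /andP[x1 x2]; have N0' : 0 < N%:R :> R by rewrite ltr0n.
case: (ltnP i j) => ij.
  have h : 0 <= (x - i.+1%:R / N%:R) / dl.
    apply: divr_ge0; last exact: ltW.
    by rewrite subr_ge0; apply: le_trans x1; rewrite ler_pM2r ?invr_gt0// ler_nat.
  by rewrite !relu_id ?addr_ge0// [_ + 1]addrC addrK.
have h : (x - i.+1%:R / N%:R) / dl <= - 1.
  rewrite ler_pdivrMr// mulN1r lerBlDr addrC; apply: le_trans x2 _.
  by rewrite lerD2r ler_pM2r ?invr_gt0// ler_nat ltnS.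
by rewrite !relu_0 ?subrr//; lra.
Qed.

Lemma sum_lt_indicator (R : realType) (N j : nat) :
  (j <= N)%N -> \sum_(i < N) ((i < j)%N%:R : R) = j%:R.
Proof.
move=> jN; have -> : j%:R = \sum_(i < j) (1 : R) by rewrite sumr_const card_ord.
rewrite (big_ord_widen N (fun=> 1))// [RHS]big_mkcond.
by apply: eq_bigr => i _; case: ifP.
Qed.

(** On integers a ramp of length 1 is already an exact step, so reading the table adds no error. *)
Lemma clamp_indicator (R : realType) (U i : nat) :
  relu (U%:R - i%:R : R) - relu (U%:R - i.+1%:R) = (i < U)%N%:R.
Proof.
case: (ltnP i U) => iU.
  have h : i.+1%:R <= U%:R :> R by rewrite ler_nat.
  by rewrite -natr1 in h *; rewrite !relu_id /=; lra.
have h : U%:R <= i%:R :> R by rewrite ler_nat.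
by rewrite -natr1 !relu_0 /=; lra.
Qed.

Lemma sum_interp (R : realType) (M U : nat) (f : nat -> R) :
  (U <= M)%N -> f 0%N + \sum_(i < M) (f i.+1 - f i) * (i < U)%N%:R = f U.
Proof.
move=> UM.
rewrite (_ : \sum_(i < M) _ = \sum_(i < U) (f i.+1 - f i)); last first.
  rewrite (big_ord_widen M (fun i => f i.+1 - f i))// [RHS]big_mkcond.
  by apply: eq_bigr => i _; case: ifP => _; rewrite ?mulr1 ?mulr0.
by rewrite -(big_mkord xpredT (fun i => f i.+1 - f i)) telescope_sumr// addrC subrK.
Qed.

Lemma sum_unit (R : realType) (F : unit -> R) : \sum_i F i = F tt.
Proof. by rewrite (big_pred1 tt)// => [[]]. Qed.

Lemma sum_boolE (R : realType) (F : bool -> R) : \sum_i F i = F true + F false.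
Proof. by rewrite big_bool. Qed.

Lemma normr_bool_le1 (R : realType) (b : bool) : `|b%:R : R| <= 1.
Proof. by case: b; rewrite ?normr1 ?normr0. Qed.

Lemma hnet_ramps (R : realType) (W : nat) (K : finType) (N : nat) (dl B : R) :
  (0 < N)%N -> 0 < dl -> 1 + dl^-1 <= B -> (#|{: unit + K}| <= W)%N ->
  hnet W B (#|{: (unit + K) + K * 'I_N * bool}|.+1 * #|{: unit + K}|.+2) 1
    (fun (v : unit + K -> R) (v' : (unit + K) + K * 'I_N * bool -> R) =>
      (forall o, v' (inl o) = relu (v o)) /\
      forall k (i : 'I_N) (b : bool), v' (inr (k, i, b)) =
         relu ((v (inr k) - i.+1%:R / N%:R) / dl + b%:R)).
Proof.
move=> N0 d0 BB IW.
have di : 0 < dl^-1 by rewrite invr_gt0.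
pose A (j : (unit + K) + K * 'I_N * bool) (i0 : unit + K) : R := match j with
  | inl o => 1 * (i0 == o)%:R | inr (k, i, b) => dl^-1 * (i0 == inr k)%:R end.
pose c (j : (unit + K) + K * 'I_N * bool) : R := match j with
  | inl o => 0 | inr (k, i, b) => (b : bool)%:R - i.+1%:R / N%:R / dl end.
apply: (@hnet_lay R W B _ _ A c) => //; first lra.
- have b01 (x y : unit + K) : 0 <= (x == y)%:R :> R /\ (x == y)%:R <= 1 :> R.
    by case: eqP => _; rewrite ?ler01 ?lexx.
  move=> [p|[[k i] b]] i0; rewrite /A ger0_norm.
  + by have := b01 i0 p; lra.
  + by rewrite mul1r; have := b01 i0 p; lra.
  + have [h1 h2] := b01 i0 (inr k); apply: (@le_trans _ _ dl^-1); last lra.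
    by rewrite ler_piMr// ltW.
  + by apply: mulr_ge0; [exact: ltW|have := b01 i0 (inr k); lra].
- move=> [p|[[k i] b]]; rewrite /c ?normr0; first lra.
  have h1 : 0 <= (b : bool)%:R :> R /\ b%:R <= 1 :> R by case: b; rewrite ?ler01 ?lexx.
  have h2 : 0 <= (i.+1%:R / N%:R : R) <= 1.
    by rewrite divr_ge0//= ler_pdivrMr ?ltr0n// mul1r ler_nat.
  have h3 : 0 <= i.+1%:R / N%:R / dl <= dl^-1.
    have /andP[h4 h5] := h2; apply/andP; split; first by apply: mulr_ge0 => //; exact: ltW.
    by rewrite ler_piMl// ltW.
  by rewrite ler_norml; apply/andP; split; lra.
- move=> v; split=> [p|k i b]; rewrite /lay /A /c sum_pick; first by rewrite mul1r addr0.
  by congr relu; field; rewrite gt_eqF//= pnatr_eq0 -lt0n N0.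
Qed.

Lemma hnet_index (R : realType) (W : nat) (K : finType) (N : nat) (B : R) :
  (0 < N)%N -> (N ^ #|K|)%:R <= B -> (#|{: (unit + K) + K * 'I_N * bool}| <= W)%N ->
  hnet W B (#|{: unit + K}|.+1 * #|{: (unit + K) + K * 'I_N * bool}|.+2) 1
    (fun (v : (unit + K) + K * 'I_N * bool -> R) (v' : unit + K -> R) =>
      (forall k, v' (inr k) = relu (v (inl (inr k)))) /\
      v' (inl tt) = relu ((N ^ #|K|)%:R * v (inl (inl tt)) +
        \sum_k (N ^ enum_rank k)%:R * \sum_(i < N) (v (inr (k, i, true)) - v (inr (k, i, false))))).
Proof.
move=> N0 BB IW.
have NB (p : nat) : (p <= #|K|)%N -> (N ^ p)%:R <= B.
  by move=> pK; apply: le_trans BB; rewrite ler_nat leq_pexp2l.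
have B1 : 1 <= B by have := NB 0%N (leq0n _).
pose A (j : unit + K) (u : (unit + K) + K * 'I_N * bool) : R := match j with
  | inr k => 1 * (u == inl (inr k))%:R
  | inl _ => match u with
     | inl (inl _) => (N ^ #|K|)%:R
     | inl (inr _) => 0
     | inr (k, i, b) => (N ^ enum_rank k)%:R * (if b : bool then 1 else -1) end end.
apply: (@hnet_lay R W B _ _ A (fun=> 0)) => //; first lra.
- move=> [t|k] [[t'|k']|[[k' i] b]]; rewrite /A ?mul1r ?normr0; try lra.
  + by rewrite ger0_norm.
  + rewrite normrM ger0_norm//; have -> : `|if b then 1 else -1 : R| = 1.
      by case: b; rewrite ?normrN normr1.
    by rewrite mulr1; apply: NB; exact: ltnW.
  + exact: le_trans (normr_bool_le1 _ _) B1.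
- by move=> _; rewrite normr0; lra.
- move=> v; split=> [k|]; rewrite /lay /A addr0; first by rewrite sum_pick mul1r.
  rewrite !big_sumType /= sum_unit [X in _ + X + _]big1 ?addr0; last by move=> k _; rewrite mul0r.
  congr (relu (_ + _)).
  transitivity (\sum_(ki : K * 'I_N) \sum_(b : bool) (N ^ enum_rank ki.1)%:R * (if b : bool then 1 else -1) * v (inr (ki.1, ki.2, b))).
    by rewrite pair_bigA; apply: eq_bigr => [[[? ?] ?]].
  rewrite -(pair_bigA _ (fun k i => \sum_(b : bool) (N ^ enum_rank k)%:R * (if b : bool then 1 else -1) * v (inr (k, i, b)))) /=.
  apply: eq_bigr => k _; rewrite mulr_sumr; apply: eq_bigr => i _.
  by rewrite sum_boolE; ring.
Qed.

Lemma hnet_hats (R : realType) (W : nat) (K : finType) (M : nat) (B : R) :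
  1 <= B -> M%:R <= B -> (#|{: unit + K}| <= W)%N ->
  hnet W B (#|{: 'I_M * bool + K}|.+1 * #|{: unit + K}|.+2) 1
    (fun (v : unit + K -> R) (v' : 'I_M * bool + K -> R) =>
      (forall k, v' (inr k) = relu (v (inr k))) /\
      forall (i : 'I_M) (b : bool), v' (inl (i, b)) = relu (v (inl tt) - (i + b)%:R)).
Proof.
move=> B1 BB IW.
pose A (j : 'I_M * bool + K) (u : unit + K) : R := match j with
  | inl _ => 1 * (u == inl tt)%:R | inr k => 1 * (u == inr k)%:R end.
pose c (j : 'I_M * bool + K) : R := match j with
  | inl (i, b) => - ((i : nat) + (b : bool))%:R | inr k => 0 end.
apply: (@hnet_lay R W B _ _ A c) => //; first lra.
- by move=> [[i b]|k] u; rewrite /A mul1r; apply: le_trans (normr_bool_le1 _ _) B1.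
- move=> [[i b]|k]; rewrite /c ?normr0; last lra.
  rewrite normrN ger0_norm//; apply: le_trans BB; rewrite ler_nat.
  by have := ltn_ord i; case: b; lia.
- by move=> v; split=> [k|i b]; rewrite /lay /A /c sum_pick mul1r ?addr0.
Qed.

(** The register set to 1 will be the neutral factor of the multiplication rounds. The increments of
    [tau] used as weights have modulus at most 1 because all values lie in [0,1]. *)
Lemma hnet_table (R : realType) (W : nat) (K E : finType) (M : nat) (tau : E -> nat -> R) (B : R) :
  1 <= B -> (forall e U, 0 <= tau e U <= 1) -> (#|{: 'I_M * bool + K}| <= W)%N ->
  hnet W B (#|{: (unit + K) + E}|.+1 * #|{: 'I_M * bool + K}|.+2) 1
    (fun (v : 'I_M * bool + K -> R) (v' : (unit + K) + E -> R) =>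
      [/\ v' (inl (inl tt)) = 1, (forall k, v' (inl (inr k)) = relu (v (inr k))) &
      forall e, v' (inr e) = relu (tau e 0%N + \sum_(i < M) (tau e i.+1 - tau e i) *
          (v (inl (i, false)) - v (inl (i, true))))]).
Proof.
move=> B1 t01 IW.
pose A (j : (unit + K) + E) (u : 'I_M * bool + K) : R := match j with
  | inl (inl _) => 0
  | inl (inr k) => 1 * (u == inr k)%:R
  | inr e => match u with
    | inl (i, b) => (tau e i.+1 - tau e i) * (if b : bool then -1 else 1)
    | inr _ => 0 end end.
pose c (j : (unit + K) + E) : R := match j with
  | inl (inl _) => 1 | inl (inr k) => 0 | inr e => tau e 0%N end.
apply: (@hnet_lay R W B _ _ A c) => //; first lra.
- move=> [[t|k]|e] u; rewrite /A ?normr0 ?mul1r; try lra.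
    exact: le_trans (normr_bool_le1 _ _) B1.
  case: u => [[i b]|k]; rewrite ?normr0; last lra.
  rewrite normrM; have -> : `|if b then -1 else 1 : R| = 1.
    by case: b; rewrite ?normrN normr1.
  have := t01 e i.+1; have := t01 e i; rewrite mulr1 ler_norml; lra.
- move=> [[t|k]|e]; rewrite /c ?normr0 ?normr1; try lra.
  by have := t01 e 0%N; rewrite ler_norml; lra.
- move=> v; split=> [|k|e]; rewrite /lay /A /c.
  + by rewrite big1 ?add0r ?relu_id// => u _; rewrite mul0r.
  + by rewrite sum_pick mul1r addr0.
  + rewrite big_sumType /= [X in _ + X + _]big1 ?addr0; last by move=> k _; rewrite mul0r.
    congr relu; rewrite addrC; congr (_ + _).
    transitivity (\sum_(i < M) \sum_(b : bool) (tau e i.+1 - tau e i) * (if b : bool then -1 else 1) * v (inl (i, b))).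
      by rewrite pair_bigA; apply: eq_bigr => [[? ?]].
    by apply: eq_bigr => i _; rewrite sum_boolE; ring.
Qed.

(** Every wide layer of the front end joins one family of registers, of size governed by [N] or [M],
    to a number of others that depends on [k] and [e] only, so the count is linear in [N + M]. The
    same number also bounds the widths. *)
Definition front_cost (k e N M : nat) : nat := (100 * (k + e + 3) ^ 2 * (N + M))%N.

Definition in_cell (R : realType) (K : finType) (N : nat) (dl : R) (j : K -> nat) (x : K -> R) : Prop :=
  forall k, 0 <= x k <= 1 /\ (j k)%:R / N%:R <= x k <= (j k).+1%:R / N%:R - dl.

(** The six layers are ramps, index, breakpoints, table, and two for [clip]. Off the shrunken cells
    the index may be anything, and the final [clip] is what keeps the registers in [0,1] there. *)
Lemma hnet_front (R : realType) (W : nat) (K E : finType) (N n : nat) (dl B : R)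
    (tau : E -> nat -> R) :
  (0 < N)%N -> (0 < n)%N -> 0 < dl -> 1 + dl^-1 <= B -> (N ^ #|K| * n)%:R <= B ->
  (forall e U, 0 <= tau e U <= 1) -> (front_cost #|K| #|E| N (N ^ #|K| * n) <= W)%N ->
  hnet W B (front_cost #|K| #|E| N (N ^ #|K| * n)) 6
    (fun (v : unit + K -> R) (v' : (unit + K) + E -> R) => in01 v' /\
      forall (j : {ffun K -> 'I_N}) (q : 'I_n), v (inl tt) = (q : nat)%:R ->
        in_cell N dl (fun k => j k) (fun k => v (inr k)) ->
        [/\ v' (inl (inl tt)) = 1, (forall k, v' (inl (inr k)) = v (inr k)) &
            forall e, v' (inr e) = tau e (code N (fun k => j k) q)]).
Proof.
move=> N0 n0 d0 dB MB t01 costW; set M := (N ^ #|K| * n)%N in MB costW *.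
have B1 : 1 <= B by have := invr_gt0 dl; rewrite d0 => h; lra.
have M0 : (0 < M)%N by rewrite muln_gt0 expn_gt0 N0.
have NB : (N ^ #|K|)%:R <= B by apply: le_trans MB; rewrite ler_nat leq_pmulr.
have cards : [/\ #|{: unit + K}| = #|K|.+1,
   #|{: (unit + K) + K * 'I_N * bool}| = (#|K|.+1 + #|K| * N * 2)%N,
   #|{: 'I_M * bool + K}| = (M * 2 + #|K|)%N &
   #|{: (unit + K) + E}| = (#|K|.+1 + #|E|)%N].
  by rewrite !card_sum !card_prod !card_ord card_unit card_bool.
have [c1 c2 c3 c4] := cards.
have cost : (#|{: (unit + K) + K * 'I_N * bool}|.+1 * #|{: unit + K}|.+2 +
   #|{: unit + K}|.+1 * #|{: (unit + K) + K * 'I_N * bool}|.+2 +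
   #|{: 'I_M * bool + K}|.+1 * #|{: unit + K}|.+2 +
   #|{: (unit + K) + E}|.+1 * #|{: 'I_M * bool + K}|.+2 +
   (#|{: (unit + K) + E}|.+1 * #|{: (unit + K) + E}|.+2 +
    #|{: (unit + K) + E}|.+1 * #|{: (unit + K) + E}|.+2) <= front_cost #|K| #|E| N M)%N.
  rewrite c1 c2 c3 c4 /front_cost; move: (#|K|) (#|E|) => k e.
  have -> : (100 * (k + e + 3) ^ 2 * (N + M) = 100 * (k + e + 3) * (k + e + 3) * (N + M))%N.
    by rewrite -mulnn mulnA.
  have [P kP eP] : exists2 P, P = (k + e + 3)%N & (k + e + 3 = P)%N by exists (k + e + 3)%N.
  rewrite eP.
  have h1 : (P <= P * N)%N by rewrite leq_pmulr.
  have h2 : (P <= P * M)%N by rewrite leq_pmulr.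
  have h3 : (k * N <= P * N)%N by rewrite leq_mul2r; apply/orP; right; lia.
  have h4 : (M <= P * M)%N by rewrite leq_pmull//; lia.
  have b1 : ((k.+1 + k * N * 2).+2 <= 4 * (P * N))%N by move: h1 h3 kP; clear; lia.
  have b2 : ((M * 2 + k).+2 <= 4 * (P * M))%N by move: h2 h4 kP; clear; lia.
  have b3 : ((k.+1 + e).+2 <= 2 * (P * M))%N by move: h2 kP; clear; lia.
  have p1 : ((k.+1 + k * N * 2).+1 * k.+3 <= 4 * (P * N) * P)%N.
    by apply: leq_mul; [exact: ltnW|move: kP; clear; lia].
  have p2 : (k.+2 * (k.+1 + k * N * 2).+2 <= P * (4 * (P * N)))%N.
    by apply: leq_mul => //; move: kP; clear; lia.
  have p3 : ((M * 2 + k).+1 * k.+3 <= 4 * (P * M) * P)%N.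
    by apply: leq_mul; [exact: ltnW|move: kP; clear; lia].
  have p4 : ((k.+1 + e).+1 * (M * 2 + k).+2 <= P * (4 * (P * M)))%N.
    by apply: leq_mul => //; move: kP; clear; lia.
  have p5 : ((k.+1 + e).+1 * (k.+1 + e).+2 <= P * (2 * (P * M)))%N.
    by apply: leq_mul => //; move: kP; clear; lia.
  have e1 : (4 * (P * N) * P = 4 * (P * P * N))%N by ring.
  have e2 : (P * (4 * (P * N)) = 4 * (P * P * N))%N by ring.
  have e3 : (4 * (P * M) * P = 4 * (P * P * M))%N by ring.
  have e4 : (P * (4 * (P * M)) = 4 * (P * P * M))%N by ring.
  have e5 : (P * (2 * (P * M)) = 2 * (P * P * M))%N by ring.
  have e6 : (100 * P * P * (N + M) = 100 * (P * P * N) + 100 * (P * P * M))%N by ring.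
  rewrite e6; rewrite e1 in p1; rewrite e2 in p2; rewrite e3 in p3; rewrite e4 in p4; rewrite e5 in p5.
  by move: p1 p2 p3 p4 p5; clear; lia.
(* Each number of registers occurs in a factor of the cost, hence lies below it. *)
have widths : [/\ (#|{: unit + K}| <= W)%N, (#|{: (unit + K) + K * 'I_N * bool}| <= W)%N,
   (#|{: 'I_M * bool + K}| <= W)%N & (#|{: (unit + K) + E}| <= W)%N].
  move: cost; set a1 := #|{: unit + K}|; set a2 := #|{: (unit + K) + _ * _}|.
  set a3 := #|{: _ * bool + K}|; set a4 := #|{: (unit + K) + E}| => cost.
  by split; nia.
have [w1 w2 w3 w4] := widths.
have Hc : hnet W B _ 2 _ := hnet_weaken B1 (leqnn _) (fun u v H => H) (@hnet_clip R W _ w4).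
have H := hnet_comp (hnet_comp (hnet_comp (hnet_comp
   (hnet_ramps N0 d0 dB w1) (hnet_index N0 NB w2) (fun u v w H1 H2 => ex_intro2 _ _ v H1 H2))
   (hnet_hats B1 MB w1) (fun u v w H1 H2 => ex_intro2 _ _ v H1 H2))
   (hnet_table B1 t01 w3) (fun u v w H1 H2 => ex_intro2 _ _ v H1 H2))
   Hc (fun u v w H1 H2 => ex_intro2 _ _ v H1 H2).
apply: hnet_weaken H => //.
move=> v v' [v4 [v3 [v2 [v1 [r1 r2] [i1 i2]] [h1 h2]] [t1 t2 t3]] Hv']; split.
  by move=> i; rewrite Hv'; exact: clip01.
move=> j q vq cell.
have x0 k : relu (v (inr k)) = v (inr k) by rewrite relu_id//; have [/andP[]] := cell k.
have v2q : v2 (inl tt) = (code N (fun k => j k) q)%:R.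
  rewrite i2 r1 vq [relu q%:R]relu_id//.
  rewrite (_ : \sum_k _ = \sum_k (N ^ enum_rank k)%:R * (j k)%:R); last first.
    apply: eq_bigr => k _; congr (_ * _).
    (* The digit [j k] is the number of ramps that coordinate [k] has climbed. *)
    rewrite -[RHS](@sum_lt_indicator R N); last exact: ltnW.
    apply: eq_bigr => i _; rewrite !r2 addr0.
    by apply: step_indicator => //; have [_] := cell k.
  rewrite relu_id; last first.
    by rewrite addr_ge0 ?mulr_ge0// sumr_ge0// => k _; rewrite mulr_ge0.
  by rewrite /code natrD natr_sum natrM addrC; congr (_ + _); apply: eq_bigr => k _; rewrite natrM.
split=> [|k|e]; rewrite Hv'.
- by rewrite t1 clip_id// ler01 lexx.
- rewrite t2 h1 i1 r1 !x0 clip_id//; by have [] := cell k.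
- rewrite t3 (_ : \sum_(i < M) _ = \sum_(i < M) (tau e i.+1 - tau e i) * (i < code N (fun k => j k) q)%N%:R); last first.
    apply: eq_bigr => i _; congr (_ * _); rewrite !h2 v2q addn0 addn1.
    exact: clamp_indicator.
  rewrite sum_interp; last exact/ltnW/code_lt.
  have /andP[tau0 tau1] := t01 e (code N (fun k => j k) q).
  by rewrite relu_id// clip_id// tau0.
Qed.

(** Round (k, i) multiplies register [e] by coordinate [k] only while [i] is below the exponent, and
    by the constant 1 otherwise; running over i < s then produces exactly the required power. *)
Definition pow_round (K E : finType) (expo : E -> K -> nat) (ki : K * nat) :
    ((unit + K) + E -> (unit + K) + E) * ((unit + K) + E -> (unit + K) + E) :=
  (id, fun r => match r with
     | inr e => if (ki.2 < expo e ki.1)%N then inl (inr ki.1) else inl (inl tt)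
     | inl _ => inl (inl tt) end).

Lemma mul_rounds_pow (R : realType) (K E : finType) (expo : E -> K -> nat) (l : seq (K * nat))
    (v : (unit + K) + E -> R) :
  v (inl (inl tt)) = 1 ->
  [/\ forall o, mul_rounds (map (pow_round expo) l) v (inl o) = v (inl o) &
    forall e, mul_rounds (map (pow_round expo) l) v (inr e) =
      v (inr e) * \prod_(ki <- l) (if (ki.2 < expo e ki.1)%N then v (inl (inr ki.1)) else 1)].
Proof.
elim: l v => [|ki l IH] v v1.
  by split=> // e; rewrite big_nil mulr1.
pose v' := mul_round v (pow_round expo ki).
have v'l p : v' (inl p) = v (inl p) by rewrite /v' /mul_round /= v1 mulr1.
have [|h1 h2] := IH v'; first by rewrite v'l.
split=> [p|e]; rewrite /mul_rounds /= -/(mul_rounds _ _); first by rewrite h1.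
rewrite h2 big_cons mulrA; congr (_ * _).
  by rewrite /v' /mul_round /=; case: ifP => _; rewrite ?v1.
by apply: eq_bigr => ki' _; rewrite v'l.
Qed.

Definition pow_rounds (K E : finType) (expo : E -> K -> nat) (s : nat) :=
  map (pow_round expo) [seq (k, i) | k <- enum K, i <- iota 0 s].

Lemma size_pow_rounds (K E : finType) (expo : E -> K -> nat) (s : nat) :
  size (pow_rounds expo s) = (#|K| * s)%N.
Proof. by rewrite size_map size_allpairs size_iota -cardE. Qed.

Lemma mul_pow_rounds (R : realType) (K E : finType) (expo : E -> K -> nat) (s : nat)
    (v : (unit + K) + E -> R) :
  v (inl (inl tt)) = 1 -> (forall e k, (expo e k <= s)%N) ->
  forall e, mul_rounds (pow_rounds expo s) v (inr e) =
     v (inr e) * \prod_k v (inl (inr k)) ^+ expo e k.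
Proof.
move=> v1 es e; have [_ ->//] := mul_rounds_pow expo [seq (k, i) | k <- enum K, i <- iota 0 s] v1.
rewrite big_allpairs_dep big_enum; congr (_ * _); apply: eq_bigr => k _.
have -> : iota 0 s = index_iota 0 s by rewrite /index_iota subn0.
rewrite big_mkord -big_mkcond /=.
rewrite (_ : \prod_(i < s | _) _ = \prod_(i < expo e k) v (inl (inr k))).
  by rewrite prodr_const card_ord.
by rewrite (big_ord_widen s (fun=> v (inl (inr k)))).
Qed.

Definition poly_cost (k e s N M L : nat) : nat :=
  (front_cost k e N M + k * s * (round_cost (k.+1 + e) * (L + 4)))%N.

(** On a shrunken cell the front end is exact, so only the [#|K| * s] multiplication rounds
    contribute an error. *)
Lemma hnet_poly (R : realType) (W : nat) (K E : finType) (N n s L : nat) (dl B : R)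
    (tau : E -> nat -> R) (expo : E -> K -> nat) :
  (0 < N)%N -> (0 < n)%N -> 0 < dl -> 1 + dl^-1 <= B -> (N ^ #|K| * n)%:R <= B -> 4 <= B ->
  (forall e U, 0 <= tau e U <= 1) -> (forall e k, (expo e k <= s)%N) ->
  (front_cost #|K| #|E| N (N ^ #|K| * n) <= W)%N -> (9 * (#|K|.+1 + #|E|) <= W)%N ->
  hnet W B (poly_cost #|K| #|E| s N (N ^ #|K| * n) L) (6 + #|K| * s * (L + 4))
    (fun (v : unit + K -> R) (v' : (unit + K) + E -> R) => in01 v' /\
      forall (j : {ffun K -> 'I_N}) (q : 'I_n), v (inl tt) = (q : nat)%:R ->
        in_cell N dl (fun k => j k) (fun k => v (inr k)) ->
        forall e, `|v' (inr e) - tau e (code N (fun k => j k) q) * \prod_k v (inr k) ^+ expo e k|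
           <= 2 ^+ (#|K| * s) * 4 ^- L).
Proof.
move=> N0 n0 d0 dB MB B4 t01 es w1 w2.
have c4 : #|{: (unit + K) + E}| = (#|K|.+1 + #|E|)%N by rewrite !card_sum card_unit.
rewrite /poly_cost -c4 -(size_pow_rounds expo s).
apply: (hnet_comp (hnet_front N0 n0 d0 dB MB t01 w1)).
  apply: (hnet_weaken B4 (leqnn _) (fun u v H => H)).
  by apply: (@hnet_rounds R W _ (pow_rounds expo s) L); rewrite c4.
move=> u v w [v01 Hv] /(_ v01) [w01 Hw]; split=> // j q uq cell e.
have [v1 vx vt] := Hv j q uq cell.
rewrite -vt (_ : \prod_k _ = \prod_k v (inl (inr k)) ^+ expo e k).
  by rewrite -(mul_pow_rounds v1 es).
by apply: eq_bigr => k _; rewrite vx.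
Qed.

(** * Gathering the columns by self-attention *)

(** A linear map in the guise of a ReLU network: identity hidden layers fill up the prescribed depth
    and act trivially on nonnegative vectors. *)
Definition lin_fnn (R : realType) (a b w m : nat) (A : 'M[R]_(w, a)) (C : 'M[R]_(b, w)) : FNN R a b :=
  mkFNN A 0 (nseq m (1%:M, 0)) C 0.

Lemma relu_mx_id (R : realType) (m k : nat) (A : 'M[R]_(m, k)) :
  (forall i j, 0 <= A i j) -> relu_mx A = A.
Proof. by move=> A0; apply/matrixP => i j; rewrite mxE max_l. Qed.

Lemma lin_fnn_eval (R : realType) (a b w m : nat) (A : 'M[R]_(w, a)) (C : 'M[R]_(b, w)) z :
  (forall i j, 0 <= (A *m z) i j) -> fnn_eval (lin_fnn m A C) z = C *m (A *m z).
Proof.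
move=> A0; rewrite /fnn_eval /= !addr0 relu_mx_id//; congr (_ *m _).
by elim: m => //= m; rewrite mul1mx addr0 relu_mx_id.
Qed.

Lemma ff_block_id (R : realType) (D w n : nat) (Y : 'M[R]_(D, n)) :
  (D <= w)%N -> (forall i j, 0 <= Y i j) ->
  ff_block (lin_fnn 1 (pid_mx D : 'M[R]_(w, D)) (pid_mx D : 'M[R]_(D, w))) Y = Y.
Proof.
move=> Dw Y0.
have P : (pid_mx D : 'M[R]_(D, w)) *m (pid_mx D : 'M[R]_(w, D)) = 1%:M.
  by rewrite mul_pid_mx minnn (minn_idPr Dw) pid_mx_1.
apply/matrixP => i j; rewrite mxE lin_fnn_eval; last first.
  move=> r c; rewrite mxE sumr_ge0// => k _; rewrite !mxE mulr_ge0//.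
by rewrite mulmxA P mul1mx mxE.
Qed.

Definition e_col (R : realType) (m i : nat) : 'cV[R]_m := \col_r ((r : nat) == i)%:R.

Lemma e_col_mul (R : realType) (m k i : nat) (X : 'M[R]_(m, k)) (im : (i < m)%N) r c :
  ((e_col R m i)^T *m X) r c = X (Ordinal im) c.
Proof.
rewrite mxE (bigD1 (Ordinal im))//= !mxE eqxx mul1r big1 ?addr0// => j ji.
by rewrite !mxE -[_ == i]/(j == Ordinal im) (negPf ji) mul0r.
Qed.

(** Rank-one matrices through one coordinate of the head: row [i] is averaged over the columns and
    added to row [o], with row [k] as key and row [q] as query. *)
Definition attend_head (R : realType) (D S i o k q : nat) : SAhead R D S :=
  mkSAhead (e_col R D o *m (e_col R S 0)^T) (e_col R S 0 *m (e_col R D i)^T)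
           (e_col R S 0 *m (e_col R D k)^T) (e_col R S 0 *m (e_col R D q)^T).

(** Fills up the prescribed head numbers without changing the layer. *)
Definition zero_head (R : realType) (D S : nat) : SAhead R D S := mkSAhead 0 0 0 0.

Lemma attend_head_eval (R : realType) (D S n i o k q : nat) (X : 'M[R]_(D, n))
    (iD : (i < D)%N) (kD : (k < D)%N) (qD : (q < D)%N) r c :
  (0 < S)%N -> let h := attend_head R D S i o k q in
  (sa_WO h *m sa_WV h *m X *m softmax_col (X^T *m (sa_WK h)^T *m sa_WQ h *m X)) r c =
  ((r : nat) == o)%:R * \sum_(j < n) X (Ordinal iD) j *
     (expR (X (Ordinal kD) j * X (Ordinal qD) c) /
      \sum_(l < n) expR (X (Ordinal kD) l * X (Ordinal qD) c)).
Proof.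
move=> S0 /=.
have E : (e_col R S 0)^T *m e_col R S 0 = 1%:M.
  by apply/matrixP => a b; rewrite (@e_col_mul _ _ _ _ _ S0) !mxE !ord1 !eqxx.
rewrite -!mulmxA [(e_col R S 0)^T *m (e_col R S 0 *m _)]mulmxA E mul1mx.
rewrite !trmx_mul trmxK.
rewrite -!mulmxA [(e_col R S 0)^T *m (e_col R S 0 *m _)]mulmxA E mul1mx.
rewrite mxE big_ord1 [e_col _ _ _ _ _]mxE; congr (_ * _).
rewrite e_col_mul mxE; apply: eq_bigr => j _; congr (_ * _).
have Q a b : (X^T *m (e_col R D k *m ((e_col R D q)^T *m X))) a b =
    X (Ordinal kD) a * X (Ordinal qD) b.
  rewrite mulmxA mxE big_ord1 (e_col_mul X qD); congr (_ * _).
  rewrite -[X^T *m _]trmxK trmx_mul trmxK mxE.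
  exact: e_col_mul.
by rewrite mxE Q; congr (_ / _); apply: eq_bigr => l _; rewrite Q.
Qed.

Lemma zero_head_eval (R : realType) (D S n : nat) (X : 'M[R]_(D, n)) :
  let h := zero_head R D S in
  sa_WO h *m sa_WV h *m X *m softmax_col (X^T *m (sa_WK h)^T *m sa_WQ h *m X) = 0.
Proof. by rewrite /= !mul0mx. Qed.

Definition entry (R : realType) (d n : nat) (X : 'M[R]_(d, n)) (i : nat) (q : 'I_n) : R :=
  oapp (fun a => X a q) 0 (insub i : option 'I_d).

(* The score is 1 at position l and 0 elsewhere, so the softmax weights
   do not depend on X. *)
Definition gathered (R : realType) (d n : nat) (X : 'M[R]_(d, n)) (l i : nat) : R :=
  \sum_(j < n) entry X i j *
     (expR ((j : nat) == l)%:R / \sum_(k < n) expR ((k : nat) == l)%:R).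

(** The state after [l] attention layers. Its row blocks are [X], the one-hot position, a constant 1
    that serves as query, [d] mixtures for each layer passed, and zeros to which the residual
    connection adds the later mixtures. *)
Definition gather_state (R : realType) (d n D l : nat) (X : 'M[R]_(d, n)) : 'M[R]_(D, n) :=
  \matrix_(r, q)
    if (r < d)%N then entry X r q
    else if (r < d + n)%N then (r - d == q)%N%:R
    else if (r < d + n + 1)%N then 1
    else if (r - (d + n + 1) < l * d)%N
      then gathered X ((r - (d + n + 1)) %/ d) ((r - (d + n + 1)) %% d) else 0.

Definition gather_sa (R : realType) (d n D S H l : nat) : SA R D :=
  mkSA ([seq attend_head R D S i (d + n + 1 + l * d + i) (d + l) (d + n) | i <- iota 0 d]
    ++ nseq (H - d) (zero_head R D S)).

Lemma gather_sa_eval (R : realType) (d n D S H l : nat) (X : 'M[R]_(d, n)) :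
  (0 < S)%N -> (0 < d)%N -> (l < n)%N -> (d + n + 1 + d * n <= D)%N ->
  sa_eval (gather_sa R d n D S H l) (gather_state D l X) = gather_state D l.+1 X.
Proof.
move=> S0 d0 ln hD.
have idD i : (i < d)%N -> (i < D)%N by lia.
have kD : (d + l < D)%N by lia.
have qD : (d + n < D)%N by lia.
have dln : ((l.+1) * d <= d * n)%N by rewrite mulnC leq_mul2l ln orbT.
rewrite /sa_eval /= big_cat /= [X in _ + (_ + X)](_ : _ = 0) ?addr0; last first.
  elim: (H - d)%N => [|m IH]; first by rewrite big_nil.
  by rewrite [nseq _ _]/= big_cons zero_head_eval add0r.
rewrite big_map.
apply/matrixP => r c; rewrite mxE summxE.
rewrite (_ : \sum_(i <- iota 0 d) _ =
    \sum_(i <- iota 0 d) ((r : nat) == d + n + 1 + l * d + i)%N%:R * gathered X l i); last first.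
  rewrite big_seq [RHS]big_seq; apply: eq_bigr => i; rewrite mem_iota => /andP[_ id].
  rewrite (attend_head_eval _ _ (idD i id) kD qD)//; congr (_ * _).
  have e1 j : gather_state D l X (Ordinal (idD i id)) j = entry X i j.
    by rewrite mxE /= id.
  (* The key is row [l] of the one-hot block and the query is constantly 1, so the score is [j = l]
     in every column. *)
  have e2 j : gather_state D l X (Ordinal kD) j * gather_state D l X (Ordinal qD) c = ((j : nat) == l)%:R.
    rewrite !mxE /= !ltnNge !leq_addr /= -!ltnNge ltn_add2l ln ltnn addn1 ltnS leqnn mulr1.
    by rewrite addKn eq_sym.
  rewrite /gathered; apply: eq_bigr => j _; rewrite e1 e2; congr (_ * (_ / _)).
  by apply: eq_bigr => k _; rewrite e2.
rewrite !mxE.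
case: ifP => rd.
  rewrite big1_seq ?addr0// => i _; case: eqP => [E|]; rewrite ?mul0r//.
  by move: rd; rewrite E; lia.
case: ifP => rdn.
  rewrite big1_seq ?addr0// => i _; case: eqP => [E|]; rewrite ?mul0r//.
  by move: rdn; rewrite E; lia.
case: ifP => rdn1.
  rewrite big1_seq ?addr0// => i _; case: eqP => [E|]; rewrite ?mul0r//.
  by move: rdn1; rewrite E; lia.
(* [r'] counts rows from the start of the mixtures; layer [l] fills those with l d <= r' < (l+1)
   d. *)
set r' := (r - _)%N; have rE : (r : nat) = (d + n + 1 + r')%N by rewrite /r'; lia.
have -> : \sum_(i <- iota 0 d) ((r : nat) == d + n + 1 + l * d + i)%N%:R * gathered X l i =
    \sum_(i < d) (r' == l * d + i)%N%:R * gathered X l i.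
  rewrite -(big_mkord xpredT (fun i => (r' == l * d + i)%N%:R * gathered X l i)) /index_iota subn0.
  by apply: eq_bigr => i _; rewrite rE -[(d + n + 1 + l * d + i)%N]addnA eqn_add2l.
case: (ltnP r' (l * d)) => rl.
  rewrite (leq_trans rl); last by rewrite mulSn leq_addl.
  rewrite big1 ?addr0// => i _; case: eqP => [E|]; rewrite ?mul0r//.
  by move: rl; rewrite E ltnNge leq_addr.
rewrite add0r mulSn; case: (ltnP r' (d + l * d)) => rl2.
  have id : (r' - l * d < d)%N by lia.
  rewrite (bigD1 (Ordinal id))//= subnKC// eqxx mul1r big1 ?addr0.
    by rewrite -[in RHS](subnKC rl) divnMDl// divn_small// addn0 modnMDl modn_small.
  move=> i ne; case: eqP => [E|]; rewrite ?mul0r//; case/negP: ne; apply/eqP/val_inj => /=.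
  by rewrite E addKn.
rewrite big1// => i _; case: eqP => [E|]; rewrite ?mul0r//.
by move: rl2; rewrite E; have := ltn_ord i; lia.
Qed.

Lemma gather_state_ge0 (R : realType) (d n D l : nat) (X : 'M[R]_(d, n)) :
  in_cube X -> forall r q, 0 <= gather_state D l X r q.
Proof.
move=> Xc r q.
have e0 i j : 0 <= entry X i j.
  by rewrite /entry; case: insub => //= a; have /andP[] := Xc a j.
rewrite mxE; do 4 case: ifP => _ //.
rewrite /gathered; apply: sumr_ge0 => j _; apply: mulr_ge0 => //.
by rewrite divr_ge0 ?expR_ge0// sumr_ge0// => k _; rewrite expR_ge0.
Qed.

Definition embed_W (R : realType) (d n : nat) : 'M[R]_(d + n + 1, d) :=
  \matrix_(r, c) ((r : nat) == c)%:R.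

Definition embed_B (R : realType) (d n : nat) : 'M[R]_(d + n + 1, n) :=
  \matrix_(r, q) if (r < d)%N then 0 else if (r < d + n)%N then (r - d == q)%N%:R else 1.

Lemma embed_eval (R : realType) (d n D : nat) (X : 'M[R]_(d, n)) :
  (d + n + 1 <= D)%N -> in_cube X ->
  ff_block (lin_fnn 2 (pid_mx (d + n + 1) : 'M[R]_(D, d + n + 1)) (1%:M : 'M[R]_D))
     (embed_W R d n *m X + embed_B R d n) = gather_state D 0 X.
Proof.
move=> hD Xc.
have E r q : (embed_W R d n *m X + embed_B R d n) r q =
    if (r < d)%N then entry X r q else if (r < d + n)%N then (r - d == q)%N%:R else 1.
  rewrite !mxE; case: (ltnP r d) => rd.
    rewrite addr0 (bigD1 (Ordinal rd))//= !mxE eqxx mul1r big1 ?addr0.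
      by rewrite /entry insubT.
    move=> j ji; rewrite !mxE; case: eqP => [rj|]; rewrite ?mul0r//.
    by case/negP: ji; apply/eqP/val_inj.
  rewrite big1 ?add0r// => j _; rewrite !mxE; case: eqP => [rj|]; rewrite ?mul0r//.
  by move: rd; rewrite rj leqNgt ltn_ord.
have P z (r : 'I_D) c : ((pid_mx (d + n + 1) : 'M[R]_(D, d + n + 1)) *m (z : 'cV_ _)) r c =
    oapp (fun r' => z r' c) 0 (insub (r : nat) : option 'I_(d + n + 1)).
  rewrite mxE; case: insubP => [r' _ rr'|rn] /=.
    rewrite (bigD1 r')//= !mxE rr' eqxx -{1}rr' ltn_ord mul1r big1 ?addr0// => j jr.
    rewrite !mxE; case: eqP => [rj|]; rewrite ?mul0r//.
    by case/negP: jr; apply/eqP/val_inj; rewrite /= rr'.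
  rewrite big1// => j _; rewrite !mxE; case: eqP => [rj|]; rewrite ?mul0r//.
  by rewrite (negPf rn) mul0r.
have S (r : 'I_D) q : oapp (fun r' => col q (embed_W R d n *m X + embed_B R d n) r' 0) 0
     (insub (r : nat) : option 'I_(d + n + 1)) = gather_state D 0 X r q.
  rewrite mxE mul0n ltn0; case: insubP => [r' _ rr'|rn] /=.
    rewrite mxE E -rr'; case: ifP => // _; case: ifP => // _.
    by rewrite ltn_ord.
  by rewrite !ifF//; lia.
apply/matrixP => r q; rewrite mxE lin_fnn_eval ?mul1mx ?P ?S// => i j.
by rewrite (ord1 j) P S gather_state_ge0.
Qed.

Definition gather_sas (R : realType) (d n D bin : nat) (l : nat) : SA R D :=
  if l == 0%N then gather_sa R d n D (maxn (d * n) 3) ((3 * d + 1) * bin) l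
  else gather_sa R d n D 3 (3 * d * bin) l.

Definition gather_tf (R : realType) (d n D w bin : nat) (F : FNN R D d) : TF R n d (d + n + 1) D d :=
  mkTF (embed_W R d n) (embed_B R d n)
    (lin_fnn 2 (pid_mx (d + n + 1) : 'M[R]_(D, d + n + 1)) (1%:M : 'M[R]_D))
    [seq (gather_sas R d n D bin l,
          lin_fnn 1 (pid_mx D : 'M[R]_(w, D)) (pid_mx D : 'M[R]_(D, w))) | l <- iota 0 n.-1]
    (gather_sas R d n D bin n.-1) F.

Lemma gather_tf_eval (R : realType) (d n D w bin : nat) (F : FNN R D d) (X : 'M[R]_(d, n)) :
  (0 < d)%N -> (0 < n)%N -> (D <= w)%N -> (d + n + 1 + d * n <= D)%N -> in_cube X ->
  tf_eval (gather_tf n w bin F) X = ff_block F (gather_state D n X).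
Proof.
move=> d0 n0 Dw hD Xc.
have SAE l : (l < n)%N -> sa_eval (gather_sas R d n D bin l) (gather_state D l X) = gather_state D l.+1 X.
  move=> ln; rewrite /gather_sas; case: ifP => _; apply: gather_sa_eval => //.
  by rewrite leq_max orbT.
rewrite /tf_eval /= embed_eval//; last by lia.
have -> : forall m, (m < n)%N -> foldl (fun Y p => ff_block p.2 (sa_eval p.1 Y)) (gather_state D 0 X)
   [seq (gather_sas R d n D bin l,
          lin_fnn 1 (pid_mx D : 'M[R]_(w, D)) (pid_mx D : 'M[R]_(D, w))) | l <- iota 0 m] = gather_state D m X.
  elim=> // m IH mn; rewrite -(addn1 m) (iotaD 0 m 1) map_cat foldl_cat IH /=; last exact: ltnW.
  rewrite SAE; last exact: ltnW.
  rewrite ff_block_id ?addn1// => r q; exact: gather_state_ge0.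

- by rewrite SAE ?prednK.
- by rewrite prednK.
Qed.

(** * Sizes and weight bounds of the gathering layers *)

Lemma bdd_weaken_mx (R : realType) (m k : nat) (B B' : R) (A : 'M[R]_(m, k)) :
  B <= B' -> mx_bdd B A -> mx_bdd B' A.
Proof. by move=> BB AB i j; exact: le_trans (AB i j) BB. Qed.

Lemma mx_bdd_0 (R : realType) (m k : nat) : mx_bdd 1 (0 : 'M[R]_(m, k)).
Proof. by move=> i j; rewrite mxE normr0. Qed.

Lemma mx_bdd_pid (R : realType) (m k r : nat) : mx_bdd 1 (pid_mx r : 'M[R]_(m, k)).
Proof. by move=> i j; rewrite mxE; case: (_ && _); rewrite ?normr1 ?normr0. Qed.

Lemma mx_bdd_1 (R : realType) (m : nat) : mx_bdd 1 (1%:M : 'M[R]_m).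
Proof. by move=> i j; rewrite mxE; case: (i == j); rewrite ?normr1 ?normr0. Qed.

Lemma mx_bdd_e_col_mul (R : realType) (m k i j : nat) :
  mx_bdd 1 (e_col R m i *m (e_col R k j)^T).
Proof.
move=> r c; rewrite mxE big_ord1 !mxE normrM.
by do 2 case: eqP => _; rewrite ?normr1 ?normr0 ?mulr1 ?mulr0.
Qed.

Lemma lin_fnn_bdd (R : realType) (a b w m : nat) (A : 'M[R]_(w, a)) (C : 'M[R]_(b, w)) :
  mx_bdd 1 A -> mx_bdd 1 C -> fnn_bdd 1 (lin_fnn m A C).
Proof.
move=> A1 C1; split => //=; try exact: mx_bdd_0.
by move=> p /nseqP[-> _]; split; [exact: mx_bdd_1|exact: mx_bdd_0].
Qed.

Lemma fnn_bdd_weaken (R : realType) (a b : nat) (B B' : R) (f : FNN R a b) :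
  B <= B' -> fnn_bdd B f -> fnn_bdd B' f.
Proof.
move=> BB [h1 h2 h3 h4 h5]; split; try exact: bdd_weaken_mx BB _.
by move=> p /h3[p1 p2]; split; exact: bdd_weaken_mx BB _.
Qed.

Lemma gather_sa_bdd (R : realType) (d n D S H l : nat) : sa_bdd 1 (gather_sa R d n D S H l).
Proof.
move=> h hin; have [/List.in_map_iff hin1|hin1] := (List.in_app_iff _ _ _).1 hin.
  by case: hin1 => i [<- _]; split; exact: mx_bdd_e_col_mul.
elim: (H - d)%N hin1 => //= m IH [<-|//].
by split; exact: mx_bdd_0.
Qed.

Lemma gather_sas_bdd (R : realType) (d n D bin l : nat) : sa_bdd 1 (gather_sas R d n D bin l).
Proof. by rewrite /gather_sas; case: ifP => _; exact: gather_sa_bdd. Qed.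

Lemma gather_sa_headnum (R : realType) (d n D S H l : nat) :
  (d <= H)%N -> sa_headnum (gather_sa R d n D S H l) = H.
Proof.
by move=> dH; rewrite /sa_headnum /= size_cat size_map size_iota size_nseq subnKC.
Qed.

Lemma gather_tf_length (R : realType) (d n D w bin : nat) (F : FNN R D d) :
  (0 < n)%N -> tf_length (gather_tf n w bin F) = n.
Proof. by move=> n0; rewrite /tf_length /= size_map size_iota prednK. Qed.

Lemma gather_tf_sas (R : realType) (d n D w bin : nat) (F : FNN R D d) :
  (0 < n)%N -> tf_sas (gather_tf n w bin F) = [seq gather_sas R d n D bin l | l <- iota 0 n].
Proof.
move=> n0; rewrite /tf_sas /= -map_comp -cats1.
have -> : iota 0 n = iota 0 (n.-1 + 1) by rewrite addn1 prednK.
by rewrite (iotaD 0 n.-1 1) map_cat.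
Qed.

Lemma gather_tf_ffmids (R : realType) (d n D w bin : nat) (F : FNN R D d) g :
  List.In g (tf_ffmids (gather_tf n w bin F)) ->
  g = lin_fnn 1 (pid_mx D : 'M[R]_(w, D)) (pid_mx D : 'M[R]_(D, w)).
Proof.
rewrite /tf_ffmids /= -map_comp => /List.in_map_iff[l [<- _]] //.
Qed.

Lemma gather_tf_sizes (R : realType) (d n D w bin : nat) (F : FNN R D d) :
  (0 < n)%N -> (0 < bin)%N -> let T := gather_tf n w bin F in
  forall l, (l < n)%N ->
    let A := nth (tf_saK T) (tf_sas T) l in
    (l = 0%N -> sa_headnum A = ((3 * d + 1) * bin)%N /\ sa_size A = maxn (d * n) 3) /\
    ((0 < l)%N -> sa_headnum A = (3 * d * bin)%N /\ sa_size A = 3%N).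
Proof.
move=> n0 b0 /= l ln; rewrite gather_tf_sas//.
rewrite (nth_map 0%N) ?size_iota// nth_iota// add0n /gather_sas; split=> l0.
  by rewrite l0 eqxx gather_sa_headnum//; nia.
by rewrite gtn_eqF// gather_sa_headnum//; nia.
Qed.

Lemma gather_tf_bdd (R : realType) (d n D w bin : nat) (F : FNN R D d) (B : R) :
  (0 < n)%N -> 1 <= B -> fnn_bdd B F -> let T := gather_tf n w bin F in
  [/\ tf_bdd_EB 1 T, tf_bdd_FF B T & tf_bdd_SA 1 T].
Proof.
move=> n0 B1 FB T; split.
- split=> i j; rewrite mxE; first by case: eqP; rewrite ?normr1 ?normr0.
  by do 3?case: ifP => _; rewrite ?normr0 ?normr1//; case: eqP; rewrite ?normr1 ?normr0.
- split=> //.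
    by apply: (fnn_bdd_weaken B1); apply: lin_fnn_bdd; [exact: mx_bdd_pid|exact: mx_bdd_1].
  move=> f /gather_tf_ffmids ->; apply: (fnn_bdd_weaken B1).
  by apply: lin_fnn_bdd; exact: mx_bdd_pid.
- by move=> A; rewrite gather_tf_sas// => /List.in_map_iff[l [<- _]]; exact: gather_sas_bdd.
Qed.

Definition gather_nnz_FF (R : realType) (d n D w : nat) : nat :=
  (fnn_nnz (lin_fnn 2 (pid_mx (d + n + 1) : 'M[R]_(D, d + n + 1)) (1%:M : 'M[R]_D))
   + n.-1 * fnn_nnz (lin_fnn 1 (pid_mx D : 'M[R]_(w, D)) (pid_mx D : 'M[R]_(D, w))))%N.

Lemma gather_tf_nnz_FF (R : realType) (d n D w bin : nat) (F : FNN R D d) :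
  tf_nnz_FF (gather_tf n w bin F) = (gather_nnz_FF R d n D w + fnn_nnz F)%N.
Proof.
rewrite /tf_nnz_FF /gather_nnz_FF; congr (_ + _ + _)%N.
by rewrite /tf_ffmids /= -map_comp big_map /= big_const_seq count_predT size_iota iter_addn_0 mulnC.
Qed.

(** * Recovering the whole input from the mixtures *)

Lemma gather_slot_subproof (d n D : nat) (hD : (d + n + 1 + d * n <= D)%N) (l : 'I_n) (i : 'I_d) :
  (d + n + 1 + (l * d + i) < D)%N.
Proof.
have : (l.+1 * d <= d * n)%N by rewrite mulnC leq_mul2l ltn_ord orbT.
by have := ltn_ord i; rewrite mulSn; lia.
Qed.

Lemma pos_slot_subproof (d n D : nat) (hD : (d + n + 1 + d * n <= D)%N) (l : 'I_n) :
  (d + l < D)%N.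
Proof. by have := ltn_ord l; lia. Qed.

(** With J the all-ones matrix, the attention layers mix the columns by (J + (e - 1) I) / (e + n -
    1), whose inverse is ((e + n - 1) I - J) / (e - 1); the [inr] case lists its entries. The [inl]
    case reads the position off the one-hot rows. *)
Definition decode (R : realType) (d n D : nat) (hD : (d + n + 1 + d * n <= D)%N)
    (u : unit + 'I_d * 'I_n) (r : 'I_D) : R :=
  match u with
  | inl _ => \sum_(l < n) ((l : nat)%:R * (r == Ordinal (pos_slot_subproof hD l))%:R)
  | inr (i, j) => \sum_(l < n)
      ((((expR 1 + n%:R - 1) * (l == j)%:R - 1) / (expR 1 - 1))
        * (r == Ordinal (gather_slot_subproof hD l i))%:R)
  end.

Lemma gathered_eq (R : realType) (d n : nat) (X : 'M[R]_(d, n)) (l : 'I_n) (i : 'I_d) :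
  gathered X l i = (\sum_j X i j + (expR 1 - 1) * X i l) / (expR 1 + n%:R - 1).
Proof.
have den : \sum_(k < n) expR ((k : nat) == l)%N%:R = expR 1 + n%:R - 1 :> R.
  rewrite (bigD1 l)//= eqxx (eq_bigr (fun=> 1)); last first.
    by move=> k kl; rewrite -[_ == _]/(k == l) (negPf kl) expR0.
  have -> : n%:R = \sum_(k < n) (1 : R) by rewrite sumr_const card_ord.
  by rewrite [in RHS](bigD1 l)//=; ring.
rewrite /gathered den.
under eq_bigr => j _ do rewrite mulrA.
rewrite -mulr_suml; congr (_ / _).
have eE j : entry X i j = X i j.
  by rewrite /entry; case: insubP => [a _ ai|]; [congr (X _ _); exact: val_inj|rewrite ltn_ord].
rewrite (bigD1 l)//= eqxx eE [in RHS](bigD1 l)//= (eq_bigr (fun j => X i j)); first ring.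
by move=> k kl; rewrite -[_ == _]/(k == l) (negPf kl) expR0 mulr1 eE.
Qed.

Lemma decode_state (R : realType) (d n D : nat) (hD : (d + n + 1 + d * n <= D)%N)
    (X : 'M[R]_(d, n)) (q : 'I_n) (u : unit + 'I_d * 'I_n) :
  \sum_r decode R hD u r * gather_state D n X r q =
  match u with inl _ => (q : nat)%:R | inr (i, j) => X i j end.
Proof.
have e1 : 1 < expR 1 :> R by rewrite expR_gt1.
have e0 : expR 1 - 1 != 0 :> R by rewrite subr_eq0 gt_eqF.
case: u => [t|[i j]]; rewrite /decode.
  under eq_bigr do rewrite mulr_suml.
  rewrite exchange_big /=; under eq_bigr do rewrite sum_pick.
  rewrite (bigD1 q)//= big1 ?addr0.
    by rewrite mxE /= ltnNge leq_addr /= ltn_add2l ltn_ord addKn eqxx mulr1.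
  move=> l lq; rewrite mxE /= ltnNge leq_addr /= ltn_add2l ltn_ord addKn.
  by rewrite -[_ == _]/(l == q) (negPf lq) mulr0.
under eq_bigr do rewrite mulr_suml.
rewrite exchange_big /=; under eq_bigr do rewrite sum_pick.
have n0 : 1 <= n%:R :> R by rewrite ler1n (leq_ltn_trans (leq0n j)).
have G (l : 'I_n) : gather_state D n X (Ordinal (gather_slot_subproof hD l i)) q =
    (\sum_j X i j + (expR 1 - 1) * X i l) / (expR 1 + n%:R - 1).
  rewrite -gathered_eq mxE /=; do 3 (rewrite ifF; last by lia).
  rewrite addKn; have := ltn_ord i; have := ltn_ord l => ln id.
  rewrite ifT; last first.
    have : (l.+1 * d <= n * d)%N by rewrite leq_mul2r ln orbT.
    by rewrite mulSn; lia.
  by rewrite divnMDl ?divn_small// ?addn0 ?modnMDl ?modn_small//; lia.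
under eq_bigr do rewrite G.
set S := \sum_j X i j.
have nz : expR 1 + n%:R - 1 != 0 :> R by rewrite gt_eqF//; lra.
rewrite (eq_bigr (fun l : 'I_n => ((l == j)%:R * (S + (expR 1 - 1) * X i l)) / (expR 1 - 1)
    - (S / ((expR 1 - 1) * (expR 1 + n%:R - 1)) + X i l / (expR 1 + n%:R - 1)))); last first.
  by move=> l _; field; rewrite e0 nz.
rewrite sumrB big_split /= -!mulr_suml -/S sumr_const card_ord.
rewrite (bigD1 j)//= eqxx mul1r big1 ?addr0; last by move=> l /negPf ->; rewrite mul0r.
by rewrite -[S *+ n]mulr_natl; field; rewrite e0 nz.
Qed.

(** * The last feedforward block *)

Lemma mem_words (s m : nat) (w : seq nat) : w \in words s m -> size w = m /\ all (fun i => (i <= s)%N) w.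
Proof.
elim: m w => [|m IH] w; first by rewrite inE => /eqP ->.
move=> /allpairsPdep[i [w' [iI w'I ->]]]; have [<- al] := IH _ w'I; split=> //.
by change ((i <= s)%N && all (fun i => (i <= s)%N) w'); rewrite al andbT; move: iI; rewrite mem_iota.
Qed.

(** [rev] repeats the order in which the Taylor expansion processes the coordinates. *)
Definition word_expo (d n s : nat) (w : nat) (k : 'I_d * 'I_n) : nat :=
  nth 0%N (nth [::] (words s (d * n)) w) (index k (rev (enum {: 'I_d * 'I_n}))).

Lemma size_coords (d n : nat) : size (rev (enum {: 'I_d * 'I_n})) = (d * n)%N.
Proof. by rewrite size_rev -cardE card_prod !card_ord. Qed.

Lemma word_expo_le (d n s w : nat) (k : 'I_d * 'I_n) : (word_expo s w k <= s)%N.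
Proof.
rewrite /word_expo; case: (ltnP w (size (words s (d * n)))) => ws; last first.
  by rewrite (nth_default [::] ws) nth_nil.
have [sz /allP al] := mem_words (mem_nth [::] ws).
by apply: al; apply: mem_nth; rewrite sz -size_coords index_mem mem_rev mem_enum.
Qed.

Lemma monomial_word_expo (R : realType) (d n s w : nat) (X : 'M[R]_(d, n)) :
  (w < size (words s (d * n)))%N ->
  monomial (rev (enum {: 'I_d * 'I_n})) (nth [::] (words s (d * n)) w) X =
  \prod_(k : 'I_d * 'I_n) X k.1 k.2 ^+ word_expo s w k.
Proof.
move=> ws; have [sz _] := mem_words (mem_nth [::] ws).
rewrite /monomial /word_expo; set v := nth _ _ w in sz *; set ks := rev _.
have szk : size ks = size v by rewrite sz size_coords.
transitivity (\prod_(k <- ks) X k.1 k.2 ^+ nth 0%N v (index k ks)); last first.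
  by rewrite -big_enum; apply: perm_big; rewrite perm_rev.
have uk : uniq ks by rewrite rev_uniq enum_uniq.
elim: ks v uk szk {ws sz} => [|k ks IH] [|i v] //=; first by rewrite !big_nil.
move=> /andP[kks uks] [szk]; rewrite !big_cons /= eqxx IH//; congr (_ * _).
rewrite big_seq [RHS]big_seq; apply: eq_bigr => k' k'ks.
by case: eqP k'ks kks => // -> ->.
Qed.

(** The read-in and read-out layers around the hidden stack account for the two extra layers of
    depth. *)
Lemma fnn_of_hnet (R : realType) (D d W Z len : nat) (I J : finType) (B : R)
    (S : (I -> R) -> (J -> R) -> Prop) (A1 : I -> 'I_D -> R) (A2 : 'I_d -> J -> R) :
  hnet W B Z len S -> (#|I| <= W)%N -> (#|J| <= W)%N -> 0 <= B ->
  (forall i r, `|A1 i r| <= B) -> (forall p j, `|A2 p j| <= B) ->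
  exists F : FNN R D d,
    [/\ fnn_depth F = len.+2, fnn_width F = W, fnn_bdd B F,
        (fnn_nnz F <= #|I|.+1 * D.+2 + Z + d.+1 * #|J|.+2)%N &
        forall z : 'cV[R]_D, exists2 v : J -> R,
          S (fun i => relu (\sum_r A1 i r * z r 0)) v &
          forall p, fnn_eval F z p 0 = \sum_j A2 p j * v j].
Proof.
move=> [hs [szh zh bh Hh]] IW JW B0 A1B A2B.
have zI : enc D (fun r : 'I_D => 0 : R) = 0.
  by apply/matrixP => i j; rewrite !mxE; case: slot.
exists (mkFNN (pad_mx W D A1) (enc W (fun _ : I => 0)) hs (pad_mx d W A2) (enc d (fun _ : 'I_d => 0))).
split=> //.
- by rewrite /fnn_depth /= szh.
- by split=> //=; try exact: mx_bdd_pad; apply: mx_bdd_enc => // i; rewrite normr0.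
- rewrite /fnn_nnz /=.
  have h1 := @nnz_pad R W D 'I_D I A1; rewrite card_ord in h1.
  have h2 := @nnz_enc R W I (fun _ : I => 0).
  have h3 := @nnz_pad R d W J 'I_d A2; rewrite card_ord in h3.
  have h4 := @nnz_enc R d 'I_d (fun _ : 'I_d => 0); rewrite card_ord in h4.
  apply: leq_trans (leq_add (leq_add (leq_add (leq_add h1 h2) zh) h3) h4) _.
  move: (#|I|) (#|J|) => i j; rewrite !mulnS !mulSn; lia.
- move=> z; rewrite /fnn_eval /=.
  have E : relu_mx (pad_mx W D A1 *m z + enc W (fun _ : I => 0)) =
      enc W (fun i => relu (\sum_r A1 i r * z r 0)).
    rewrite -[z in LHS]enc_ord relu_pad_mx_enc ?card_ord//; congr enc; apply/funext => i.
    by rewrite /lay addr0.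
  have [v rv Sv] := Hh (fun i => relu (\sum_r A1 i r * z r 0)).
  exists v => // p; rewrite E -/(run hs _) rv pad_mx_enc// !mxE.
  rewrite /slot; case: insubP => [p' _ pp'|/negP[]]; last by rewrite [X in (_ < X)%N]card_ord.
  rewrite /= addr0; apply: eq_bigr => j _; congr (A2 _ _ * _).
  by rewrite enum_val_ord; apply: val_inj.
Qed.

Definition approx_cost (d n s D N L : nat) : nat :=
  let e := (size (words s (d * n)) * d.+1)%N in
  ((d * n).+2 * D.+2 + poly_cost (d * n) e s N (N ^ (d * n) * n) L + d.+1 * (d * n + e).+3)%N.

Definition approx_width (d n s N : nat) : nat :=
  let e := (size (words s (d * n)) * d.+1)%N in
  (front_cost (d * n) e N (N ^ (d * n) * n) + 9 * ((d * n).+1 + e))%N.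

(** On shrunken cells the error splits into the Taylor error [eta] and the multiplication error,
    where each monomial contributes 2 C0 + C0 times the error of a register. The bound on the whole
    cube rests only on the registers being in [0,1]. *)
Lemma approx_fnn (R : realType) (d n s D N L : nat) (dl B C0 eta : R)
    (hD : (d + n + 1 + d * n <= D)%N) (f : 'M[R]_(d, n) -> 'M[R]_(d, n)) :
  (0 < N)%N -> (0 < n)%N -> 0 < dl -> 1 <= C0 ->
  1 + dl^-1 <= B -> (N ^ (d * n) * n)%:R <= B -> 4 <= B -> 2 * C0 <= B ->
  (forall u r, `|decode R hD u r| <= B) ->
  (forall p q (j : {ffun 'I_d * 'I_n -> 'I_N}),
     exists2 c : seq nat -> R, forall w, `|c w| <= C0 &
       forall x, in_box (fun k => (j k)%:R / N%:R) (fun k => (j k).+1%:R / N%:R) x ->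
       `|f x p q - \sum_(w <- words s (d * n)) c w * monomial (rev (enum {: 'I_d * 'I_n})) w x|
        <= eta) ->
  exists F : FNN R D d,
    [/\ fnn_depth F = (6 + d * n * s * (L + 4)).+2, fnn_width F = approx_width d n s N,
        fnn_bdd B F, (fnn_nnz F <= approx_cost d n s D N L)%N &
        forall X, in_cube X -> forall p q,
          let y := fnn_eval F (col q (gather_state D n X)) p 0 in
          `|y| <= 3 * C0 * (size (words s (d * n)))%:R /\
          forall j : {ffun 'I_d * 'I_n -> 'I_N},
            in_box (fun k => (j k)%:R / N%:R) (fun k => (j k).+1%:R / N%:R - dl) X ->
            `|y - f X p q| <= eta +
              3 * C0 * (size (words s (d * n)))%:R * (2 ^+ (d * n * s) * 4 ^- L)].
Proof.
move=> N0 n0 d0 C1 dB MB B4 CB decB Hloc.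
set ws := words s (d * n) in Hloc *.
pose K : finType := ('I_d * 'I_n)%type.
(* For each monomial, one register for the bare monomial ([inl]) and one per output row for its
   product with a coefficient ([inr]). *)
pose E : finType := ('I_(size ws) * (unit + 'I_d))%type.
have cK : #|{: K}| = (d * n)%N by rewrite card_prod !card_ord.
have cE : #|{: E}| = (size ws * d.+1)%N by rewrite card_prod card_ord card_sum card_unit card_ord.
have C0p : 0 < C0 by lra.
have /choice[c Hc] : forall pqj : 'I_d * 'I_n * {ffun K -> 'I_N}, exists c : seq nat -> R,
    (forall w, `|c w| <= C0) /\
    forall x, in_box (fun k => (pqj.2 k)%:R / N%:R) (fun k => (pqj.2 k).+1%:R / N%:R) x ->
       `|f x pqj.1.1 pqj.1.2 - \sum_(w <- ws) c w * monomial (rev (enum {: 'I_d * 'I_n})) w x| <= eta.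
  by move=> [[p q] j]; have [c c1 c2] := Hloc p q j; exists c.
(* Coefficients in [-C0, C0] are mapped affinely to [0,1]; [A2] undoes this by subtracting C0 times
   the bare monomial. *)
pose val (jq : {ffun K -> 'I_N} * 'I_n) (e : E) : R := match e.2 with
  | inl _ => 1 | inr p => (c (p, jq.2, jq.1) (nth [::] ws e.1) + C0) / (2 * C0) end.
have val01 jq e : 0 <= val jq e <= 1.
  rewrite /val; case: e.2 => [_|p]; first by rewrite ler01 lexx.
  have := (Hc (p, jq.2, jq.1)).1 (nth [::] ws e.1); rewrite ler_norml => /andP[h1 h2].
  rewrite ler_pdivlMr ?ler_pdivrMr; lra.
have [tau tau01 tauE] := @code_table K (E -> R) N n (fun g => forall e, 0 <= g e <= 1)
  val (fun=> 1) (fun _ => introT andP (conj ler01 (lexx 1))) val01.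
pose A2 (p : 'I_d) (r : (unit + K) + E) : R := match r with
  | inr (_, inr p') => 2 * C0 * (p' == p)%:R
  | inr (_, inl _) => - C0
  | inl _ => 0 end.
pose expo (e : E) (k : K) : nat := word_expo s e.1 k.
have W1 : (front_cost #|{: K}| #|{: E}| N (N ^ #|{: K}| * n) <= approx_width d n s N)%N.
  by rewrite cK cE /approx_width leq_addr.
have W2 : (9 * (#|{: K}|.+1 + #|{: E}|) <= approx_width d n s N)%N.
  by rewrite cK cE /approx_width leq_addl.
have MB' : (N ^ #|{: K}| * n)%:R <= B by rewrite cK.
have H := @hnet_poly R (approx_width d n s N) K E N n s L dl B (fun e U => tau U e) expo N0 n0 d0 dB
    MB' B4 (fun e U => tau01 U e) (fun e k => word_expo_le _ _ _) W1 W2.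
have cI : #|{: unit + K}| = (d * n).+1 by rewrite card_sum card_unit cK.
have cJ : #|{: (unit + K) + E}| = ((d * n).+1 + size ws * d.+1)%N.
  by rewrite card_sum cI cE.
have A2B p r : `|A2 p r| <= B.
  rewrite /A2; case: r => [_|[w [_|p']]]; rewrite ?normr0 ?normrN; try lra.
    by rewrite ger0_norm; lra.
  by case: eqP => _; rewrite ?mulr1 ?mulr0 ?normr0 ?ger0_norm; lra.
have IW : (#|{: unit + K}| <= approx_width d n s N)%N.
  by apply: leq_trans W2; rewrite cI cK; move: #|{: E}|; clear; lia.
have JW : (#|{: (unit + K) + E}| <= approx_width d n s N)%N.
  by apply: leq_trans W2; rewrite cJ cK cE; move: (size ws * _)%N; clear; lia.
have B0 : 0 <= B by lra.
have [F [F1 F2 F3 F4 F5]] := fnn_of_hnet H IW JW B0 decB A2B.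
exists F; split => //.
- by rewrite F1 cK.
- by rewrite /approx_cost -cE -cK -/ws; move: F4; rewrite cI cJ cE cK.
move=> X Xc p q /=.
have [v [v01 Hv] yE] := F5 (col q (gather_state D n X)).
have decE u : \sum_r decode R hD u r * (col q (gather_state D n X)) r 0 =
     match u with inl _ => (q : nat)%:R | inr (i, j) => X i j end.
  by rewrite -(decode_state hD X q u); apply: eq_bigr => r _; rewrite mxE.
have {}yE : fnn_eval F (col q (gather_state D n X)) p 0 =
   \sum_(w < size ws) (2 * C0 * v (inr (w, inr p)) - C0 * v (inr (w, inl tt))).
  rewrite yE big_sumType /= [X in X + _]big1 ?add0r; last by move=> i _; rewrite mul0r.
  transitivity (\sum_(w < size ws) \sum_(o : unit + 'I_d) A2 p (inr (w, o)) * v (inr (w, o))).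
    by rewrite pair_bigA; apply: eq_bigr => [[? ?]].
  apply: eq_bigr => w _; rewrite big_sumType /= sum_unit.
  by rewrite (sum_pick (fun p' => v (inr (w, inr p')))) addrC mulNr.
split.
  rewrite yE; apply: le_trans (ler_norm_sum _ _ _) _.
  have -> : 3 * C0 * (size ws)%:R = \sum_(w < size ws) (3 * C0).
    by rewrite sumr_const card_ord mulr_natr.
  apply: ler_sum => w _.
  have := v01 (inr (w, inr p)); have := v01 (inr (w, inl tt)) => /andP[a0 a1] /andP[b0 b1].
  by rewrite ler_norml; apply/andP; split; nra.
move=> j jX.
have xk k : relu (\sum_r decode R hD (inr k) r * (col q (gather_state D n X)) r 0) = X k.1 k.2.
  by rewrite decE; case: k => a b; rewrite relu_id//; have /andP[] := Xc a b.
have cell : in_cell N dl (fun k => j k)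
   (fun k => relu (\sum_r decode R hD (inr k) r * (col q (gather_state D n X)) r 0)).
  move=> k; rewrite xk; split; first exact: Xc.
  by have /andP[/ltW -> /ltW ->] := jX k.
have uq : relu (\sum_r decode R hD (inl tt) r * (col q (gather_state D n X)) r 0) = (q : nat)%:R.
  by rewrite decE relu_id.
have {}Hv := Hv j q uq cell.
have xbox : in_box (fun k => (j k)%:R / N%:R) (fun k => (j k).+1%:R / N%:R) X.
  by move=> k; have := jX k => /andP[h1 h2]; rewrite h1 /=; lra.
have [cb /(_ X xbox) fE] := Hc (p, q, j).
pose mu (w : 'I_(size ws)) := \prod_(k : K) X k.1 k.2 ^+ expo (w, inl tt) k.
pose del : R := 2 ^+ (d * n * s) * 4 ^- L.
have hv w o : `|v (inr (w, o)) - val (j, q) (w, o) * mu w| <= del.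
  have := Hv (w, o); rewrite tauE cK; apply: le_trans; rewrite le_eqVlt; apply/orP; left.
  apply/eqP; congr (`|_ - _ * _|); apply: eq_bigr => k _.
  by rewrite xk.
have sumE : \sum_(w <- ws) c (p, q, j) w * monomial (rev (enum {: 'I_d * 'I_n})) w X =
   \sum_(w < size ws) c (p, q, j) (nth [::] ws w) * mu w.
  rewrite (big_nth [::]) big_mkord; apply: eq_bigr => w _; congr (_ * _).
  exact: monomial_word_expo.
have -> : fnn_eval F (col q (gather_state D n X)) p 0 - f X p q =
  (fnn_eval F (col q (gather_state D n X)) p 0 -
    \sum_(w < size ws) c (p, q, j) (nth [::] ws w) * mu w) -
  (f X p q - \sum_(w <- ws) c (p, q, j) w * monomial (rev (enum {: 'I_d * 'I_n})) w X).
  by rewrite sumE; ring.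
apply: le_trans (ler_normB _ _) _; rewrite addrC; apply: lerD => //.
rewrite yE -sumrB; apply: le_trans (ler_norm_sum _ _ _) _.
have -> : 3 * C0 * (size ws)%:R * (2 ^+ (d * n * s) * 4 ^- L) = \sum_(w < size ws) (3 * C0 * del).
  by rewrite sumr_const card_ord -mulr_natr /del; ring.
apply: ler_sum => w _.
have h1 := hv w (inr p); have h2 := hv w (inl tt).
rewrite /val /= in h1 h2.
set cw := c (p, q, j) (nth [::] ws w) in h1 *.
have -> : 2 * C0 * v (inr (w, inr p)) - C0 * v (inr (w, inl tt)) - cw * mu w =
   2 * C0 * (v (inr (w, inr p)) - (cw + C0) / (2 * C0) * mu w)
   - C0 * (v (inr (w, inl tt)) - 1 * mu w).
  by field; rewrite gt_eqF.
apply: le_trans (ler_normB _ _) _; rewrite !normrM !(ger0_norm (ltW C0p)) ger0_norm//.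
by nra.
Qed.

(** * Choice of the parameters *)

Lemma powR_invl (R : realType) (x a : R) : 0 <= x -> x^-1 `^ a = (x `^ a)^-1.
Proof. by move=> x0; rewrite -powR_inv1// -powRrM mulN1r powRN. Qed.

Lemma powR_ge1 (R : realType) (y a : R) : 1 <= y -> 0 <= a -> 1 <= y `^ a.
Proof. by move=> y1 a0; rewrite -(powRr0 y); exact: ler_powR. Qed.

(** [N] makes the Taylor error N^-gam of order eps, [dl] makes the total slab measure of order
    eps^t, and [L] makes the multiplication error 4^-L of order eps. *)
Lemma choose_params (R : realType) (m : nat) (gam t A1 A2 A3 : R) :
  (0 < m)%N -> 0 < gam -> 1 <= t -> 1 <= A1 -> 1 <= A2 -> 1 <= A3 ->
  exists2 c : R, 1 <= c & forall eps : R, 0 < eps < 1 ->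
    let Q := eps^-1 `^ (m%:R / gam) in
    let Bt := eps^-1 `^ (((7 * m)%:R + gam + 2) * t / gam) in
    [/\ 1 <= eps^-1 `^ (1 / gam), 1 <= Q, Q <= Bt & 0 <= ln eps^-1] /\
    exists (N L : nat) (dl : R),
     [/\ (0 < N)%N, 0 < dl, A1 * N%:R^-1 `^ gam <= eps / 4,
         A2 * (m%:R * (N.+1%:R * dl)) <= eps `^ t / 2 & A3 * 4 ^- L <= eps / 4] /\
     [/\ (N ^ m)%:R <= c * Q, dl^-1 <= c * Bt, L%:R <= c * (1 + ln eps^-1) & L%:R <= c * Q].
Proof.
move=> m0 g0 t1 A11 A21 A31.
have m0' : 1 <= m%:R :> R by rewrite ler1n.
(* The summand 1 pays for rounding [N] up, since eps^(-1/gam) >= 1. *)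
pose c2 : R := (4 * A1) `^ (1 / gam) + 1.
have c21 : 1 <= c2 by rewrite lerDr powR_ge0.
have l4 : 0 < ln 4 :> R by rewrite ln_gt0// ltr1n.
have lA : 0 < ln (4 * A3) by rewrite ln_gt0//; lra.
pose cL : R := (ln (4 * A3) + 1) / ln 4 + 1.
have cL1 : 1 <= cL by rewrite lerDr divr_ge0 ?ltW// addr_gt0.
pose cQ : R := cL * (1 + gam / m%:R).
have gm : 0 <= gam / m%:R by rewrite divr_ge0 ?ltW// (lt_le_trans _ m0').
have cQ1 : 1 <= cQ by rewrite /cQ; nra.
have c2m : 1 <= c2 ^+ m by exact: exprn_ege1.
pose c3 : R := 4 * A2 * m%:R * c2.
have c31 : 1 <= c3.
  have h1 : 1 <= A2 * m%:R by nra.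
  by rewrite /c3 -[4 * A2 * _]mulrA; nra.
exists (c2 ^+ m + c3 + cL + cQ); first lra.
move=> eps /andP[e0 e1] Q Bt; set y := eps^-1.
have y1 : 1 < y by rewrite /y invf_gt1.
have y0 : 0 < y by lra.
have yn0 : y != 0 by rewrite gt_eqF.
have epsE : eps = y^-1 by rewrite /y invrK.
set P := y `^ (1 / gam).
have P1 : 1 <= P by apply: powR_ge1; [lra|rewrite divr_ge0// ltW].
have Q1 : 1 <= Q by apply: powR_ge1; [exact: ltW|rewrite divr_ge0// ltW].
have Bt1 (a : R) : a * gam <= ((7 * m)%:R + gam + 2) * t -> y `^ a <= Bt.
  by move=> h; apply: ler_powR; [exact: ltW|rewrite ler_pdivlMr].
have m7 : (7 * m)%:R = 7 * m%:R :> R by rewrite natrM.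
have QB : Q <= Bt.
  by apply: Bt1; rewrite divfK ?gt_eqF// m7; nra.
have ly0 : 0 < ln y by exact: ln_gt0.
split; first by split=> //; exact: ltW.
have PmQ : P ^+ m = Q.
  by rewrite -powR_mulrn ?(le_trans _ P1)// /P -powRrM; congr (_ `^ _); field; rewrite gt_eqF.
pose x1 := (4 * A1) `^ (1 / gam) * P.
have x10 : 0 <= x1 by rewrite mulr_ge0 ?powR_ge0.
pose N := (Num.truncn x1).+1.
have Nx : x1 < N%:R by exact: truncnS_gt.
have NP : N%:R <= c2 * P.
  have h : (Num.truncn x1)%:R <= x1 by rewrite truncn_le.
  have NE : N%:R = (Num.truncn x1)%:R + 1 :> R by rewrite natr1.
  have cE : c2 * P = x1 + P by rewrite /c2 /x1 mulrDl [1 * P]mul1r.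
  by rewrite NE cE; lra.
have N1 : 1 <= N%:R :> R by rewrite ler1n.
have N0 : (0 < N)%N by [].
clearbody N.
(* Chosen so that the condition on the slab measure holds with equality. *)
pose dl : R := eps `^ t / (2 * A2 * m%:R * N.+1%:R).
have den0 : 0 < 2 * A2 * m%:R * N.+1%:R by rewrite !mulr_gt0//; lra.
have et0 : 0 < eps `^ t by exact: powR_gt0.
pose x2 := ln (4 * A3 * y) / ln 4.
have lA3y : ln (4 * A3 * y) = ln (4 * A3) + ln y by rewrite lnM ?posrE//; lra.
have x20 : 0 <= x2 by rewrite divr_ge0 ?ltW// lA3y addr_gt0.
pose L := (Num.truncn x2).+1.
have Lx : x2 < L%:R by exact: truncnS_gt.
have Lle : L%:R <= x2 + 1.
  have h : (Num.truncn x2)%:R <= x2 by rewrite truncn_le.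
  have LE : L%:R = (Num.truncn x2)%:R + 1 :> R by rewrite natr1.
  by rewrite LE; lra.
clearbody L.
have LcL : L%:R <= cL * (1 + ln y).
  apply: le_trans Lle _; rewrite /x2 lA3y /cL.
  have i4 : 0 < (ln 4 : R)^-1 by rewrite invr_gt0.
  have h1 : 0 < ln (4 * A3) / ln 4 by rewrite mulr_gt0.
  have h2 := mulr_gt0 h1 ly0.
  move: (ln 4)^-1 (ln (4 * A3)) (ln y) i4 h1 h2 ly0 {lA lA3y} => i a l i4 h1 h2 ly0.
  have -> : ((a + 1) * i + 1) * (1 + l) = (a + l) * i + 1 + (i + l + a * i * l) by ring.
  lra.
(* The depth also enters the weight count, so ln(1/eps) must be bounded by a multiple of [Q]; ln Q <
   Q suffices, as ln Q = (m / gam) ln(1/eps). *)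
have lyQ : 1 + ln y <= (1 + gam / m%:R) * Q.
  have : ln Q < Q by apply: ln_sublinear; lra.
  rewrite /Q ln_powR -/y -/Q => h.
  have h2 : ln y <= gam / m%:R * Q.
    rewrite mulrAC ler_pdivlMr ?(lt_le_trans _ m0')// mulrC -ler_pdivrMl//.
    by rewrite mulrA [gam^-1 * _]mulrC ltW.
  by rewrite mulrDl mul1r; apply: lerD.
have Bt0 : 1 <= Bt by exact: le_trans Q1 QB.
have Q0 : 0 <= Q by lra.
have LcQ : L%:R <= cQ * Q.
  apply: le_trans LcL _; rewrite /cQ -mulrA ler_wpM2l//; lra.
exists N, L, dl; split; split => //.
- by rewrite divr_gt0.
- rewrite powR_invl; last lra.
  have h : 4 * A1 * y <= N%:R `^ gam.
    have -> : 4 * A1 * y = x1 `^ gam.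
      rewrite /x1 /P -powRM; [|lra|lra].
      by rewrite -powRrM mul1r mulVf ?gt_eqF// powRr1// mulr_ge0; lra.
    by apply: ge0_ler_powR; rewrite ?nnegrE; lra.
  have h0 : 0 < 4 * A1 * y by rewrite !mulr_gt0//; lra.
  rewrite ler_pdivrMr; last exact: lt_le_trans h.
  have -> : A1 = eps / 4 * (4 * A1 * y).
    by rewrite epsE; field.
  by rewrite ler_wpM2l// divr_ge0// ltW.
- rewrite /dl le_eqVlt; apply/orP; left; apply/eqP; field.
  by rewrite !gt_eqF//; lra.
- have h0 : 0 < 4 * A3 * y by rewrite !mulr_gt0//; lra.
  have h : 4 * A3 * y <= 4 ^+ L.
    rewrite -[X in X <= _]lnK ?posrE// -[X in _ <= X ^+ _]lnK ?posrE//.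
    by rewrite -expRM_natl ler_expR -ler_pdivrMr// ltW.
  rewrite ler_pdivrMr; last exact: lt_le_trans h.
  have -> : A3 = eps / 4 * (4 * A3 * y).
    by rewrite epsE; field.
  by rewrite ler_wpM2l// divr_ge0// ltW.
- apply: (@le_trans _ _ (c2 ^+ m * Q)).
    by rewrite natrX -PmQ -exprMn lerXn2r ?nnegrE//; nra.
  by rewrite ler_wpM2r//; lra.
- have -> : dl^-1 = 2 * A2 * m%:R * N.+1%:R * y `^ t.
    by rewrite /dl invf_div epsE powR_invl ?invrK// ltW.
  apply: (@le_trans _ _ (c3 * Bt)); last by rewrite ler_wpM2r//; lra.
  have h1 : P * y `^ t <= Bt.
    rewrite /P -powRD; last by rewrite yn0 implybT.
    apply: Bt1; rewrite mulrDl mul1r mulVf ?gt_eqF// m7; nra.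
  have h2 : N.+1%:R <= 2 * (c2 * P) by have : N.+1%:R = N%:R + 1 :> R; [rewrite natr1|move=> ->; lra].
  have yt0 : 0 <= y `^ t by exact: powR_ge0.
  have h3 : N.+1%:R * y `^ t <= 2 * c2 * Bt.
    apply: (@le_trans _ _ (2 * (c2 * P) * y `^ t)); first by rewrite ler_wpM2r.
    by rewrite -!mulrA ler_wpM2l// ler_wpM2l//; lra.
  rewrite -mulrA.
  have k0 : 0 <= 2 * A2 * m%:R by rewrite !mulr_ge0//; lra.
  apply: le_trans (ler_wpM2l k0 h3) _.
  by rewrite /c3 le_eqVlt; apply/orP; left; apply/eqP; ring.
- apply: le_trans LcL _; rewrite ler_wpM2r//; lra.
- apply: le_trans LcQ _; rewrite ler_wpM2r//; lra.
Qed.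

(** The N + 1 slabs end at the grid points 0, 1/N, ..., 1 and contain them, so a point outside all
    slabs lies strictly inside a shrunken cell; the last slab excludes x = 1. *)
Lemma cell_of (R : realType) (N : nat) (dl x : R) :
  (0 < N)%N -> 0 < dl -> 0 <= x <= 1 ->
  (forall i : 'I_N.+1, ~ (i%:R / N%:R - dl <= x <= i%:R / N%:R)) ->
  exists j : 'I_N, j%:R / N%:R < x < j.+1%:R / N%:R - dl.
Proof.
move=> N0 d0 /andP[x0 x1] bad.
have N0' : 0 < N%:R :> R by rewrite ltr0n.
have Nn : N%:R != 0 :> R by rewrite gt_eqF.
have xN0 : 0 <= x * N%:R by rewrite mulr_ge0// ltW.
have /andP[h1 h2] := truncn_itv xN0.
set j := Num.truncn _ in h1 h2.
have j1 : j%:R / N%:R <= x by rewrite ler_pdivrMr.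
have j2 : x < j.+1%:R / N%:R by rewrite ltr_pdivlMr.
have xl1 : x < 1.
  rewrite lt_neqAle x1 andbT; apply/eqP => xe.
  by apply: (bad ord_max); rewrite /= divff// xe lexx andbT lerBlDr lerDl ltW.
have jN : (j < N)%N.
  by rewrite -(ltr_nat R); apply: le_lt_trans h1 _; rewrite gtr_pMl.
exists (Ordinal jN) => /=; apply/andP; split.
  rewrite lt_neqAle j1 andbT; apply/eqP => xe.
  apply: (bad (Ordinal (ltnW jN : (j < N.+1)%N))) => /=.
  by rewrite -xe lexx andbT lerBlDr lerDl ltW.
rewrite ltNge; apply/negP => h3.
apply: (bad (Ordinal (jN : (j.+1 < N.+1)%N))) => /=.
by rewrite h3 ltW.
Qed.

(** As d n >= 1, one has N <= N^(d n): the table dominates the ramps. *)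
Lemma approx_width_le (d n s : nat) : (0 < d * n)%N ->
  exists k : nat, forall N, (0 < N)%N -> (approx_width d n s N <= k * N ^ (d * n))%N.
Proof.
move=> m0; pose m := (d * n)%N; pose e := (size (words s m) * d.+1)%N.
exists (100 * (m + e + 3) ^ 2 * (1 + n) + 9 * (m.+1 + e))%N => N N0.
rewrite /approx_width /front_cost -/m -/e.
set a := (100 * _)%N; set b := (9 * _)%N.
have NN : (N <= N ^ m)%N by rewrite -{1}(expn1 N) leq_pexp2l.
have N1 : (0 < N ^ m)%N by rewrite expn_gt0 N0.
rewrite mulnDl; apply: leq_add; last by rewrite leq_pmulr.
by rewrite -mulnA leq_mul2l; apply/orP; right; rewrite mulnDl mul1n [(n * _)%N]mulnC leq_add2r.
Qed.

Lemma approx_cost_le (d n s D : nat) : (0 < d * n)%N ->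
  exists k l : nat, forall N L, (0 < N)%N ->
    (approx_cost d n s D N L <= k * N ^ (d * n) + l * (L + 4))%N.
Proof.
move=> m0; pose m := (d * n)%N; pose e := (size (words s m) * d.+1)%N.
exists (m.+2 * D.+2 + 100 * (m + e + 3) ^ 2 * (1 + n) + d.+1 * (m + e).+3)%N.
exists (m * s * round_cost (m.+1 + e))%N => N L N0.
rewrite /approx_cost /poly_cost /front_cost -/m -/e.
set a := (100 * _)%N; set b := (d.+1 * _)%N; set r := round_cost _; set g := (m.+2 * _)%N.
have NN : (N <= N ^ m)%N by rewrite -{1}(expn1 N) leq_pexp2l.
have N1 : (0 < N ^ m)%N by rewrite expn_gt0 N0.
have h1 : (g <= g * N ^ m)%N by rewrite leq_pmulr.
have h2 : (b <= b * N ^ m)%N by rewrite leq_pmulr.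
have h3 : (a * (N + N ^ m * n) <= a * (1 + n) * N ^ m)%N.
  by rewrite -mulnA leq_mul2l; apply/orP; right; rewrite mulnDl mul1n [(n * _)%N]mulnC leq_add2r.
have -> : ((g + a * (1 + n) + b) * N ^ m = g * N ^ m + a * (1 + n) * N ^ m + b * N ^ m)%N.
  by rewrite mulnDl [((g + _) * _)%N]mulnDl.
rewrite -[(m * s * r * _)%N]mulnA; move: h1 h2 h3.
by move: (g * N ^ m)%N (a * _ * N ^ m)%N (b * N ^ m)%N (a * _)%N (m * s * _)%N; clear; lia.
Qed.

Lemma binomial_gt0 (s m : nat) : (0 < 'C(s + m - 1, m - 1))%N.
Proof. by rewrite bin_gt0; lia. Qed.

Theorem theorem1 (R : realType) (d n s : nat) (lam t : R) :
  (0 < d)%N -> (0 < n)%N -> 0 < lam <= 1 -> 1 <= t ->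
  let gam : R := s%:R + lam in
  let bin : nat := 'C(s + d * n - 1, d * n - 1) in
  forall f : 'M[R]_(d, n) -> 'M[R]_(d, n),
  (forall p q, holder s lam (fun X => f X p q)) ->
  exists C : R, forall eps : R, 0 < eps < 1 ->
  exists T : TF R n d (d + n + 1) ((2 * d * n + 5 * d) * bin) d,
    [/\
      (* length n *)
      [/\ tf_length T = n,
      (* (L_0, W_0) *)
           fnn_depth (tf_ff0 T) = 4%N &
           (fnn_width (tf_ff0 T))%:R <= C * eps^-1 `^ (1 / gam)],
      [/\
      (* (H_1, S_1) and (H_l, S_l), l = 2..n *)
      (forall l, (l < n)%N ->
         let A := nth (tf_saK T) (tf_sas T) l in
         (l = 0%N -> sa_headnum A = ((3 * d + 1) * bin)%N /\
                     sa_size A = maxn (d * n) 3) /\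
         ((0 < l)%N -> sa_headnum A = (3 * d * bin)%N /\ sa_size A = 3%N)),
      (* (L_l, W_l), l = 1..n-1 *)
      (forall g, Stdlib.Lists.List.In g (tf_ffmids T) ->
         fnn_depth g = 3%N /\ fnn_width g = (d * bin * (4 * n + 11))%N) &
      (* (L_n, W_n) *)
      (fnn_depth (tf_ffK T))%:R <= C * (1 + ln eps^-1) /\
        (fnn_width (tf_ffK T))%:R <= C * eps^-1 `^ ((d * n)%:R / gam)],
      (* approximation in L^t *)
      (forall p q, (Ltnorm t (fun X => (tf_eval T X p q - f X p q)%R) <= eps%:E)%E),
      (* weight bounds B_EB, B_FF, B_SA *)
      [/\ tf_bdd_EB C T,
          tf_bdd_FF (C * eps^-1 `^ (((7 * d * n)%:R + gam + 2) * t / gam)) T &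
          tf_bdd_SA (C * (1 + ln eps^-1)) T] &
      (* numbers of (nonzero) parameters M_EB, M_FF, M_SA *)
      [/\ (tf_nnz_EB T)%:R <= C,
          (tf_nnz_FF T)%:R <= C * eps^-1 `^ ((d * n)%:R / gam) &
          (tf_nnz_SA T)%:R <= C]].
Proof.
move=> d0 n0 /andP[l0 l1] t1 gam bin f Hf.
have m0 : (0 < d * n)%N by rewrite muln_gt0 d0.
have b0 : (0 < bin)%N by exact: binomial_gt0.
have g0 : 0 < gam by rewrite ltr_wpDl.
have dn : (d <= d * n)%N by rewrite leq_pmulr.
have nd : (n <= d * n)%N by rewrite leq_pmull.
set D := ((2 * d * n + 5 * d) * bin)%N; set w := (d * bin * (4 * n + 11))%N.
have hD : (d + n + 1 + d * n <= D)%N.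
  apply: (@leq_trans (2 * d * n + 5 * d)); last by rewrite leq_pmulr.
  by rewrite -mulnA; lia.
have Dw : (D <= w)%N.
  rewrite /D /w [(d * bin * _)%N]mulnAC leq_mul2r; apply/orP; right.
  rewrite mulnDr [(d * (4 * n))%N]mulnCA -[(2 * d * n)%N]mulnA; lia.
have /choice[Cf HCf] : forall pq : 'I_d * 'I_n, exists C : R, [/\ 0 <= C,
  (forall (h : R) (lo hi : 'I_d * 'I_n -> R), 0 <= h ->
    (forall k, [/\ 0 <= lo k, lo k < hi k, hi k <= 1 & hi k - lo k <= h]) ->
    exists2 c : seq nat -> R, forall w, `|c w| <= C &
      forall x, in_box lo hi x ->
        `|f x pq.1 pq.2 - \sum_(w <- words s (d * n)) c w * monomial (rev (enum {: 'I_d * 'I_n})) w x|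
        <= C * (h ^+ s * h `^ lam)) &
    forall x, in_cube x -> `|f x pq.1 pq.2| <= C].
  move=> [p q]; have [C1 C10 H1] := holder_local_poly (ltW l0) (Hf p q).
  have [C2 C20 H2] := holder_bounded (Hf p q).
  exists (C1 + C2); split; first exact: addr_ge0.
    move=> h lo hi h0 box; have [c c1 c2] := H1 h lo hi h0 box.
    exists c => [w'|x xb]; first by apply: le_trans (c1 w') _; rewrite lerDl.
    apply: le_trans (c2 x xb) _; rewrite ler_wpM2r ?lerDl//.
    by rewrite mulr_ge0 ?exprn_ge0 ?powR_ge0.
  by move=> x xc; apply: le_trans (H2 x xc) _; rewrite lerDr.
pose C0 : R := 1 + \sum_pq Cf pq.
have CfC0 pq : Cf pq <= C0.
  rewrite /C0 (bigD1 pq)//= addrCA lerDl addr_ge0// sumr_ge0// => i _.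
  by have [] := HCf i.
have C01 : 1 <= C0.
  by rewrite lerDl sumr_ge0// => i _; have [] := HCf i.
pose nw : R := (size (words s (d * n)))%:R.
have nw0 : 0 <= nw by exact: ler0n.
(* Bounds the error on the whole cube, slabs included: network output plus [f]. *)
pose Mb : R := 3 * C0 * nw + C0.
have C0nw : 0 <= 3 * C0 * nw by rewrite !mulr_ge0//; lra.
have Mb1 : 1 <= Mb by rewrite /Mb; lra.
pose A2 := Mb `^ t.
have A21 : 1 <= A2 by apply: powR_ge1 => //; lra.
pose A3 : R := 1 + 3 * C0 * nw * 2 ^+ (d * n * s).
have A31 : 1 <= A3 by rewrite lerDl mulr_ge0// exprn_ge0.
have [c c1 Hc] := choose_params m0 g0 t1 C01 A21 A31.
(* The decoding weights do not depend on eps, so a bound for them may enter the constant. *)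
pose Ad : R := \sum_(u : unit + 'I_d * 'I_n) \sum_(r < D) `|decode R hD u r|.
have decA u r : `|decode R hD u r| <= Ad.
  rewrite /Ad (bigD1 u)//= (bigD1 r)//= -addrA lerDl addr_ge0//; first exact: sumr_ge0.
  by apply: sumr_ge0 => i _; exact: sumr_ge0.
have Ad0 : 0 <= Ad by apply: sumr_ge0 => i _; exact: sumr_ge0.
have [kw kwP] := approx_width_le s m0.
have [kc [lc kcP]] := approx_cost_le s D m0.
pose ns : nat := (\sum_(l <- iota 0 n) sa_nnz (gather_sas R d n D bin l))%N.
pose Cdep : R := (8 + d * n * s * 4)%:R + (d * n * s)%:R * c.
pose Cnnz : R := (gather_nnz_FF R d n D w)%:R + kc%:R * c + lc%:R * (c + 4).
pose CB : R := 5 + c + n%:R * c + 2 * C0 + Ad.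
have c0 : 0 <= c by lra.
have P1 : 0 <= D%:R :> R by [].
have P2 : 0 <= Cdep by rewrite addr_ge0// mulr_ge0.
have P3 : 0 <= kw%:R * c by rewrite mulr_ge0.
have P4 : 0 <= CB by rewrite /CB !addr_ge0// ?mulr_ge0//; lra.
have P5 : 0 <= (nnz (embed_W R d n) + nnz (embed_B R d n))%:R :> R by [].
have P6 : 0 <= Cnnz by rewrite /Cnnz !addr_ge0// mulr_ge0//; lra.
have P7 : 0 <= ns%:R :> R by [].
(* All summands are nonnegative and fixed before eps is introduced; the separate bounds of the
   statement each rely on one of them. *)
pose C : R := 1 + D%:R + Cdep + kw%:R * c + CB
   + (nnz (embed_W R d n) + nnz (embed_B R d n))%:R + Cnnz + ns%:R.
have [CD [Cd [Ck [Cb [Ce [Cn [Cs C1]]]]]]] : D%:R <= C /\ Cdep <= C /\ kw%:R * c <= C /\ CB <= C /\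
   (nnz (embed_W R d n) + nnz (embed_B R d n))%:R <= C /\ Cnnz <= C /\ ns%:R <= C /\ 1 <= C.
  rewrite /C; move: P1 P2 P3 P4 P5 P6 P7.
  move: (D%:R : R) (Cdep) (kw%:R * c) (CB) ((nnz (embed_W R d n) + nnz (embed_B R d n))%:R : R)
    (Cnnz) (ns%:R : R) => x1 x2 x3 x4 x5 x6 x7; clear.
  by do ?split; lra.
have C0' : 0 <= C by exact: le_trans C1.
clearbody Ad C0 C.
exists C => eps e01.
have [] := Hc eps e01.
set P := _ `^ (1 / gam); set Q := _ `^ ((d * n)%:R / gam).
rewrite -[(7 * (d * n))%N]/(7 * (d * n))%N mulnA.
set Bt := _ `^ (_ * t / gam); set ly := ln _.
move=> [PP1 Q1 QB ly0] [N [L [dl [[N0 dl0 E1 E2 E3] [F1 F2 F3 F4]]]]].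
have /andP[e0 e1] := e01.
have Q0 : 0 <= Q by exact: le_trans Q1.
have Bt1 : 1 <= Bt by exact: le_trans Q1 QB.
have Bt0 : 0 <= Bt by exact: le_trans Bt1.
have ly1 : 1 <= 1 + ly by rewrite lerDl.
have ly0' : 0 <= 1 + ly by exact: le_trans ly1.
have N0' : 0 < N%:R :> R by rewrite ltr0n.
(* Bounds all weights of the last block at the chosen parameters. *)
pose B : R := 5 + dl^-1 + (N ^ (d * n) * n)%:R + 2 * C0 + Ad.
have dli : 0 <= dl^-1 by rewrite invr_ge0 ltW.
have nN0 : 0 <= (N ^ (d * n) * n)%:R :> R by [].
have loc p q (j : {ffun 'I_d * 'I_n -> 'I_N}) :
     exists2 c : seq nat -> R, forall w, `|c w| <= C0 &
       forall x, in_box (fun k => (j k)%:R / N%:R) (fun k => (j k).+1%:R / N%:R) x ->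
       `|f x p q - \sum_(w <- words s (d * n)) c w * monomial (rev (enum {: 'I_d * 'I_n})) w x|
        <= eps / 4.
  have [_ H _] := HCf (p, q).
  have [|k|c' h1 h2] := H N%:R^-1 (fun k => (j k)%:R / N%:R) (fun k => (j k).+1%:R / N%:R).
  - by rewrite invr_ge0.
  - split; first by rewrite divr_ge0.
    + by rewrite ltr_pM2r ?invr_gt0// ltr_nat.
    + by rewrite ler_pdivrMr// mul1r ler_nat.
    + by rewrite -mulrBl -natr1 addrAC subrr add0r mul1r.
  exists c' => [w'|x xb]; first by apply: le_trans (h1 w') (CfC0 _).
  apply: le_trans (h2 x xb) _; apply: le_trans E1.
  (* With h = 1/N, the product h^s h^lam is h^gam. *)
  rewrite -powR_mulrn ?invr_ge0// -powRD; last by rewrite gt_eqF.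
  by rewrite ler_wpM2r ?powR_ge0// CfC0.
have [BdB BnB B4B BCB BAB] : [/\ 1 + dl^-1 <= B, (N ^ (d * n) * n)%:R <= B, 4 <= B,
    2 * C0 <= B & Ad <= B].
  rewrite /B; move: dli nN0 C01 Ad0.
  move: (dl^-1) ((N ^ (d * n) * n)%:R : R) (C0) (Ad) => x1 x2 x3 x4; clear; split; lra.
have B1 : 1 <= B by apply: le_trans B4B; rewrite ler1n.
have decB u r : `|decode R hD u r| <= B by exact: le_trans (decA u r) BAB.
have [F [Fd Fw FB Fn FA]] := @approx_fnn R d n s D N L dl B C0 (eps / 4) hD f N0 n0 dl0 C01
  BdB BnB B4B BCB decB loc.
have BC : B <= C * Bt.
  apply: (@le_trans _ _ (CB * Bt)); last by rewrite ler_wpM2r.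
  have h1 : (N ^ (d * n) * n)%:R <= n%:R * c * Bt.
    rewrite mulnC natrM -mulrA ler_wpM2l//; apply: le_trans F1 _.
    by rewrite ler_wpM2l.
  have h2 : 5 + 2 * C0 + Ad <= (5 + 2 * C0 + Ad) * Bt.
    by rewrite ler_peMr// !addr_ge0// mulr_ge0// (le_trans _ C01).
  rewrite /CB /B; move: h1 h2 F2.
  by move: (dl^-1) ((N ^ (d * n) * n)%:R : R) (C0) (Ad) (n%:R : R) (c) (Bt) => x1 x2 x3 x4 x5 x6 x7; clear; lra.
have [T1 T2 T3] := @gather_tf_bdd R d n D w bin F B n0 B1 FB.
have weak_SA (B' : R) A : 1 <= B' -> sa_bdd 1 A -> @sa_bdd R D B' A.
  by move=> BB HA h hin; have [a1 a2 a3 a4] := HA h hin; split; exact: bdd_weaken_mx BB _.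
exists (gather_tf n w bin F); split.
- split; [exact: gather_tf_length|by []|].
  by apply: le_trans CD _; rewrite ler_peMr.
- split.
  + by move=> l ln; exact: (gather_tf_sizes w F n0 b0).
  + by move=> g /gather_tf_ffmids ->.
  + split.
      apply: (@le_trans _ _ (Cdep * (1 + ly))); last by rewrite ler_wpM2r.
      have -> : fnn_depth (tf_ffK (gather_tf n w bin F)) = (8 + d * n * s * 4 + d * n * s * L)%N.
        by rewrite [LHS]Fd mulnDr; move: (d * n * s * 4)%N (d * n * s * L)%N; clear; lia.
      rewrite natrD natrM /Cdep mulrDl; apply: lerD.
        by rewrite ler_peMr.
      by rewrite -mulrA ler_wpM2l.
    rewrite [fnn_width _]Fw; apply: (@le_trans _ _ (kw%:R * c * Q)); last by rewrite ler_wpM2r.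
    apply: (@le_trans _ _ (kw * N ^ (d * n))%:R); first by rewrite ler_nat kwP.
    by rewrite natrM -mulrA ler_wpM2l.
- move=> p q.
  have Teq X : in_cube X -> tf_eval (gather_tf n w bin F) X p q =
      fnn_eval F (col q (gather_state D n X)) p 0.
    by move=> Xc; rewrite gather_tf_eval// mxE.
  (* The bad set consists of the slabs [i/N - dl, i/N], 0 <= i <= N, in every coordinate. *)
  apply: (@Ltnorm_le R d n t eps Mb N.+1 (fun i => i%:R / N%:R - dl) (fun i => i%:R / N%:R)) => //.
  + exact: le_trans Mb1.
  + by move=> i; rewrite lerBlDr lerDl ltW.
  + move=> X Xc; rewrite Teq//; apply: le_trans (ler_normB _ _) _; apply: lerD.
      by have [] := FA X Xc p q.
    by have [_ _ /(_ X Xc)] := HCf (p, q) => h; exact: le_trans h (CfC0 _).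
  + move=> X Xc bad; rewrite Teq//.
    have /choice[j0 Hj] : forall k : 'I_d * 'I_n, exists j : 'I_N,
        j%:R / N%:R < X k.1 k.2 < j.+1%:R / N%:R - dl.
      by move=> k; exact: cell_of N0 dl0 (Xc _ _) (bad k).
    have [_ /(_ [ffun k => j0 k])] := FA X Xc p q.
    move=> H; apply: le_trans (H _) _; first by move=> k; rewrite ffunE; exact: Hj.
    (* The Taylor error and the multiplication error are at most eps/4 each. *)
    have A34 : 3 * C0 * nw * (2 ^+ (d * n * s) * 4 ^- L) <= A3 * 4 ^- L.
      by rewrite mulrA ler_wpM2r ?invr_ge0 ?exprn_ge0// lerDr.
    by move: A34 E3 e0; rewrite /nw; clear; lra.
  + rewrite (eq_bigr (fun=> dl)); last by move=> i _; rewrite opprB addrCA subrr addr0.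
    by rewrite sumr_const card_ord -[dl *+ _]mulr_natl.
- have [T11 T12] := T1; split.
  + by split; exact: bdd_weaken_mx C1 _.
  + have [t1' t2 t3] := T2; split; try exact: fnn_bdd_weaken BC _.
    by move=> g /t2; exact: fnn_bdd_weaken BC.
  + move=> A /T3; apply: weak_SA.
    by rewrite -[X in X <= _]mulr1; apply: ler_pM.
- split.
  + exact: Ce.
  + rewrite gather_tf_nnz_FF; apply: (@le_trans _ _ (Cnnz * Q)); last by rewrite ler_wpM2r.
    have h1 : (fnn_nnz F)%:R <= kc%:R * (N ^ (d * n))%:R + lc%:R * (L%:R + 4) :> R.
      rewrite -!natrM -natrD -natrM -natrD ler_nat.
      by apply: leq_trans Fn _; exact: kcP.
    have h2 : kc%:R * (N ^ (d * n))%:R <= kc%:R * c * Q by rewrite -mulrA ler_wpM2l.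
    have h3 : lc%:R * (L%:R + 4) <= lc%:R * (c + 4) * Q.
      by rewrite -mulrA ler_wpM2l// mulrDl lerD// ler_peMr.
    have h4 : (gather_nnz_FF R d n D w)%:R <= (gather_nnz_FF R d n D w)%:R * Q by rewrite ler_peMr.
    rewrite natrD /Cnnz !mulrDl -addrA; apply: lerD => //.
    by apply: le_trans h1 _; apply: lerD.
  + by rewrite /tf_nnz_SA gather_tf_sas// big_map.
Qed.
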